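(* Let $f:[0,1]\to[0,1]$ be the Lanford map $f(x)=2x+\frac12x(1-x)\bmod 1$, and let $\rho$ be its absolutely continuous invariant probability density. (a) The Lyapunov exponent $L_{exp}:=\int_0^1\log|f'(x)|\,\rho(x)\,dx$ satisfies $L_{exp}=0.657\,661\,780\,006\,597\,677\,541\,582\,413\,823\,832\,065\,743\,241\,069\,580\,012\,201\,953\,952\,802\,691\,632\,666\,111\,554\,023\,759\,556\,459\,752\,915\,174\,829\,642\,156\,331\,798\,026\,301\,488\,594\,89\pm2\times10^{-128}$. (b) The diffusion coefficient of $f$ for the observable $\phi(x)=x^2$ satisfies $\sigma_f^2(\phi)=0.360\,109\,486\,199\,160\,672\,898\,824\,186\,828\,576\,749\,241\,669\,997\,797\,228\,864\,358\,977\,865\,838\,174\,403\,103\,617\,477\,981\,402\,783\,211\,083\,646\,769\,039\,410\,848\,031\,999\,960\,664\,7\pm6\times10^{-124}$.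
   Context: The diffusion coefficient (variance in the central limit theorem for Birkhoff sums) of an observable $A$ is $\sigma_f^2(A)=\lim_{n\to\infty}\frac1n\int_0^1\big(\sum_{k=0}^{n-1}A\circ f^k-n\int_0^1A\rho\big)^2\rho\,dx$, equivalently given by the Green–Kubo formula $\sigma_f^2(A)=\int\tilde A^2\rho\,dx+2\sum_{n\ge1}\int\tilde A\,(\tilde A\circ f^n)\rho\,dx$ with $\tilde A=A-\int A\rho$. *)

(* Defs.v *)
From HB Require Import structures.
From mathcomp Require Import all_boot all_order all_algebra.
From mathcomp Require Import all_classical all_reals all_analysis.
Set Implicit Arguments. Unset Strict Implicit. Unset Printing Implicit Defensive.
Import Order.TTheory GRing.Theory Num.Theory.
Import numFieldNormedType.Exports.
Local Open Scope classical_set_scope.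
Local Open Scope ring_scope.

Definition I01 {R : realType} : set R := `[0%R, 1%R]%classic.

Definition mod1 {R : realType} (x : R) : R := x - (Num.floor x)%:~R.

Definition lanford {R : realType} (x : R) : R :=
  mod1 (2 * x + 2^-1 * x * (1 - x)).

Definition decfrac {R : realType} (s : seq nat) : R :=
  \sum_(i < size s) (nth 0%N s i)%:R / 10 ^+ i.+1.

Definition acip_density {R : realType} (f : R -> R) (rho : R -> R) : Prop :=
  measurable_fun I01 rho /\
  (forall x, I01 x -> 0 <= rho x) /\
  (\int[@lebesgue_measure R]_(x in I01) (rho x)%:E = 1)%E /\
  (forall A : set R, measurable A -> A `<=` I01 -> (
     \int[@lebesgue_measure R]_(x in I01 `&` f @^-1` A) (rho x)%:E =
     \int[@lebesgue_measure R]_(x in A) (rho x)%:E)%E).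

Definition lyap_integral {R : realType} (f : R -> R) (rho : R -> R) : \bar R :=
  \int[@lebesgue_measure R]_(x in I01) (ln `|derive1 f x| * rho x)%:E.

Definition birkhoff {R : realType} (f : R -> R) (A : R -> R) (n : nat) (x : R) : R :=
  \sum_(k < n) A (iter k f x).

(* n-th term of the sequence whose limit defines the diffusion coefficient *)
Definition diffusion_seq {R : realType} (f : R -> R) (rho A : R -> R) (n : nat) : R :=
  let m := Rintegral (@lebesgue_measure R) I01 (fun x => A x * rho x) in
  n%:R^-1 * Rintegral (@lebesgue_measure R) I01
     (fun x => (birkhoff f A n x - n%:R * m) ^+ 2 * rho x).

(* Main.v *)
(* Put [s = 5/2 - x]. The inverse branches of the Lanford map send [y] to the
   points with [s_i = sqrt (25/4 - 2 y - 2 i)], [i = 0, 1], and its transfer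
   operator is [P u (y) = sum_i u (5/2 - s_i) / s_i]. A mean-zero function is
   bounded by half its Lipschitz constant, and this makes [P] contract the
   Lipschitz constant of mean-zero functions by [theta = 0.886]. Hence [P^n 1]
   converges to an invariant density, which is the only one, and correlations
   decay exponentially: with [m = int x^2 rho] and [chi - P chi = (x^2 - m) rho],
     [sigma^2 = 2 int (x^2 - m) chi - int (x^2 - m)^2 rho].
   If [E] is a polynomial then the image under [P] of [s E (s^2)] is the
   polynomial [E (25/4 - 2 y) + E (17/4 - 2 y)], so an approximate fixed point
   [h = s E] and an approximate solution [chi = s F] of the second equation,
   with integer coefficients, have residuals bounded by exact computation. A
   residual with sup norm [e] and Lipschitz constant [M] moves the solution by
   at most [3 n e + 5 M theta^n] for every [n], so that a crude [M] suffices.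
   The exponent [int ln (5/2 - x) rho] is computed by integration by parts. *)
Require Import Defs.
From Stdlib Require Import BinInt.
From HB Require Import structures.
From mathcomp Require Import all_boot all_order all_algebra.
From mathcomp Require Import all_classical all_reals all_analysis.
From mathcomp Require Import ssrZ zify ring lra measurable_realfun.
Import Order.TTheory GRing.Theory Num.Theory.
Import numFieldNormedType.Exports.
Local Open Scope classical_set_scope.
Local Open Scope ring_scope.
Set Implicit Arguments. Unset Strict Implicit. Unset Printing Implicit Defensive.

(** Nothing is assumed about the regularity of [rho], so it must be identified almost everywhere
    with the limit of [P^n 1] before any estimate applies; both quantities then depend on it only
    through integrals. The functional-analytic constants (Lipschitz bounds, [theta], the sup bound
    3) are derived by hand and need not be sharp: accuracy comes from the residuals alone. The
    variable [w = (s^2 - 17/4) / 2] is [1 - quad x], and [quad (br i y) = y + i]. Hence [s E] has as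
    image the sum of [E] at [w = 1 - y] and at [w = - y]. All three arguments stay in [[-1, 1]],
    where Chebyshev coefficients control the sup norm. To compare [h] with [P h], both are expanded
    in [U_k (1 - 2 x)] by Clenshaw recurrences on rounded integer lists. Rounding errors are bounded
    a priori by list lengths, so only a handful of integer checks is left to computation. The scale
    exceeds [10^146]: 16 guard digits below the unit [10^-130]. The error of [h] enters the second
    equation and is amplified there once more, by about [2 * 3 * 2920], which is why the second
    value is enclosed less tightly. *)

Ltac norm_lra :=
  rewrite !ler_norml; repeat move=> /andP[? ?]; apply/andP; split; lra.

(** * Bounded and Lipschitz observables *)

Section Mean.
Context {R : realType}.
Local Notation mu := (@lebesgue_measure R).
Implicit Types (u w : R -> R) (x y z L M : R).

Definition mean u : R := Rintegral mu I01 u.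

(** Closed under sums, products and composition with the map, and always integrable on [[0, 1]]:
    integrability side conditions reduce to membership in this class. *)
Definition bmeas u : Prop :=
  measurable_fun I01 u /\ exists M, forall x, I01 x -> `|u x| <= M.

Definition lip u L : Prop :=
  forall x y, I01 x -> I01 y -> `|u x - u y| <= L * `|x - y|.

Lemma I01E x : I01 x <-> 0 <= x <= 1.
Proof. by rewrite /I01/= in_itv/=. Qed.

Lemma measurable_I01 : measurable (@I01 R).
Proof. exact: measurable_itv. Qed.

Lemma mu_I01 : mu I01 = 1%E.
Proof. by rewrite /I01 lebesgue_measure_itv/= lte_fin ltr01 oppr0 adde0. Qed.
Local Hint Resolve measurable_I01 : core.

Lemma bmeas_integrable u : bmeas u -> mu.-integrable I01 (EFin \o u).
Proof.
move=> [mu_ [M uM]]; apply: measurable_bounded_integrable => //.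
  by rewrite [X in (X < _)%E]mu_I01 ltry.
exists M; split; rewrite ?num_real// => N MN x Ix.
exact: le_trans (uM _ Ix) (ltW MN).
Qed.
Local Hint Resolve bmeas_integrable : core.

Lemma bmeas_ext u w : (forall x, I01 x -> u x = w x) -> bmeas u -> bmeas w.
Proof.
move=> uw [mu_ [M uM]]; split.
  by apply: eq_measurable_fun mu_ => x /[!inE]; exact: uw.
by exists M => x Ix; rewrite -uw// uM.
Qed.

Lemma bmeas_cst M : bmeas (fun=> M).
Proof. by split => //; exists `|M|. Qed.

Lemma bmeasD u w : bmeas u -> bmeas w -> bmeas (fun x => u x + w x).
Proof.
move=> [mu_ [M uM]] [mw [N wN]]; split; first exact: measurable_funD.
exists (M + N) => x Ix; apply: le_trans (ler_normD _ _) _.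
by rewrite lerD ?uM ?wN.
Qed.

Lemma bmeasM u w : bmeas u -> bmeas w -> bmeas (fun x => u x * w x).
Proof.
move=> [mu_ [M uM]] [mw [N wN]]; split; first exact: measurable_funM.
by exists (M * N) => x Ix; rewrite normrM ler_pM ?uM ?wN.
Qed.

Lemma bmeasN u : bmeas u -> bmeas (fun x => - u x).
Proof.
by move=> bu; apply: bmeas_ext (bmeasM (bmeas_cst (-1)) bu) => x _; rewrite mulN1r.
Qed.

Lemma bmeasB u w : bmeas u -> bmeas w -> bmeas (fun x => u x - w x).
Proof. by move=> bu bw; apply: bmeasD => //; exact: bmeasN. Qed.

Lemma bmeas_sum (n : nat) (F : nat -> R -> R) : (forall i, bmeas (F i)) ->
  bmeas (fun x => \sum_(i < n) F i x).
Proof.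
move=> bF; elim: n => [|n IH].
  by apply: bmeas_ext (bmeas_cst 0) => x _; rewrite big_ord0.
by apply: bmeas_ext (bmeasD IH (bF n)) => x _; rewrite big_ord_recr.
Qed.

Lemma eq_mean u w : (forall x, I01 x -> u x = w x) -> mean u = mean w.
Proof. by move=> uw; apply: eq_Rintegral => x /[!inE]; exact: uw. Qed.

Lemma mean_cst M : mean (fun=> M) = M.
Proof. by rewrite /mean Rintegral_cst// [X in fine X]mu_I01/= mulr1. Qed.

Lemma meanD u w : bmeas u -> bmeas w ->
  mean (fun x => u x + w x) = mean u + mean w.
Proof. by move=> bu bw; apply: RintegralD => //; exact: bmeas_integrable. Qed.

Lemma meanZ M u : bmeas u -> mean (fun x => M * u x) = M * mean u.
Proof. by move=> bu; apply: RintegralZl => //; exact: bmeas_integrable. Qed.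

Lemma meanB u w : bmeas u -> bmeas w ->
  mean (fun x => u x - w x) = mean u - mean w.
Proof. by move=> bu bw; apply: RintegralB => //; exact: bmeas_integrable. Qed.

Lemma mean_sum (n : nat) (F : nat -> R -> R) : (forall i, bmeas (F i)) ->
  mean (fun x => \sum_(i < n) F i x) = \sum_(i < n) mean (F i).
Proof.
move=> bF; elim: n => [|n IH].
  by rewrite big_ord0 -[RHS](mean_cst 0); apply: eq_mean => x _; rewrite big_ord0.
rewrite big_ord_recr/= -IH -meanD//; last exact: bmeas_sum.
by apply: eq_mean => x _; rewrite big_ord_recr.
Qed.

Lemma le_mean u w : bmeas u -> bmeas w -> (forall x, I01 x -> u x <= w x) ->
  mean u <= mean w.
Proof. by move=> bu bw uw; apply: le_Rintegral => //; exact: bmeas_integrable. Qed.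

Lemma le_mean_norm u M : bmeas u -> (forall x, I01 x -> `|u x| <= M) ->
  `|mean u| <= M.
Proof.
move=> bu uM; rewrite ler_norml; apply/andP; split.
  rewrite -[X in X <= _]mean_cst; apply: le_mean => //; first exact: bmeas_cst.
  by move=> x /uM; rewrite ler_norml => /andP[].
rewrite -[X in _ <= X]mean_cst; apply: le_mean => //; first exact: bmeas_cst.
by move=> x /uM; rewrite ler_norml => /andP[].
Qed.

Lemma I01_0 : I01 (0 : R). Proof. by rewrite I01E lexx ler01. Qed.
Lemma I01_1 : I01 (1 : R). Proof. by rewrite I01E lexx ler01. Qed.

Lemma lip_ge0 u L : lip u L -> 0 <= L.
Proof.
move=> /(_ 1 0 I01_1 I01_0); rewrite subr0 normr1 mulr1; exact: le_trans.
Qed.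

Lemma lip_bounded u L x : lip u L -> I01 x -> `|u x| <= `|u 0| + L.
Proof.
move=> lu Ix; have := lu _ _ Ix I01_0; rewrite subr0 => ux.
have L0 := lip_ge0 lu.
have x1 : L * `|x| <= L.
  by move/I01E : Ix => /andP[x0 x1]; rewrite ler_piMr// ger0_norm.
have := ler_normD (u x - u 0) (u 0); rewrite subrK; lra.
Qed.

Lemma lip_continuous u L : lip u L -> {within I01, continuous u}.
Proof.
move=> lu; apply/subspace_continuousP => x Ix.
apply/cvgrPdist_le => e e0.
have L0 := lip_ge0 lu.
(* [L] may vanish, hence the radius [e / (L + 1)]. *)
have L1 : 0 < L + 1 by lra.
near=> y.
have Iy : I01 y by near: y; exact: withinT.
apply: (le_trans (lu _ _ Ix Iy)).
have : `|x - y| <= e / (L + 1).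
  near: y; apply: cvg_within; apply/nbhs_normP; exists (e / (L + 1)).
    exact: divr_gt0.
  by move=> z /ltW.
rewrite ler_pdivlMr// => h.
have := normr_ge0 (x - y); nra.
Unshelve. all: by end_near. Qed.

Lemma lip_bmeas u L : lip u L -> bmeas u.
Proof.
move=> lu; split; last first.
  by exists (`|u 0| + L) => x; exact: lip_bounded.
apply: subspace_continuous_measurable_fun => //.
exact: lip_continuous lu.
Qed.

Lemma lip_ext u w L : (forall x, I01 x -> u x = w x) -> lip u L -> lip w L.
Proof. by move=> uw lu x y Ix Iy; rewrite -!uw//; exact: lu. Qed.

Lemma lip_le u L M : L <= M -> lip u L -> lip u M.
Proof.
move=> LM lu x y Ix Iy; apply: le_trans (lu _ _ Ix Iy) _.
by rewrite ler_wpM2r.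
Qed.

Lemma lip_cst M : lip (fun=> M) 0.
Proof. by move=> x y _ _; rewrite subrr normr0 mul0r. Qed.

Lemma lipD u w L M : lip u L -> lip w M -> lip (fun x => u x + w x) (L + M).
Proof.
move=> lu lw x y Ix Iy.
rewrite (_ : _ - _ = (u x - u y) + (w x - w y)); last by ring.
by rewrite mulrDl (le_trans (ler_normD _ _))// lerD// ?lu ?lw.
Qed.

Lemma lipZ u L M : lip u L -> lip (fun x => M * u x) (`|M| * L).
Proof.
by move=> lu x y Ix Iy; rewrite -mulrBr normrM -mulrA ler_wpM2l// lu.
Qed.

Lemma lipB u w L M : lip u L -> lip w M -> lip (fun x => u x - w x) (L + M).
Proof.
move=> lu lw; apply: lip_ext (lipD lu (lip_le _ (lipZ (-1) lw))) => [x _|].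
  by rewrite mulN1r.
by rewrite normrN1 mul1r.
Qed.

Lemma lipM u w L M A B : lip u L -> lip w M ->
  (forall x, I01 x -> `|u x| <= A) -> (forall x, I01 x -> `|w x| <= B) ->
  lip (fun x => u x * w x) (L * B + A * M).
Proof.
move=> lu lw uA wB x y Ix Iy.
rewrite (_ : _ - _ = (u x - u y) * w x + u y * (w x - w y)); last by ring.
apply: le_trans (ler_normD _ _) _; rewrite !normrM mulrDl; apply: lerD.
  by rewrite mulrAC ler_pM ?wB ?lu.
by rewrite -mulrA ler_pM ?uA ?lw.
Qed.

Lemma lip_id : lip id 1.
Proof. by move=> x y _ _; rewrite mul1r. Qed.

Lemma mean_FTC (F f : R -> R) : (forall x, I01 x -> is_derive x 1 F (f x)) ->
  {within I01, continuous f} -> mean f = F 1 - F 0.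
Proof.
move=> dF cf; rewrite /mean /Rintegral /I01.
have cF x : I01 x -> F y @[y --> x] --> F x.
  move=> /dF dFx; apply/differentiable_continuous/derivable1_diffP.
  exact: ex_derive.
rewrite (@continuous_FTC2 _ f F 0 1)//; first split.
- by move=> x /subset_itv_oo_cc /dF ?; exact: ex_derive.
- by apply: cvg_at_right_filter; apply: cF; exact: I01_0.
- by apply: cvg_at_left_filter; apply: cF; exact: I01_1.
- by move=> x /subset_itv_oo_cc /dF ?; rewrite derive1E derive_val.
Qed.

Lemma mean_id : mean id = 2^-1.
Proof.
have dF x : I01 x -> is_derive x 1 (fun x : R => 2^-1 * x ^+ 2) (id x).
  by move=> _; apply: is_derive_eq; rewrite /GRing.scale/=; field.
rewrite (mean_FTC dF); first by lra.
by apply: continuous_subspaceT => x; exact: cvg_id.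
Qed.

(* [|x - y| <= x (1 - y) + y (1 - x)] on the unit square, and the right-hand
   side has mean [1/2] in [y]. *)
Lemma mean0_lip u L x : lip u L -> mean u = 0 -> I01 x -> `|u x| <= L / 2.
Proof.
move=> lu u0 Ix.
have bu := lip_bmeas lu; have L0 := lip_ge0 lu.
have bid := lip_bmeas lip_id.
have -> : u x = mean (fun y => u x - u y).
  by rewrite meanB ?mean_cst ?u0 ?subr0//; exact: bmeas_cst.
pose g y := L * (x + (1 - 2 * x) * y).
have bg : bmeas g.
  by apply: bmeasM (bmeas_cst _) _; apply: bmeasD (bmeas_cst _) _;
    exact: bmeasM (bmeas_cst _) bid.
have mg : mean g = L / 2.
  rewrite /g meanZ; last first.
    by apply: bmeasD (bmeas_cst _) _; exact: bmeasM (bmeas_cst _) bid.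
  rewrite meanD ?mean_cst ?meanZ//; [|exact: bmeas_cst|exact: bmeasM (bmeas_cst _) bid].
  by rewrite [mean _]mean_id; lra.
have le_g y : I01 y -> `|u x - u y| <= g y.
  move=> Iy; apply: le_trans (lu _ _ Ix Iy) _; rewrite /g ler_wpM2l//.
  move: Ix Iy => /I01E/andP[x0 x1] /I01E/andP[y0 y1].
  by rewrite ler_norml; apply/andP; split; nra.
rewrite -mg; have bd : bmeas (fun y => u x - u y) by apply: bmeasB => //; exact: bmeas_cst.
rewrite ler_norml -mulN1r -meanZ//; apply/andP; split; apply: le_mean => //.
- exact: bmeasM (bmeas_cst _) bg.
- by move=> y /le_g; rewrite mulN1r ler_norml => /andP[].
- by move=> y /le_g; rewrite ler_norml => /andP[].
Qed.

End Mean.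
#[global] Hint Resolve measurable_I01 : core.

(** * The transfer operator *)

Section Transfer.
Context {R : realType}.
Implicit Types (u w : R -> R) (x y z L M c : R) (i : nat).

Definition root_br i y : R := Num.sqrt (25 / 4 - 2 * y - 2 * i%:R).

Definition br i y : R := 5 / 2 - root_br i y.

Definition transfer u y : R :=
  u (br 0 y) / root_br 0 y + u (br 1 y) / root_br 1 y.

Definition quad x : R := 2 * x + 2^-1 * x * (1 - x).

Lemma sqr_root_br i y : (i <= 1)%N -> I01 y ->
  root_br i y ^+ 2 = 25 / 4 - 2 * y - 2 * i%:R.
Proof.
move=> i1 /I01E/andP[y0 y1]; rewrite sqr_sqrtr//.
have : i%:R <= 1 :> R by rewrite lern1.
lra.
Qed.

Lemma root_br_le i y : (i <= 1)%N -> I01 y -> root_br i y <= 5 / 2.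
Proof.
move=> i1 Iy; have h : 0 <= 5 / 2 :> R by lra.
rewrite -(@ler_pXn2r _ 2)// ?nnegrE ?sqrtr_ge0//.
rewrite sqr_root_br//; move/I01E : Iy => /andP[y0 y1].
by have : 0 <= i%:R :> R by []; lra.
Qed.

(** The minima of [s_i] on [[0, 1]], reached at [y = 1]: [sqrt 17 / 2 = 2.06155...], rounded down to
    a rational, and exactly [3 / 2]. *)
Definition br_min i : R := if i == 0%N then 20614 / 10000 else 3 / 2.

Lemma br_min_gt0 i : 0 < br_min i.
Proof. by rewrite /br_min; case: ifP => _; lra. Qed.

Lemma root_br_ge i y : (i <= 1)%N -> I01 y -> br_min i <= root_br i y.
Proof.
move=> i1 Iy; rewrite -(@ler_pXn2r _ 2)// ?nnegrE ?sqrtr_ge0//; last first.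
  exact/ltW/br_min_gt0.
rewrite sqr_root_br//; move/I01E : Iy => /andP[y0 y1]; rewrite /br_min.
by case: i i1 => [|[|//]] _ /=; lra.
Qed.

Lemma root_br_gt0 i y : (i <= 1)%N -> I01 y -> 0 < root_br i y.
Proof. by move=> i1 Iy; rewrite (lt_le_trans (br_min_gt0 i))// root_br_ge. Qed.

Lemma br_I01 i y : (i <= 1)%N -> I01 y -> I01 (br i y).
Proof.
move=> i1 Iy; apply/I01E; rewrite /br subr_ge0 root_br_le//=.
have := root_br_ge i1 Iy; rewrite /br_min.
by case: ifP => _; lra.
Qed.

Lemma quad_br i y : (i <= 1)%N -> I01 y -> quad (br i y) = y + i%:R.
Proof.
move=> i1 Iy; have := sqr_root_br i1 Iy; rewrite /quad /br.
by set r := root_br i y => h; lra.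
Qed.

Lemma root_br_lip i y z : (i <= 1)%N -> I01 y -> I01 z ->
  `|root_br i y - root_br i z| <= `|y - z| / br_min i.
Proof.
move=> i1 Iy Iz.
have := root_br_ge i1 Iy; have := root_br_ge i1 Iz; have := br_min_gt0 i.
have := sqr_root_br i1 Iy; have := sqr_root_br i1 Iz.
set r := root_br i y; set s := root_br i z; set c := br_min i => ez ey c0 sc rc.
rewrite ler_pdivlMr//.
have e : (r - s) * (r + s) = 2 * (z - y) by lra.
have e2 : `|r - s| * (r + s) = 2 * `|y - z|.
  have rs0 : 0 <= r + s by lra.
  by rewrite -[X in _ * X = _](ger0_norm rs0) -normrM e normrM distrC ger0_norm.
have := normr_ge0 (r - s); nra.
Qed.

(** With respect to [y], the branch has derivative [1 / s] and [1 / s] has derivative [1 / s^3];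
    these give the two powers, the proof using difference quotients in place of derivatives. *)
Lemma br_term_lip i u L M y z : (i <= 1)%N -> lip u L ->
  (forall x, I01 x -> `|u x| <= M) -> I01 y -> I01 z ->
  `|u (br i y) / root_br i y - u (br i z) / root_br i z| <=
  (L / br_min i ^+ 2 + M / br_min i ^+ 3) * `|y - z|.
Proof.
move=> i1 lu uM Iy Iz.
have hd := root_br_lip i1 Iy Iz.
have L0 := lip_ge0 lu.
have M0 : 0 <= M by apply: le_trans (uM _ (br_I01 i1 Iy)).
have c0 := br_min_gt0 i.
have r0 := root_br_gt0 i1 Iy; have s0 := root_br_gt0 i1 Iz.
have ri : (root_br i y)^-1 <= (br_min i)^-1.
  by rewrite lef_pV2 ?posrE// root_br_ge.
have si : (root_br i z)^-1 <= (br_min i)^-1.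
  by rewrite lef_pV2 ?posrE// root_br_ge.
have uL : `|u (br i y) - u (br i z)| <= L * (`|y - z| / br_min i).
  apply: le_trans (lu _ _ (br_I01 i1 Iy) (br_I01 i1 Iz)) _.
  rewrite ler_wpM2l// /br (_ : _ - _ = root_br i z - root_br i y); last by lra.
  by rewrite distrC.
rewrite (_ : _ - _ = (u (br i y) - u (br i z)) / root_br i y +
  u (br i z) * ((root_br i z - root_br i y) * ((root_br i y)^-1 * (root_br i z)^-1))); last first.
  by field; rewrite !gt_eqF.
apply: le_trans (ler_normD _ _) _; rewrite [leRHS]mulrDl; apply: lerD.
  rewrite normrM (_ : L / _ * _ = L * (`|y - z| / br_min i) * (br_min i)^-1); last first.
    by field; rewrite gt_eqF.
  by apply: ler_pM => //; rewrite ger0_norm// invr_ge0 ltW.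
rewrite normrM (_ : M / _ * _ = M * (`|y - z| / br_min i * ((br_min i)^-1 * (br_min i)^-1))); last first.
  by field; rewrite gt_eqF.
apply: ler_pM => //; first exact/uM/br_I01.
rewrite normrM; apply: ler_pM => //; first by rewrite distrC.
have ri0 : 0 <= (root_br i y)^-1 by rewrite invr_ge0 ltW.
have si0 : 0 <= (root_br i z)^-1 by rewrite invr_ge0 ltW.
by rewrite ger0_norm ?mulr_ge0//; apply: ler_pM.
Qed.

(** The constants are the sums over both branches of [br_min^-2] and [br_min^-3], about 0.6798 and
    0.41046, rounded up. *)
Lemma transfer_lip u L M : lip u L -> (forall x, I01 x -> `|u x| <= M) ->
  lip (transfer u) (68 / 100 * L + 4105 / 10000 * M).
Proof.
move=> lu uM y z Iy Iz; rewrite /transfer.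
have h0 := br_term_lip (leq0n 1) lu uM Iy Iz.
have h1 := br_term_lip (leqnn 1) lu uM Iy Iz.
have L0 := lip_ge0 lu.
have M0 : 0 <= M by apply: le_trans (uM _ Iy).
set a := _ / root_br 0 y in h0 *; set b := _ / root_br 1 y in h1 *.
set a' := _ / root_br 0 z in h0 *; set b' := _ / root_br 1 z in h1 *.
rewrite (_ : _ - _ = (a - a') + (b - b')); last by ring.
apply: le_trans (ler_normD _ _) _; apply: le_trans (lerD h0 h1) _.
rewrite -mulrDl ler_wpM2r//.
have hA : (br_min 0 ^+ 2)^-1 + (br_min 1 ^+ 2)^-1 <= 68 / 100 :> R.
  by rewrite /br_min/=; lra.
have hB : (br_min 0 ^+ 3)^-1 + (br_min 1 ^+ 3)^-1 <= 4105 / 10000 :> R.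
  by rewrite /br_min/=; lra.
have := ler_wpM2l L0 hA; have := ler_wpM2l M0 hB; rewrite !mulrDr; lra.
Qed.

Lemma transferD u w y : transfer (fun x => u x + w x) y = transfer u y + transfer w y.
Proof. by rewrite /transfer; ring. Qed.

Lemma transferB u w y : transfer (fun x => u x - w x) y = transfer u y - transfer w y.
Proof. by rewrite /transfer; ring. Qed.

Lemma transferZ M u y : transfer (fun x => M * u x) y = M * transfer u y.
Proof. by rewrite /transfer; ring. Qed.

Lemma transfer_ext u w y : (forall x, I01 x -> u x = w x) -> I01 y ->
  transfer u y = transfer w y.
Proof. by move=> uw Iy; rewrite /transfer !uw//; exact: br_I01. Qed.

Lemma le_transfer u w y : (forall x, I01 x -> u x <= w x) -> I01 y ->
  transfer u y <= transfer w y.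
Proof.
move=> uw Iy; rewrite /transfer; apply: lerD.
  by rewrite ler_wpM2r ?invr_ge0 ?(ltW (root_br_gt0 _ _))// uw//; exact: br_I01.
by rewrite ler_wpM2r ?invr_ge0 ?(ltW (root_br_gt0 _ _))// uw//; exact: br_I01.
Qed.

End Transfer.

(** * Pushforward measures and the two monotone branches *)

Section Branches.
Context {R : realType}.
Local Notation mu := (@lebesgue_measure R).
Implicit Types (u w psi : R -> R) (x y z a b L M : R) (i : nat).

Definition push_density (g w : R -> R) (A : set R) : \bar R :=
  \int[mu]_(x in I01 `&` g @^-1` A) (w x)%:E.

(** Open rays form a pi-system generating the Borel sets, and the rays []-n, +oo[] exhaust the line
    with finite mass. The duality below uses it with [g1 = lanford] and [g2 = id]. *)
Lemma push_density_unique (g1 w1 g2 w2 : R -> R) :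
  measurable_fun I01 g1 -> measurable_fun I01 g2 -> bmeas w1 -> bmeas w2 ->
  (forall x, I01 x -> 0 <= w1 x) -> (forall x, I01 x -> 0 <= w2 x) ->
  (forall a, push_density g1 w1 `]a, +oo[ = push_density g2 w2 `]a, +oo[) ->
  forall A, measurable A -> push_density g1 w1 A = push_density g2 w2 A.
Proof.
move=> mg1 mg2 bw1 bw2 w10 w20 eq12.
have meas g w : measurable_fun I01 g -> bmeas w -> (forall x, I01 x -> 0 <= w x) ->
    {m : {measure set R -> \bar R} | m = push_density g w :> (set R -> \bar R)}.
  move=> mg bw w0.
  have p0 : push_density g w set0 = 0%E.
    by rewrite /push_density preimage_set0 setI0 integral_set0.
  have pge0 A : (0 <= push_density g w A)%E.
    by apply: integral_ge0 => x [Ix _]; rewrite lee_fin w0.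
  have padd : semi_sigma_additive (push_density g w).
    move=> F mF tF mUF; rewrite /push_density preimage_bigcup setI_bigcupr.
    have mgF k : measurable (I01 `&` g @^-1` (F k)) by exact: (mg measurable_I01 _ (mF k)).
    rewrite integral_bigcup//.
    - apply: is_cvg_ereal_nneg_natsum_cond => n _ _.
      by apply: integral_ge0 => x [Ix _]; rewrite lee_fin w0.
    - by apply: trivIset_setIl; move=> i j _ _ [x [xi xj]];
        apply: tF => //; exists (g x).
    - apply: integrableS (bmeas_integrable bw) => //.
      + exact: measurable_I01.
      + exact: bigcupT_measurable.
      + by move=> x [k _ [Ix _]].
  by exists (HB.pack_for {measure set R -> \bar R} (push_density g w)
    (isMeasure.Build _ _ _ (push_density g w) p0 pge0 padd)).
have [m1 m1E] := meas _ _ mg1 bw1 w10.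
have [m2 m2E] := meas _ _ mg2 bw2 w20.
move=> A mA; rewrite -m1E -m2E.
apply: (@measure_unique _ _ _ (@RGenOInfty.G R) (fun n => `](- n%:R), +oo[%classic)) => //.
- exact: RGenOInfty.measurableE.
- move=> _ _ [a ->] [b ->]; exists (Num.max a b).
  by apply/seteqP; split => x /=; rewrite !in_itv/= !andbT gt_max => /andP.
- by move=> i; eexists.
- rewrite -subTset => x _; exists (Num.truncn `|x|).+1 => //=.
  rewrite in_itv/= andbT ltrNl; apply: le_lt_trans (truncnS_gt _).
  by rewrite -normrN ler_norm.
- by move=> _ [a ->]; rewrite m1E m2E.
- move=> k; rewrite m1E.
  have : (\int[mu]_(x in I01) (w1 x)%:E)%E \is a fin_num.
    apply: integrable_fin_num (bmeas_integrable bw1); exact: measurable_I01.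
  rewrite fin_numElt => /andP[_]; apply: le_lt_trans.
  apply: ge0_subset_integral; last by move=> x [].
  + by apply: mg1 => //; exact: measurable_itv.
  + exact: measurable_I01.
  + by apply/measurable_EFinP; case: bw1.
  + by move=> x Ix; rewrite lee_fin w10.
Qed.

(** The interior discontinuity of the map, where [quad] takes the value 1. *)
Definition cut : R := br 0 1.

Lemma br1_0 : br 1 0 = cut.
Proof. by rewrite /cut /br /root_br; congr (_ - Num.sqrt _); lra. Qed.

Lemma br0_0 : br 0 0 = 0 :> R.
Proof.
have h : 0 <= 5 / 2 :> R by lra.
rewrite /br /root_br (_ : 25 / 4 - _ - _ = (5 / 2) ^+ 2); last lra.
by rewrite sqrtr_sqr ger0_norm// subrr.
Qed.

Lemma br1_1 : br 1 1 = 1 :> R.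
Proof.
have h : 0 <= 3 / 2 :> R by lra.
rewrite /br /root_br (_ : 25 / 4 - _ - _ = (3 / 2) ^+ 2); last lra.
by rewrite sqrtr_sqr ger0_norm//; lra.
Qed.

Lemma quad_lt x y : I01 x -> I01 y -> (quad x < quad y) = (x < y).
Proof.
move=> /I01E/andP[x0 x1] /I01E/andP[y0 y1].
have e : quad y - quad x = (y - x) * (5 / 2 - (x + y) / 2) by rewrite /quad; lra.
have h : 0 < 5 / 2 - (x + y) / 2 by lra.
by rewrite -subr_gt0 e pmulr_lgt0// subr_gt0.
Qed.

Lemma quad_cut : quad cut = 1.
Proof. by rewrite /cut quad_br//; [lra|exact: I01_1]. Qed.

Lemma I01_cut : I01 cut.
Proof. by apply: br_I01 => //; exact: I01_1. Qed.

Lemma lanford_lt_cut x : I01 x -> x < cut -> lanford x = quad x.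
Proof.
move=> Ix xc; have := xc; rewrite -quad_lt ?quad_cut//; last exact: I01_cut.
rewrite /lanford /mod1 -/(quad x) => q1.
have q0 : 0 <= quad x.
  by move: Ix => /I01E/andP[x0 x1]; rewrite /quad; nra.
rewrite (_ : Num.floor _ = 0) ?subr0//.
by apply/floor_def; rewrite q0 add0r.
Qed.

Lemma lanford_ge_cut x : I01 x -> cut <= x -> x < 1 -> lanford x = quad x - 1.
Proof.
move=> Ix cx; rewrite -quad_lt//; last exact: I01_1.
have := quad_lt Ix I01_cut; rewrite quad_cut => e.
move: cx; rewrite leNgt -e -leNgt => q1; rewrite (_ : quad 1 = 2) => [q2|]; last by rewrite /quad; lra.
rewrite /lanford /mod1 -/(quad x).
rewrite (_ : Num.floor _ = 1)//.
by apply/floor_def; rewrite q1/=; lra.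
Qed.

(** The endpoint is exceptional: [quad 1 = 2], so the formula [quad x - 1] of the right branch fails
    there. *)
Lemma lanford1 : lanford (1 : R) = 0.
Proof.
rewrite /lanford /mod1 (_ : 2 * 1 + _ = 2%:~R); last by lra.
by rewrite intrKfloor subrr.
Qed.

Lemma lanford_I01 x : I01 x -> I01 (lanford x).
Proof.
move=> Ix; move: (Ix) => /I01E/andP[x0 x1].
apply/I01E; rewrite /lanford /mod1; set q := (2 * x + _).
have /andP[h1 h2] := floor_itv q; move: h2; rewrite intrD => h2.
by apply/andP; split; lra.
Qed.

(** Turns a superlevel set of the map into an interval on each branch; the half-open domain leaves
    out the point 1. *)
Lemma lanford_br i x y : (i <= 1)%N -> I01 x -> I01 y ->
  br i 0 <= x < br i 1 -> (y < lanford x) = (br i y < x).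
Proof.
move=> i1 Ix Iy /andP[bx xb].
have -> : lanford x = quad x - i%:R.
  case: i i1 bx xb => [|[|//]] _.
    by move=> _ xc; rewrite lanford_lt_cut// subr0.
  by rewrite br1_0 br1_1; exact: lanford_ge_cut.
by rewrite ltrBrDr -(quad_br i1 Iy) quad_lt//; exact: br_I01.
Qed.

Lemma measurable_lanford : measurable_fun I01 (@lanford R).
Proof.
have mq : measurable_fun setT (@quad R).
  by apply: continuous_measurable_fun => x; rewrite /quad; apply: continuousD; [
    apply: continuousM; [exact: cst_continuous|exact: cvg_id]|
    apply: continuousM; [apply: continuousM; [exact: cst_continuous|exact: cvg_id]|
      apply: continuousB; [exact: cst_continuous|exact: cvg_id]]].
rewrite /I01 (@itv_bndbnd_setU _ _ _ (BLeft cut)); last 2 first.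
  by rewrite bnd_simp; have /I01E/andP[] := I01_cut.
  by rewrite bnd_simp; have /I01E/andP[] := I01_cut.
apply/measurable_funU => //; split.
  apply: (@eq_measurable_fun _ _ _ _ _ (@quad R)); last exact: measurable_funTS.
  move=> x /[!inE]/=; rewrite in_itv/= => /andP[x0 xc].
  rewrite lanford_lt_cut//; apply/I01E; rewrite x0/= (le_trans (ltW xc))//.
  by have /I01E/andP[] := I01_cut.
rewrite (@itv_bndbnd_setU _ _ _ (BLeft 1)); last 2 first.
  by rewrite bnd_simp; have /I01E/andP[] := I01_cut.
  by rewrite bnd_simp.
apply/measurable_funU => //; split; last first.
  by rewrite set_itv1; exact: measurable_fun_set1.
apply: (@eq_measurable_fun _ _ _ _ _ (fun x => quad x - 1)); last first.
  by apply: measurable_funB => //; exact: measurable_funTS.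
move=> x /[!inE]/=; rewrite in_itv/= => /andP[cx x1].
rewrite lanford_ge_cut//; apply/I01E; rewrite (ltW x1) andbT (le_trans _ cx)//.
by have /I01E/andP[] := I01_cut.
Qed.

End Branches.

(** * Change of variables along the branches *)

Section BranchSubstitution.
Context {R : realType}.
Local Notation mu := (@lebesgue_measure R).
Implicit Types (u w psi : R -> R) (x y z a b L M : R) (i : nat).

Lemma br_derive i x : (i <= 1)%N -> I01 x ->
  is_derive x 1 (@br R i) (root_br i x)^-1.
Proof.
move=> i1 Ix; have r0 := root_br_gt0 i1 Ix.
have p0 : 0 < 25 / 4 - 2 * x - 2 * i%:R by rewrite -sqr_root_br// exprn_gt0.
have ds := is_derive1_sqrt p0.
pose p y : R := 25 / 4 - 2 * y - 2 * i%:R.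
have dp : is_derive x 1 p (- 2).
  by apply: is_derive_eq; rewrite /GRing.scale/=; ring.
have dc := @is_derive1_comp _ Num.sqrt p x _ _ ds dp.
rewrite (_ : (root_br i x)^-1 = 0 - (2 * Num.sqrt (p x))^-1 * - 2); last first.
  by rewrite -/(root_br i x); field; rewrite gt_eqF.
exact: is_deriveB.
Qed.

Lemma br_lt i x y : (i <= 1)%N -> I01 x -> I01 y -> (br i x < br i y) = (x < y).
Proof. by move=> i1 Ix Iy; rewrite -quad_lt ?quad_br ?ltrD2r//; exact: br_I01. Qed.

Lemma br_le i x y : (i <= 1)%N -> I01 x -> I01 y -> (br i x <= br i y) = (x <= y).
Proof. by move=> i1 Ix Iy; rewrite !leNgt br_lt. Qed.

Lemma br_continuous i x : {for x, continuous (@br R i)}.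
Proof.
apply: continuousB; first exact: cst_continuous.
apply: (@continuous_comp _ _ _ (fun y : R => 25 / 4 - 2 * y - 2 * i%:R) Num.sqrt); last first.
  exact: sqrt_continuous.
apply: continuousB; last exact: cst_continuous.
apply: continuousB; first exact: cst_continuous.
by apply: continuousM; [exact: cst_continuous|exact: cvg_id].
Qed.

Lemma root_br_continuous i x : {for x, continuous (@root_br R i)}.
Proof.
rewrite (_ : @root_br R i = fun y => 5 / 2 - br i y); last first.
  by apply/funext => y; rewrite /br; ring.
by apply: continuousB; [exact: cst_continuous|exact: br_continuous].
Qed.

Lemma br_substitution i a u L : (i <= 1)%N -> I01 a -> lip u L ->
  (\int[mu]_(x in `[br i a, br i 1%R]) (u x)%:E =
   \int[mu]_(y in `[a, 1%R]) (u (br i y) / root_br i y)%:E)%E.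
Proof.
move=> i1 Ia lu; move/I01E : (Ia) => /andP[a0].
rewrite le_eqVlt => /predU1P[->|a1].
  by rewrite !set_itv1 !integral_set1.
have sI x : `[a, 1]%classic x -> I01 x.
  by rewrite /= in_itv/= => /andP[ax x1]; apply/I01E; rewrite x1 (le_trans a0 ax).
have soI x : x \in `]a, 1[ -> I01 x.
  by move=> /subset_itv_oo_cc; exact: sI.
have dE x : I01 x -> derive1 (@br R i) x = (root_br i x)^-1.
  by move=> Ix; have := br_derive i1 Ix => ?; rewrite derive1E derive_val.
have cV x : I01 x -> {for x, continuous (fun y => (root_br i y)^-1 : R)}.
  move=> Ix; apply: continuousV; first by rewrite gt_eqF// root_br_gt0.
  exact: root_br_continuous.
rewrite (integration_by_substitution_increasing (ltW a1)).
- by apply: eq_integral => x /[!inE] /sI Ix; congr EFin; rewrite /GRing.mul/= -/(derive1 (br i) x) dE.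
- move=> x y; rewrite !inE => /sI Ix /sI Iy; by rewrite br_lt.
- move=> x xa1; have Ix := soI _ xa1.
  rewrite /continuous_at dE//; apply: cvg_trans (cV _ Ix).
  apply: near_eq_cvg; near=> y; rewrite dE//; apply: soI.
  by near: y; exact: near_in_itvoo.
- apply/cvg_ex; exists (root_br i a)^-1.
  have : (root_br i x)^-1 @[x --> a^'+] --> (root_br i a)^-1.
    by apply: cvg_at_right_filter; exact: cV.
  apply: cvg_trans; apply: near_eq_cvg; near=> y; rewrite dE//; apply: soI.
  by rewrite in_itv/=; apply/andP; split; near: y;
    [exact: nbhs_right_gt|exact: nbhs_right_lt].
- apply/cvg_ex; exists (root_br i 1)^-1.
  have : (root_br i x)^-1 @[x --> 1^'-] --> (root_br i 1 : R)^-1.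
    by apply: cvg_at_left_filter; apply: cV; exact: I01_1.
  apply: cvg_trans; apply: near_eq_cvg; near=> y; rewrite dE//; apply: soI.
  by rewrite in_itv/=; apply/andP; split; near: y;
    [exact: nbhs_left_gt|exact: nbhs_left_lt].
- split.
  + by move=> x /soI Ix; have := br_derive i1 Ix => ?; exact: ex_derive.
  + by apply: cvg_at_right_filter; exact: br_continuous.
  + by apply: cvg_at_left_filter; exact: br_continuous.
- apply: continuous_subspaceW (lip_continuous lu) => x /=.
  rewrite in_itv/= => /andP[h1 h2].
  have /I01E/andP[h3 _] := br_I01 i1 Ia.
  have /I01E/andP[_ h4] := br_I01 i1 (@I01_1 R).
  by apply/I01E; rewrite (le_trans h3 h1) (le_trans h2 h4).
Unshelve. all: by end_near. Qed.

(** Up to null sets, the preimage of []a, +oo[] is []br 0 a, cut[] together with []br 1 a, 1[].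
    Substituting along each branch produces the two terms of [transfer u] on [[a, 1]]. *)
Lemma push_lanford_ray u L a : lip u L -> (forall x, I01 x -> 0 <= u x) ->
  push_density lanford u `]a, +oo[ = push_density id (transfer u) `]a, +oo[.
Proof.
move=> lu u0.
have bu := lip_bmeas lu.
have lPu := transfer_lip lu (fun x => lip_bounded lu).
have bPu := lip_bmeas lPu.
have mE (v : R -> R) (A : set R) : bmeas v -> measurable A -> A `<=` I01 ->
    measurable_fun A (fun x => (v x)%:E).
  by move=> [mv _] mA AI; apply/measurable_EFinP; apply: measurable_funS AI mv; exact: measurable_I01.
have cutI := @I01_cut R; have cutI' := cutI.
move/I01E : cutI' => /andP[c0 c1].
(* The two substitutions added together, on closed intervals. *)
have key b : I01 b ->
    (\int[mu]_(x in `[br 0 b, cut]) (u x)%:E + \int[mu]_(x in `[br 1 b, 1%R]) (u x)%:E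
     = \int[mu]_(y in `[b, 1%R]) (transfer u y)%:E)%E.
  move=> Ib; have := br_substitution (leqnn 1) Ib lu; rewrite br1_1 => ->.
  rewrite /cut (br_substitution _ Ib lu)//.
  have sI x : `[b, 1]%classic x -> I01 x.
    move/I01E : (Ib) => /andP[b0 _].
    by rewrite /= in_itv/= => /andP[ax x1]; apply/I01E; rewrite x1 (le_trans b0 ax).
  have bt i : (i <= 1)%N -> bmeas (fun y => u (br i y) / root_br i y).
    move=> i1; apply: (@lip_bmeas _ _ (L / br_min i ^+ 2 + (`|u 0| + L) / br_min i ^+ 3)).
    by move=> y z Iy Iz; apply: br_term_lip => // x Ix; exact: lip_bounded.
  rewrite -ge0_integralD//=.
  - by move=> x /sI Ix; rewrite lee_fin divr_ge0 ?u0 ?(ltW (root_br_gt0 _ _))//; exact: br_I01.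
  - by apply: mE => //; exact: bt.
  - by move=> x /sI Ix; rewrite lee_fin divr_ge0 ?u0 ?(ltW (root_br_gt0 _ _))//; exact: br_I01.
  - by apply: mE => //; exact: bt.
(* Endpoints carry no mass, so open, half-open and closed intervals are interchangeable. *)
have oo (v : R -> R) p q c d : bmeas v -> I01 c -> I01 d ->
    (\int[mu]_(x in [set` Interval (BSide p c) (BSide q d)]) (v x)%:E =
     \int[mu]_(x in `[c, d]) (v x)%:E)%E.
  move=> bv /I01E/andP[cc0 _] /I01E/andP[_ dd1].
  have mo : measurable_fun `]c, d[ (fun x => (v x)%:E).
    apply: mE => // x /=; rewrite in_itv/= => /andP[cx xd].
    by apply/I01E; rewrite (le_trans cc0 (ltW cx)) (le_trans (ltW xd) dd1).
  by rewrite [LHS]integral_itv_bndoo// [RHS]integral_itv_bndoo.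
have sub c d p q : I01 c -> I01 d -> [set` Interval (BSide p c) (BSide q d)] `<=` I01.
  move=> /I01E/andP[cc0 _] /I01E/andP[_ dd1] x /=.
  rewrite in_itv => /andP[cx xd]; apply/I01E; apply/andP; split.
    by apply: le_trans cc0 _; case: p cx => //= /ltW.
  by apply: le_trans dd1; case: q xd => //= /ltW.
rewrite /push_density.
have [a1|a1] := leP 1 a.
  rewrite (_ : _ `&` _ = set0); last first.
    apply/seteqP; split => // x [Ix /=]; rewrite in_itv/= andbT => ax.
    have /I01E/andP[_] := lanford_I01 Ix.
    by rewrite leNgt (le_lt_trans a1 ax).
  rewrite (_ : I01 `&` _ = set0) ?integral_set0//.
  apply/seteqP; split => // x [/I01E/andP[_ x1] /=]; rewrite in_itv/= andbT => ax.
  by have := le_lt_trans a1 ax; rewrite ltNge x1.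
have [a0|a0] := ltP a 0.
  rewrite (_ : _ `&` _ = I01); last first.
    apply/seteqP; split => [x []//|x Ix]; split => //=; rewrite in_itv/= andbT.
    have /I01E/andP[h _] := lanford_I01 Ix; exact: lt_le_trans h.
  rewrite (_ : I01 `&` _ = I01); last first.
    apply/seteqP; split => [x []//|x Ix]; split => //=; rewrite in_itv/= andbT.
    by move: Ix => /I01E/andP[h _]; exact: lt_le_trans h.
  apply: etrans (key 0 (@I01_0 R)).
  rewrite br0_0 br1_0 /I01 (@itv_bndbnd_setU _ _ _ (BLeft cut)) ?bnd_simp//.
  rewrite ge0_integral_setU//.
  - by congr (_ + _)%E; rewrite oo//; exact: I01_0.
  - apply: mE => //; first exact: measurableU.
    by rewrite -itv_bndbnd_setU ?bnd_simp.
  - move=> x h; rewrite lee_fin u0//; move: h.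
    by rewrite -itv_bndbnd_setU ?bnd_simp.
  - rewrite disj_set2E; apply/eqP/seteqP; split => // x [] /=.
    by rewrite !in_itv/= => /andP[_ xc] /andP[]; rewrite leNgt xc.
have Ia : I01 a by apply/I01E; rewrite a0 ltW.
have I0 := br_I01 (leq0n 1) Ia; have I1 := br_I01 (leqnn 1) Ia.
have b1c : cut <= br 1 a by rewrite -br1_0 br_le//; exact: I01_0.
have b0c : br 0 a < cut by rewrite /cut br_lt//; exact: I01_1.
rewrite (_ : I01 `&` id @^-1` _ = `]a, 1]%classic); last first.
  apply/seteqP; split => x /=; rewrite !in_itv/= ?andbT.
    by move=> [/I01E/andP[_ x1] ax]; rewrite ax x1.
  by move=> /andP[ax x1]; split => //; apply/I01E; rewrite (le_trans a0 (ltW ax)).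
rewrite (oo (transfer u))//; last exact: I01_1.
rewrite -key// (_ : _ `&` _ = `]br 0 a, cut[ `|` `]br 1 a, 1[)%classic; last first.
  apply/seteqP; split => [x [Ix /=]|x /=]; rewrite !in_itv/= ?andbT.
    move/I01E : (Ix) => /andP[x0 x1].
    have [xc|cx] := ltP x cut.
      by rewrite (@lanford_br _ 0)// ?br0_0 ?x0//= => ->; left.
    (* The point 1 is sent to 0, which is not above [a], so it does not belong to the preimage. *)
    move: x1; rewrite le_eqVlt => /predU1P[->|x1].
      by rewrite lanford1 ltNge a0.
    by rewrite (@lanford_br _ 1)// ?br1_0 ?br1_1 ?cx//= => ->; right; rewrite ?x1.
  case=> /andP[h1 h2].
    have /I01E/andP[b0 _] := I0.
    have Ix : I01 x by apply/I01E; rewrite (le_trans b0 (ltW h1)) (le_trans (ltW h2) c1).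
    by split => //; rewrite (@lanford_br _ 0)// br0_0 h2 andbT; move/I01E : Ix => /andP[].
  have Ix : I01 x by apply/I01E; rewrite (le_trans c0 (le_trans b1c (ltW h1))) (ltW h2).
  by split => //; rewrite (@lanford_br _ 1)// br1_0 br1_1 h2 andbT (le_trans b1c (ltW h1)).
rewrite ge0_integral_setU//.
- by congr (_ + _)%E; rewrite oo//; exact: I01_1.
- apply: mE => //; first exact: measurableU.
  by move=> x [/sub|/sub]; apply => //; exact: I01_1.
- by move=> x h; rewrite lee_fin u0//; case: h => /sub; apply => //; exact: I01_1.
- rewrite disj_set2E; apply/eqP/seteqP; split => // x [] /=.
  rewrite !in_itv/= => /andP[_ xc] /andP[h _].
  by have := lt_trans xc (le_lt_trans b1c h); rewrite ltxx.
Qed.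

End BranchSubstitution.

(** * Duality between the map and the transfer operator *)

Section TransferDuality.
Context {R : realType}.
Local Notation mu := (@lebesgue_measure R).
Implicit Types (u w psi : R -> R) (x y z a b L M t : R) (i n K : nat).

Lemma bmeas_lanford psi : bmeas psi -> bmeas (fun x => psi (lanford x)).
Proof.
move=> [mpsi [M psiM]]; split; last by exists M => x Ix; exact/psiM/lanford_I01.
apply: (@measurable_comp _ _ _ _ _ _ I01).
- exact: measurable_I01.
- by move=> _ [x Ix <-]; exact: lanford_I01.
- exact: mpsi.
- exact: measurable_lanford.
Qed.

Lemma mean_indic (g w : R -> R) (A : set R) :
  mean (fun x => \1_A (g x) * w x) = fine (push_density g w A).
Proof.
rewrite /push_density -/(Rintegral mu _ w) Rintegral_mkcondr; apply: eq_Rintegral => x _.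
have e : (x \in g @^-1` A) = (g x \in A) by apply/idP/idP; rewrite !inE.
by rewrite patchE indicE e; case: ifP; rewrite ?mul1r ?mul0r.
Qed.

Lemma bmeas_indic (A : set R) : measurable A -> bmeas (\1_A : R -> R).
Proof.
move=> mA; split; first exact: measurable_indic.
by exists 1 => x _; rewrite indicE; case: (x \in A); rewrite ?normr1 ?normr0.
Qed.

Lemma mean_lanford_indic u L (A : set R) : lip u L ->
  (forall x, I01 x -> 0 <= u x) -> measurable A ->
  mean (fun x => \1_A (lanford x) * u x) = mean (fun x => \1_A x * transfer u x).
Proof.
move=> lu u0 mA; rewrite (mean_indic lanford) (mean_indic id); congr fine.
apply: push_density_unique => //.
- exact: measurable_lanford.
- exact: lip_bmeas lu.
- exact: lip_bmeas (transfer_lip lu (fun x => lip_bounded lu)).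
- move=> x Ix; have <- : transfer (fun=> 0) x = 0 :> R by rewrite /transfer !mul0r addr0.
  exact: le_transfer.
- by move=> a; exact: push_lanford_ray lu u0.
Qed.

(** This is [min (K, floor (n t)) / n], written as a sum of truth values so that it becomes a sum of
    indicators of superlevel sets. *)
Definition stairs n K t : R := n%:R^-1 * \sum_(k < K) ((k.+1%:R <= n%:R * t)%R)%:R.

Lemma stairs_approx n K t : (0 < n)%N -> 0 <= t -> n%:R * t <= K%:R ->
  `|t - stairs n K t| <= n%:R^-1.
Proof.
move=> n0 t0; have n0' : 0 < n%:R :> R by rewrite ltr0n.
have nt0 : 0 <= n%:R * t by rewrite mulr_ge0// ltW.
rewrite /stairs; set s := n%:R * t.
have sumP : if K%:R <= s then \sum_(k < K) ((k.+1%:R <= s)%R)%:R = K%:R :> R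
    else s - 1 < \sum_(k < K) ((k.+1%:R <= s)%R)%:R <= s.
  elim: K => [|K]; first by rewrite nt0 big_ord0.
  rewrite big_ord_recr/=; case: (leP K.+1%:R s) => [Ks|sK].
    by rewrite (le_trans _ Ks) ?ler_nat// => ->; rewrite -natr1.
  rewrite addr0; case: (leP K%:R s) => // Ks -> ; rewrite Ks andbT.
  by rewrite ltrBlDr natr1.
move=> sK; have h : s - 1 <= \sum_(k < K) ((k.+1%:R <= s)%R)%:R <= s.
  move: sumP; case: (leP K%:R s) => [Ks ->|_ /andP[/ltW -> ->//]].
  by rewrite Ks andbT; lra.
rewrite (_ : t = n%:R^-1 * s); last by rewrite /s mulKf ?gt_eqF.
have ni : 0 <= n%:R^-1 :> R by rewrite invr_ge0 ltW.
rewrite -mulrBr normrM ger0_norm// ler_piMr//.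
by move: h => /andP[h1 h2]; rewrite ger0_norm; lra.
Qed.

(* Layer-cake: a bounded observable is a uniform limit of combinations of
   indicators of its superlevel sets. *)
Lemma mean_lanford_ge0 psi u L : bmeas psi -> lip u L ->
  (forall x, I01 x -> 0 <= psi x) -> (forall x, I01 x -> 0 <= u x) ->
  mean (fun x => psi (lanford x) * u x) = mean (fun x => psi x * transfer u x).
Proof.
move=> bpsi lu psi0 u0; have [mpsi [M psiM]] := bpsi.
have bu := lip_bmeas lu.
have lPu := transfer_lip lu (fun x => lip_bounded lu).
have bPu := lip_bmeas lPu.
have [_ [A uA]] := bu; have [_ [B PuB]] := bPu.
have A0 : 0 <= A by exact: le_trans (uA _ (@I01_0 R)).
have B0 : 0 <= B by exact: le_trans (PuB _ (@I01_0 R)).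
suff close n : (0 < n)%N -> `|mean (fun x => psi (lanford x) * u x) -
    mean (fun x => psi x * transfer u x)| <= (A + B) * n%:R^-1.
  apply/eqP; rewrite -subr_eq0 -normr_le0; apply/ler_addgt0Pr => e e0; rewrite add0r.
  apply: le_trans (close (Num.truncn ((A + B) / e)).+1 _) _ => //.
  rewrite ler_pdivrMr ?ltr0n// mulrC -ler_pdivrMr//.
  exact/ltW/truncnS_gt.
(* [K] exceeds [n] times the supremum of [psi], so the staircase is never truncated. *)
move=> n0; pose K := (Num.truncn (n%:R * `|M|)).+1.
pose S k : set R := I01 `&` psi @^-1` [set t | k.+1%:R <= n%:R * t].
have mS k : measurable (S k).
  apply: mpsi; first exact: measurable_I01.
  rewrite [X in measurable X](_ : _ = `[k.+1%:R / n%:R, +oo[%classic); first exact: measurable_itv.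
  by apply/seteqP; split => t /=; rewrite in_itv/= andbT ler_pdivrMr ?ltr0n// [t * _]mulrC.
pose st x : R := n%:R^-1 * \sum_(k < K) \1_(S k) x.
have stE x : I01 x -> st x = stairs n K (psi x).
  move=> Ix; congr (_ * _); apply: eq_bigr => k _; rewrite indicE /S.
  by case: leP => h; [rewrite mem_set|rewrite memNset// => -[_ /=]; rewrite leNgt h].
have bst : bmeas st.
  apply: bmeasM; first exact: bmeas_cst.
  by apply: (@bmeas_sum _ K (fun k => \1_(S k))) => k; exact: bmeas_indic.
have psi_st x : I01 x -> `|psi x - st x| <= n%:R^-1.
  move=> Ix; rewrite stE//; apply: stairs_approx => //; first exact: psi0.
  rewrite /K; apply: le_trans (ltW (truncnS_gt _)).
  rewrite ler_wpM2l// (le_trans (ler_norm _))// (le_trans (psiM _ Ix))//.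
  exact: ler_norm.
have mean_st : mean (fun x => st (lanford x) * u x) = mean (fun x => st x * transfer u x).
  have bS k := bmeas_indic (mS k).
  have bF k : bmeas (fun x => \1_(S k) (lanford x) * u x).
    by apply: bmeasM => //; exact: (bmeas_lanford (bS k)).
  have bG k : bmeas (fun x => \1_(S k) x * transfer u x) by exact: bmeasM.
  have -> : mean (fun x => st (lanford x) * u x) =
      n%:R^-1 * \sum_(k < K) mean (fun x => \1_(S k) (lanford x) * u x).
    rewrite -(mean_sum K bF) -meanZ; last exact: (bmeas_sum K bF).
    by apply: eq_mean => x _; rewrite /st -mulrA mulr_suml.
  have -> : mean (fun x => st x * transfer u x) =
      n%:R^-1 * \sum_(k < K) mean (fun x => \1_(S k) x * transfer u x).
    rewrite -(mean_sum K bG) -meanZ; last exact: (bmeas_sum K bG).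
    by apply: eq_mean => x _; rewrite /st -mulrA mulr_suml.
  by congr (_ * _); apply: eq_bigr => k _; exact: mean_lanford_indic lu u0 (mS k).
have blpsi := bmeas_lanford bpsi; have blst := bmeas_lanford bst.
have e1 : `|mean (fun x => psi (lanford x) * u x) - mean (fun x => st (lanford x) * u x)|
    <= n%:R^-1 * A.
  rewrite -meanB; [|exact: bmeasM..].
  apply: le_mean_norm => [|x Ix]; first by apply: bmeasB; exact: bmeasM.
  by rewrite -mulrBl normrM ler_pM ?uA ?psi_st//; exact: lanford_I01.
have e2 : `|mean (fun x => psi x * transfer u x) - mean (fun x => st x * transfer u x)|
    <= n%:R^-1 * B.
  rewrite -meanB; [|exact: bmeasM..].
  apply: le_mean_norm => [|x Ix]; first by apply: bmeasB; exact: bmeasM.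
  by rewrite -mulrBl normrM ler_pM ?PuB ?psi_st.
rewrite mean_st in e1; move: e1 e2; rewrite !ler_norml mulrDl => /andP[? ?] /andP[? ?].
by apply/andP; split; lra.
Qed.

(** Signs are removed by linearity: adding the constant [M] to [psi] and then [A] to [u] reduces to
    the nonnegative case, and the contributions of the constants are cancelled afterwards. *)
Lemma mean_lanford psi u L : bmeas psi -> lip u L ->
  mean (fun x => psi (lanford x) * u x) = mean (fun x => psi x * transfer u x).
Proof.
move=> bpsi lu; have [_ [M psiM]] := bpsi; have [_ [A uA]] := lip_bmeas lu.
have A0 : 0 <= A by exact: le_trans (uA _ (@I01_0 R)).
have bu := lip_bmeas lu.
have bP w B : lip w B -> bmeas (transfer w).
  by move=> lw; exact: lip_bmeas (transfer_lip lw (fun x => lip_bounded lw)).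
have bM : bmeas (fun=> M : R) by exact: bmeas_cst.
have bl := bmeas_lanford bpsi.
have psi_shift w B : lip w B -> (forall x, I01 x -> 0 <= w x) ->
    mean (fun x => psi (lanford x) * w x) = mean (fun x => psi x * transfer w x).
  move=> lw w0; have bw := lip_bmeas lw; have bPw := bP _ _ lw.
  have M0 : 0 <= M by exact: le_trans (psiM _ (@I01_0 R)).
  have h1 : mean (fun x => (psi (lanford x) + M) * w x) =
      mean (fun x => (psi x + M) * transfer w x).
    apply: (mean_lanford_ge0 (psi := fun x => psi x + M) _ lw) => //.
      exact: bmeasD.
    by move=> x /psiM; rewrite ler_norml => /andP[]; lra.
  have h2 := mean_lanford_ge0 bM lw (fun=> fun=> M0) w0.
  move: h1; under eq_mean do [] => h1.
  have e1 : mean (fun x => (psi (lanford x) + M) * w x) =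
      mean (fun x => psi (lanford x) * w x) + mean (fun x => M * w x).
    rewrite -meanD; [|exact: bmeasM..].
    by apply: eq_mean => x _; rewrite mulrDl.
  have e2 : mean (fun x => (psi x + M) * transfer w x) =
      mean (fun x => psi x * transfer w x) + mean (fun x => M * transfer w x).
    rewrite -meanD; [|exact: bmeasM..].
    by apply: eq_mean => x _; rewrite mulrDl.
  by move: h1; rewrite e1 e2 h2 => /addIr.
have lA : lip (fun=> A : R) 0 by exact: lip_cst.
have luA := lipD lu lA.
have h1 : mean (fun x => psi (lanford x) * (u x + A)) =
    mean (fun x => psi x * transfer (fun x => u x + A) x).
  apply: psi_shift luA _ => x /uA.
  by rewrite ler_norml => /andP[]; lra.
have h2 := psi_shift _ _ lA (fun=> fun=> A0).
have bA := lip_bmeas lA.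
have e1 : mean (fun x => psi (lanford x) * (u x + A)) =
    mean (fun x => psi (lanford x) * u x) + mean (fun x => psi (lanford x) * A).
  rewrite -meanD; [|exact: bmeasM..].
  by apply: eq_mean => x _; rewrite mulrDr.
have e2 : mean (fun x => psi x * transfer (fun x => u x + A) x) =
    mean (fun x => psi x * transfer u x) + mean (fun x => psi x * transfer (fun=> A) x).
  rewrite -meanD; [|exact: bmeasM _ (bP _ _ lu)|exact: bmeasM _ (bP _ _ lA)].
  by apply: eq_mean => x _; rewrite transferD mulrDr.
by move: h1; rewrite e1 e2 h2 => /addIr.
Qed.

Lemma mean_transfer u L : lip u L -> mean (transfer u) = mean u.
Proof.
move=> lu; have := mean_lanford (bmeas_cst 1) lu.
by under eq_mean do rewrite mul1r; under [RHS]eq_mean do rewrite mul1r.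
Qed.

End TransferDuality.

(** * Contraction and the invariant density *)

Section Contraction.
Context {R : realType}.
Implicit Types (u w psi : R -> R) (x y z a b c L M e t : R) (i n m N K : nat).

(** A mean-zero [u] has sup norm at most [L / 2], so [transfer_lip] yields the factor
    [0.68 + 0.4105 / 2 = 0.88525], rounded up. *)
Definition theta : R := 886 / 1000.

Lemma theta_gt0 : 0 < theta. Proof. by rewrite /theta; lra. Qed.

Lemma theta_lt1 : theta < 1. Proof. by rewrite /theta; lra. Qed.

Lemma thetaX_ge0 n : 0 <= theta ^+ n. Proof. exact/exprn_ge0/ltW/theta_gt0. Qed.

(** The one passage to the limit behind most later estimates: they are proved for every [n] with a
    remainder of order [theta^n]. *)
Lemma le_geometric a b c : (forall n, a <= b + c * theta ^+ n) -> a <= b.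
Proof.
move=> h; have cv : (b + c * theta ^+ n) @[n --> \oo] --> b + c * 0.
  apply: cvgD; first exact: cvg_cst.
  apply: cvgMr; apply: cvg_expr.
  by rewrite ger0_norm ?theta_lt1// ltW// theta_gt0.
rewrite mulr0 addr0 in cv; rewrite -(cvg_lim _ cv)//; apply: limr_ge.
  by apply/cvg_ex; exists b.
by near=> n; exact: h.
Unshelve. all: by end_near. Qed.

Lemma transfer_contract u L : lip u L -> mean u = 0 ->
  lip (transfer u) (theta * L).
Proof.
move=> lu u0; have L0 := lip_ge0 lu.
apply: lip_le (transfer_lip lu (fun x => mean0_lip lu u0)).
by rewrite /theta; lra.
Qed.

Lemma lip_transfer u L : lip u L -> exists M, lip (transfer u) M.
Proof. by move=> lu; eexists; exact: transfer_lip lu (fun x => lip_bounded lu). Qed.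

Lemma lip_iter n u L : lip u L -> exists M, lip (iter n transfer u) M.
Proof.
by move=> lu; elim: n => [|n [M lM]]; [exists L|exact: lip_transfer lM].
Qed.

Lemma mean_iter n u L : lip u L -> mean (iter n transfer u) = mean u.
Proof.
move=> lu; elim: n => [//|n IH]; have [M lM] := lip_iter n lu.
by rewrite iterS (mean_transfer lM).
Qed.

Lemma iter_contract n u L : lip u L -> mean u = 0 ->
  lip (iter n transfer u) (theta ^+ n * L).
Proof.
move=> lu u0; elim: n => [|n IH]; first by rewrite expr0 mul1r.
rewrite exprS -mulrA; apply: transfer_contract IH _.
by rewrite (mean_iter _ lu).
Qed.

Lemma iter_bound n u L x : lip u L -> mean u = 0 -> I01 x ->
  `|iter n transfer u x| <= theta ^+ n * L / 2.
Proof.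
move=> lu u0; apply: mean0_lip; first exact: iter_contract.
by rewrite (mean_iter _ lu).
Qed.

Lemma iter_ext n u w x : (forall y, I01 y -> u y = w y) -> I01 x ->
  iter n transfer u x = iter n transfer w x.
Proof. by move=> uw; elim: n x => [|n IH] x Ix; [exact: uw|exact: transfer_ext]. Qed.

Lemma iterB n u w x : I01 x ->
  iter n transfer (fun y => u y - w y) x = iter n transfer u x - iter n transfer w x.
Proof.
elim: n x => [//|n IH] x Ix; rewrite !iterS -transferB.
exact: transfer_ext.
Qed.

Lemma iterZ n M u x : I01 x ->
  iter n transfer (fun y => M * u y) x = M * iter n transfer u x.
Proof.
elim: n x => [//|n IH] x Ix; rewrite !iterS -transferZ.
exact: transfer_ext.
Qed.

Lemma le_iter n u w x : (forall y, I01 y -> u y <= w y) -> I01 x ->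
  iter n transfer u x <= iter n transfer w x.
Proof. by move=> uw; elim: n x => [|n IH] x Ix; [exact: uw|exact: le_transfer]. Qed.

Definition pf n : R -> R := iter n transfer (fun=> 1).

Lemma mean_pf n : mean (pf n) = 1.
Proof. by rewrite /pf (mean_iter _ (lip_cst 1)) mean_cst. Qed.

Lemma near_mean u L x : lip u L -> I01 x -> `|u x - mean u| <= L / 2.
Proof.
move=> lu; apply: (mean0_lip (u := fun y => u y - mean u)).
  by rewrite -[L]addr0; apply: lipB lu (lip_cst _).
by rewrite meanB ?mean_cst ?subrr//; [exact: lip_bmeas lu|exact: bmeas_cst].
Qed.

(** An invariant bound: mean 1 and Lipschitz constant 3.7 force sup norm at most
    [1 + 3.7 / 2 = 2.85], and [0.68 * 3.7 + 0.4105 * 2.85 < 3.7]. *)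
Lemma lip_pf n : lip (pf n) (37 / 10).
Proof.
elim: n => [|n IH]; first by apply: lip_le (lip_cst _); lra.
apply: lip_le (transfer_lip IH (M := 1 + 37 / 10 / 2) _); first lra.
move=> x Ix; have := near_mean IH Ix; rewrite mean_pf.
by norm_lra.
Qed.

Lemma pf_ge0 n x : I01 x -> 0 <= pf n x.
Proof.
move=> Ix; have <- : iter n transfer (fun=> 0) x = 0 :> R.
  by elim: n x Ix => [//|n IH] x Ix; rewrite iterS /transfer !IH ?mul0r ?addr0//; exact: br_I01.
by apply: le_iter => // y _; exact: ler01.
Qed.

Lemma pf_le3 n x : I01 x -> pf n x <= 3.
Proof.
move=> Ix; have := near_mean (lip_pf n) Ix; rewrite mean_pf.
by rewrite ler_norml => /andP[? ?]; lra.
Qed.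

(** By positivity of the operator [P^n u] lies between [- e P^n 1] and [e P^n 1], and [P^n 1] stays
    below 3. *)
Lemma iter_sup n u e x : (forall y, I01 y -> `|u y| <= e) -> I01 x ->
  `|iter n transfer u x| <= 3 * e.
Proof.
move=> ue Ix.
have e0 : 0 <= e by exact: le_trans (ue _ (@I01_0 R)).
have h : `|iter n transfer u x| <= e * pf n x.
  rewrite /pf -iterZ// ler_norml; apply/andP; split.
    rewrite -mulN1r -iterZ//; apply: le_iter => // y /ue.
    by rewrite ler_norml => /andP[]; lra.
  by apply: le_iter => // y /ue; rewrite ler_norml mulr1 => /andP[].
apply: le_trans h _; rewrite mulrC ler_wpM2r//.
exact: pf_le3.
Qed.

(* The sup bound is used for the first [m] terms and the contraction for the
   others, so that only the logarithm of the Lipschitz constant matters. *)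
Lemma sum_iter_bound m N u L e x : lip u L -> mean u = 0 ->
  (forall y, I01 y -> `|u y| <= e) -> I01 x ->
  \sum_(k < N) `|iter k transfer u x| <= m%:R * (3 * e) + 5 * L * theta ^+ m.
Proof.
move=> lu u0 ue Ix; have L0 := lip_ge0 lu.
have e0 : 0 <= e by exact: le_trans (ue _ (@I01_0 R)).
have small k : (k < m)%N -> \sum_(k < k) `|iter k transfer u x| <= k%:R * (3 * e).
  elim: k => [|k IH] km; first by rewrite big_ord0 mul0r.
  rewrite big_ord_recr/= -natr1 mulrDl mul1r lerD ?iter_sup//.
  by apply: IH; exact: ltnW.
have large k : \sum_(k < m + k) `|iter k transfer u x| <=
    m%:R * (3 * e) + 5 * L * (theta ^+ m - theta ^+ (m + k)).
  elim: k => [|k IH].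
    rewrite addn0 subrr mulr0 addr0.
    case: m small => [|p] small; first by rewrite big_ord0 mul0r.
    rewrite big_ord_recr/= -natr1 mulrDl mul1r lerD ?iter_sup//.
    exact: small.
  rewrite addnS big_ord_recr/=; apply: le_trans (lerD IH (iter_bound _ lu u0 Ix)) _.
  rewrite exprS; have := thetaX_ge0 (m + k).
  set tk := theta ^+ (m + k) => tk0.
  have Lt : 0 <= L * tk by exact: mulr_ge0.
  (* The factor 5 suffices because [5 * (1 - theta) = 0.57] exceeds the [1 / 2] of [iter_bound]. *)
  set a := theta ^+ m; rewrite /theta; lra.
apply: le_trans (_ : \sum_(k < m + N) `|iter k transfer u x| <= _).
  rewrite -!(big_mkord xpredT (fun k => `|iter k transfer u x|)).
  by rewrite [leRHS](big_cat_nat _ (leq_addl m N))//= lerDl sumr_ge0.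
apply: le_trans (large N) _; rewrite lerD2l ler_wpM2l ?mulr_ge0//.
by have := thetaX_ge0 (m + N); lra.
Qed.

(** [P 1 - 1] has mean zero and Lipschitz constant at most 0.4105, and half of this is below
    [2 * (1 - theta) = 0.228]. The bound has the telescoping form required by [geo_limP]. *)
Lemma pf_step n x : I01 x ->
  `|pf n.+1 x - pf n x| <= 2 * theta ^+ n - 2 * theta ^+ n.+1.
Proof.
move=> Ix; rewrite /pf iterSr.
have lP1 : lip (transfer (fun=> 1 : R)) (4105 / 10000).
  apply: lip_le (transfer_lip (lip_cst 1) (M := 1) _); first lra.
  by move=> y _; rewrite normr1.
have l := lipB lP1 (lip_cst (1 : R)).
rewrite -iterB//; apply: le_trans (iter_bound n l _ Ix) _.
  rewrite meanB; [|exact: lip_bmeas lP1|exact: bmeas_cst].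
  by rewrite (mean_transfer (lip_cst 1)) mean_cst subrr.
rewrite exprS; have := thetaX_ge0 n; set t := theta ^+ n => t0.
rewrite /theta; lra.
Qed.

(** The limit of a sequence whose steps are at most [c theta^n - c theta^(n+1)]. Then
    [d n - c theta^n] increases and [d n + c theta^n] decreases, so the supremum of the former lies
    between them and comes with its rate. *)
Definition geo_lim (d : nat -> R) c : R := sup [set d n - c * theta ^+ n | n in setT].

Lemma geo_limP (d : nat -> R) c n :
  (forall k, `|d k.+1 - d k| <= c * theta ^+ k - c * theta ^+ k.+1) ->
  `|d n - geo_lim d c| <= c * theta ^+ n.
Proof.
move=> dstep; have step k : 0 <= c * theta ^+ k - c * theta ^+ k.+1.
  exact: le_trans (dstep k).
have c0 : 0 <= c by have := step 0%N; rewrite expr0 expr1 /theta; lra.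
have lower : {homo (fun k => d k - c * theta ^+ k) : n m / (n <= m)%N >-> n <= m}.
  apply: homo_leq => [//|? ? ?|k]; first exact: le_trans.
  by have := dstep k; rewrite ler_norml => /andP[? ?]; lra.
have upper : {homo (fun k => d k + c * theta ^+ k) : n m / (n <= m)%N >-> m <= n}.
  apply: homo_leq => [//|? ? ? h1 h2|k]; first exact: le_trans h2 h1.
  by have := dstep k; rewrite ler_norml => /andP[? ?]; lra.
have ub m : ubound [set d k - c * theta ^+ k | k in setT] (d m + c * theta ^+ m).
  move=> _ [k _ <-]; have km := leq_maxl k m; have mk := leq_maxr k m.
  apply: le_trans (lower _ _ km) _; apply: le_trans (upper _ _ mk).
  by have := mulr_ge0 c0 (thetaX_ge0 (maxn k m)); lra.
have h1 : d n - c * theta ^+ n <= geo_lim d c.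
  apply: ub_le_sup; first by exists (d 0 + c * theta ^+ 0); exact: ub.
  by exists n.
have h2 : geo_lim d c <= d n + c * theta ^+ n.
  by apply: ge_sup (ub n); exists (d 0 - c * theta ^+ 0), 0%N.
by rewrite ler_norml; apply/andP; split; lra.
Qed.

Definition inv_density x : R := geo_lim (fun n => pf n x) 2.

Lemma pf_cvg n x : I01 x -> `|pf n x - inv_density x| <= 2 * theta ^+ n.
Proof. by move=> Ix; apply: geo_limP => k; exact: pf_step. Qed.

Lemma lip_inv_density : lip inv_density (37 / 10).
Proof.
move=> x y Ix Iy; apply: (@le_geometric _ _ 4) => n.
have := lip_pf n Ix Iy; have := pf_cvg n Ix; have := pf_cvg n Iy.
norm_lra.
Qed.

Lemma inv_density_ge0 x : I01 x -> 0 <= inv_density x.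
Proof.
move=> Ix; apply: (@le_geometric _ _ 2) => n.
have := pf_cvg n Ix; have := pf_ge0 n Ix.
by rewrite ler_norml => ? /andP[? ?]; lra.
Qed.

Lemma mean_inv_density : mean inv_density = 1.
Proof.
apply/eqP; rewrite -subr_eq0 -normr_le0; apply: (@le_geometric _ _ 2) => n.
have bi := lip_bmeas lip_inv_density; have bp := lip_bmeas (lip_pf n).
rewrite add0r; have : `|mean inv_density - mean (pf n)| <= 2 * theta ^+ n.
  rewrite -meanB//; apply: le_mean_norm => [|x Ix]; first exact: bmeasB.
  by rewrite distrC pf_cvg.
by rewrite mean_pf.
Qed.

(** Split [u] into [u - mean u], which is contracted, and the constant [mean u], whose iterates are
    multiples of [P^n 1]. *)
Lemma iter_cvg n u L x : lip u L -> I01 x ->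
  `|iter n transfer u x - mean u * inv_density x| <= (L / 2 + 2 * `|mean u|) * theta ^+ n.
Proof.
move=> lu Ix; have bu := lip_bmeas lu.
have lum := lipB lu (lip_cst (mean u)); rewrite addr0 in lum.
have um0 : mean (fun y => u y - mean u) = 0.
  by rewrite meanB ?mean_cst ?subrr//; exact: bmeas_cst.
have := iter_bound n lum um0 Ix; rewrite iterB//.
have -> : iter n transfer (fun=> mean u) x = mean u * pf n x.
  by rewrite -iterZ//; apply: iter_ext => // y _; rewrite mulr1.
move=> h1; have h2 : `|mean u * pf n x - mean u * inv_density x| <= `|mean u| * (2 * theta ^+ n).
  by rewrite -mulrBr normrM ler_wpM2l// pf_cvg.
apply: le_trans (_ : _ <= theta ^+ n * L / 2 + `|mean u| * (2 * theta ^+ n)) _; last by lra.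
apply: le_trans (lerD h1 h2); apply: le_trans (ler_normD _ _).
by rewrite addrA subrK.
Qed.

Lemma transfer_inv_density x : I01 x -> transfer inv_density x = inv_density x.
Proof.
move=> Ix; apply/eqP; rewrite -subr_eq0 -normr_le0.
apply: (@le_geometric _ _ 8) => n; rewrite add0r.
have h1 : `|transfer (fun y => pf n y - inv_density y) x| <= 3 * (2 * theta ^+ n).
  by apply: (@iter_sup 1) => // y Iy; exact: pf_cvg.
have h2 := pf_cvg n.+1 Ix; have t1 := ltW theta_lt1.
have h3 : theta ^+ n.+1 <= theta ^+ n.
  by rewrite exprS ler_piMl// thetaX_ge0.
move: h1 h2; rewrite transferB (_ : transfer (pf n) x = pf n.+1 x)// !ler_norml => /andP[? ?] /andP[? ?].
by apply/andP; split; lra.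
Qed.

Lemma mean_inv_lanford psi : bmeas psi ->
  mean (fun x => psi (lanford x) * inv_density x) = mean (fun x => psi x * inv_density x).
Proof.
move=> bpsi; rewrite (mean_lanford bpsi lip_inv_density).
by apply: eq_mean => x Ix; rewrite transfer_inv_density.
Qed.

Lemma inv_density_le3 x : I01 x -> inv_density x <= 3.
Proof.
move=> Ix; apply: (@le_geometric _ _ 2) => n.
have := pf_cvg n Ix; have := pf_le3 n Ix.
by rewrite ler_norml => ? /andP[? ?]; lra.
Qed.

(** The sum of [P^k (h - P h)] over [k < N] telescopes to [h - P^N h], which tends to
    [h - mean h * inv_density]; normalising the mass then costs at most [3 d]. *)
Lemma inv_density_approx (h : R -> R) m L M e d x :
  lip h L -> lip (fun y => h y - transfer h y) M ->
  (forall y, I01 y -> `|h y - transfer h y| <= e) -> `|mean h - 1| <= d -> I01 x ->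
  `|h x - inv_density x| <= m%:R * (3 * e) + 5 * M * theta ^+ m + 3 * d.
Proof.
move=> lh lr hr hd Ix.
have [LP lP] := lip_transfer lh.
have r0 : mean (fun y => h y - transfer h y) = 0.
  by rewrite meanB ?(mean_transfer lh) ?subrr//; [exact: lip_bmeas lh|exact: lip_bmeas lP].
have tel N : \sum_(k < N) iter k transfer (fun y => h y - transfer h y) x = h x - iter N transfer h x.
  elim: N => [|N IH]; first by rewrite big_ord0 subrr.
  rewrite big_ord_recr/= IH iterB//.
  by rewrite -/(iter N.+1 transfer h x) iterSr; lra.
have h1 : `|h x - mean h * inv_density x| <= m%:R * (3 * e) + 5 * M * theta ^+ m.
  apply: (@le_geometric _ _ (L / 2 + 2 * `|mean h|)) => N.
  have := iter_cvg N lh Ix.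
  have := le_trans (ler_norm_sum _ _ _) (sum_iter_bound m N lr r0 hr Ix).
  rewrite tel !ler_norml => /andP[? ?] /andP[? ?].
  by apply/andP; split; lra.
have h2 : `|mean h * inv_density x - inv_density x| <= 3 * d.
  rewrite -{2}[inv_density x]mul1r -mulrBl normrM mulrC ler_pM//.
  by rewrite ger0_norm ?inv_density_ge0// inv_density_le3.
move: h1 h2; norm_lra.
Qed.

End Contraction.

(** * Lipschitz approximation of continuous functions *)

Section LipschitzDensity.
Context {R : realType}.
Local Notation mu := (@lebesgue_measure R).
Implicit Types (g u w psi : R -> R) (x y z a b c L M e t : R) (i n m N k : nat).

(** The Pasch-Hausdorff envelope: for bounded [g] it is [k]-Lipschitz, lies below [g] on [[0, 1]],
    and approaches a continuous [g] from below as [k] grows. *)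
Definition inf_conv g k x : R := inf [set g y + k%:R * `|x - y| | y in I01].

Lemma inf_conv_lb g k x M : (forall y, I01 y -> `|g y| <= M) ->
  lbound [set g y + k%:R * `|x - y| | y in I01] (- M).
Proof.
move=> gM _ [y Iy <-]; have := gM _ Iy; rewrite ler_norml => /andP[h _].
by apply: le_trans h _; rewrite lerDl mulr_ge0.
Qed.

Lemma inf_conv_le g k x y M : (forall y, I01 y -> `|g y| <= M) -> I01 y ->
  inf_conv g k x <= g y + k%:R * `|x - y|.
Proof.
move=> gM Iy; apply: ge_inf; last by exists y.
by exists (- M); exact: inf_conv_lb.
Qed.

Lemma inf_conv_lip g k M : (forall y, I01 y -> `|g y| <= M) ->
  lip (inf_conv g k) k%:R.
Proof.
move=> gM; have h x y : inf_conv g k x - k%:R * `|x - y| <= inf_conv g k y.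
  apply: lb_le_inf; first by exists (g 0 + k%:R * `|y - 0|), 0 => //; exact: I01_0.
  move=> _ [z Iz <-]; have := inf_conv_le k x gM Iz.
  have : k%:R * `|x - z| <= k%:R * `|x - y| + k%:R * `|y - z|.
    rewrite -mulrDr ler_wpM2l//; have := ler_normD (x - y) (y - z).
    by rewrite addrA subrK.
  lra.
move=> x y _ _; have := h x y; have := h y x; rewrite distrC => h1 h2.
by rewrite ler_norml; apply/andP; split; lra.
Qed.

(** Each point has a neighbourhood and a threshold for [k] that work together; compactness, in its
    near-covering form, makes [k] uniform. This gives the L1-approximation of [rho] by functions on
    which the operator contracts. *)
Lemma lip_approx g e : continuous g -> 0 < e ->
  exists u L, lip u L /\ forall x, I01 x -> `|g x - u x| <= e.
Proof.
move=> cg e0; have e2 : 0 < e / 2 by lra.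
have cI : compact (@I01 R) by exact: segment_compact.
have [M gM] : exists M, forall y, I01 y -> `|g y| <= M.
  have /compact_bounded[M [_ hM]] := continuous_compact (continuous_subspaceT cg) cI.
  by exists (M + 1) => y Iy; apply: (hM (M + 1)); [lra|exists y].
have M0 : 0 <= M by exact: le_trans (gM _ (@I01_0 R)).
have /compact_near_coveringP/near_covering_withinP cov := cI.
have [] := cov nat \oo (fun k x => g x - inf_conv g k x <= e) _.
  move=> x Ix.
  have /cvgrPdist_lt/(_ _ e2) := cg x.
  move=> /nbhs_normP[r /= r0 hr].
  (* Around [x], a competitor [y] within [r / 2] of [x'] is still within [r] of [x], where [g]
     varies little. A farther one pays at least [(4 M / r) (r / 2) = 2 M], the largest possible
     gain. *)
  exists (ball_ Num.norm x (r / 2), [set k | 4 * M / r <= k%:R]) => /=.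
    split; first by apply/nbhs_normP; exists (r / 2) => //=; rewrite divr_gt0.
    exists (Num.truncn (4 * M / r)).+1 => // k /= hk.
    by apply: le_trans (ltW (truncnS_gt _)) _; rewrite ler_nat.
  move=> [x' k] /= [xx' hk] Ix'.
  rewrite lerBlDl -lerBlDr; apply: lb_le_inf.
    by exists (g 0 + k%:R * `|x' - 0|), 0 => //; exact: I01_0.
  move=> _ [y Iy <-].
  have k0 : 0 <= k%:R * `|x' - y| by rewrite mulr_ge0.
  have [yx|yx] := ltP `|x' - y| (r / 2).
    have h1 : `|g x - g x'| < e / 2 by apply: hr => /=; lra.
    have h2 : `|g x - g y| < e / 2.
      apply: hr => /=; have := ler_normD (x - x') (x' - y); rewrite addrA subrK; lra.
    by move: h1 h2; rewrite !ltr_norml => /andP[? ?] /andP[? ?]; lra.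
  have h3 : 2 * M <= k%:R * `|x' - y|.
    apply: le_trans (_ : 4 * M / r * (r / 2) <= _).
      by rewrite le_eqVlt; apply/orP; left; apply/eqP; field; rewrite gt_eqF.
    by rewrite ler_pM// ?divr_ge0 ?mulr_ge0// ltW.
  have := gM _ Iy; have := gM _ Ix'; rewrite !ler_norml => /andP[? ?] /andP[? ?]; lra.
move=> k _ /(_ k (leqnn k)) hk.
exists (inf_conv g k), k%:R; split; first exact: inf_conv_lip gM.
move=> x Ix; have := hk x Ix; have := inf_conv_le k x gM Ix.
rewrite subrr normr0 mulr0 addr0 => h1 h2.
by rewrite ger0_norm; lra.
Qed.

End LipschitzDensity.

(** * Uniqueness of the invariant density *)

Section Uniqueness.
Context {R : realType}.
Local Notation mu := (@lebesgue_measure R).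

Lemma integrable_sub (D : set R) (v w : R -> R) : measurable D ->
  mu.-integrable D (EFin \o v) -> mu.-integrable D (EFin \o w) ->
  mu.-integrable D (EFin \o (fun x => v x - w x)).
Proof.
move=> mD iv iw; rewrite (_ : _ \o _ = ((EFin \o v) \- (EFin \o w))%E)//.
exact: integrableB.
Qed.

Lemma integrable_add (D : set R) (v w : R -> R) : measurable D ->
  mu.-integrable D (EFin \o v) -> mu.-integrable D (EFin \o w) ->
  mu.-integrable D (EFin \o (fun x => v x + w x)).
Proof.
move=> mD iv iw; rewrite (_ : _ \o _ = ((EFin \o v) \+ (EFin \o w))%E)//.
exact: integrableD.
Qed.

Lemma integrable_norm (D : set R) (v : R -> R) : mu.-integrable D (EFin \o v) ->
  mu.-integrable D (EFin \o (fun x => `|v x|)).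
Proof. by move=> /integrable_abse. Qed.

Implicit Types (g u w psi : R -> R) (x y z a b c L M e t : R) (i n m N k : nat).
Lemma dist_chain (a b c d e1 e2 e3 : R) : `|a - b| <= e1 -> `|b - c| <= e2 ->
  `|c - d| <= e3 -> `|a - d| <= e1 + e2 + e3.
Proof.
norm_lra.
Qed.

Variable rho : R -> R.
Hypothesis rhoP : acip_density lanford rho.

Lemma rho_integrable : mu.-integrable I01 (EFin \o rho).
Proof.
have [mr [r0 [r1 _]]] := rhoP; apply/integrableP; split.
  exact/measurable_EFinP.
rewrite [X in (X < _)%E](_ : _ = 1%E) ?ltry// -r1.
by apply: eq_integral => x /[!inE] Ix; rewrite /= ger0_norm// r0.
Qed.

Lemma rho_mean : mean rho = 1.
Proof. by have [_ [_ [r1 _]]] := rhoP; rewrite /mean /Rintegral r1. Qed.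

Lemma rho_approx e : 0 < e -> exists u L, lip u L /\ mean (fun x => `|rho x - u x|) <= e.
Proof.
move=> e0; have e2 : 0 < e / 2 by lra.
have muI : (mu I01 < +oo)%E by rewrite [X in (X < _)%E]mu_I01 ltry.
have [g_ [cg ig]] := approximation_continuous_integrable (measurable_I01 : measurable _) muI rho_integrable.
move=> /fine_fcvg /cvgrPdist_lt/(_ _ e2)[n _ /(_ n (leqnn n))].
set g := g_ n => hn; have {}cg : continuous g := cg n; have {}ig := ig n.
have [u [L [lu gu]]] := lip_approx cg e2.
exists u, L; split => //.
have bu := bmeas_integrable (lip_bmeas lu).
have h1 : mean (fun x => `|rho x - g x|) < e / 2.
  by move: hn; rewrite /= sub0r normrN; apply: le_lt_trans; exact: ler_norm.
have irg := integrable_norm (integrable_sub measurable_I01 rho_integrable ig).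
have iru := integrable_norm (integrable_sub measurable_I01 rho_integrable bu).
have be := bmeas_integrable (bmeas_cst (e / 2)).
have h2 : mean (fun x => `|rho x - u x|) <= mean (fun x => `|rho x - g x| + e / 2).
  apply: le_Rintegral; [exact: measurable_I01|exact: iru|..].
    by apply: integrable_add irg be; exact: measurable_I01.
  move=> x Ix; have := ler_normD (rho x - g x) (g x - u x).
  by rewrite addrA subrK; have := gu _ Ix; lra.
have h3 : mean (fun x => `|rho x - g x| + e / 2) = mean (fun x => `|rho x - g x|) + e / 2.
  rewrite -[in RHS](mean_cst (e / 2)); apply: RintegralD => //.
  exact: measurable_I01.
rewrite h3 in h2; lra.
Qed.

(** [B] is the set of points of [[0, 1]] whose [n]-th image lies in [A]: duality moves the iterates
    from [u] to the indicator, and invariance keeps the [rho]-mass. *)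
Lemma mean_indic_iter n u L (A : set R) : lip u L -> measurable A ->
  exists B, [/\ measurable B, B `<=` I01,
    mean (fun x => \1_B x * u x) = mean (fun x => \1_A x * iter n transfer u x) &
    (\int[mu]_(x in B) (rho x)%:E = \int[mu]_(x in I01 `&` A) (rho x)%:E)%E].
Proof.
have [_ [_ [_ inv]]] := rhoP.
move=> lu mA; elim: n u L lu => [|n IH] u L lu.
  exists (I01 `&` A); split => //; first exact: measurableI.
  by apply: eq_mean => x Ix; rewrite indicI/= indicE mem_set//= mul1r.
have [L' lPu] := lip_transfer lu.
have [B [mB BI e1 e2]] := IH _ _ lPu.
exists (I01 `&` lanford @^-1` B); split => //.
- exact: (measurable_lanford measurable_I01 mB).
- rewrite iterSr -e1 -(mean_lanford (bmeas_indic mB) lu).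
  apply: eq_mean => x Ix; congr (_ * _).
  rewrite indicI/= [\1_I01 x]indicE mem_set//= mul1r !indicE.
  by congr (_%:R); apply/idP/idP; rewrite !inE.
- by rewrite inv.
Qed.

(** Take a Lipschitz [u] close to [rho] in L1 and the [n]-step preimage [B] of [A]. The [rho]-mass
    of [A] is that of [B], hence within [e / 2] of [int_B u = int_A P^n u]. The latter tends to
    [mean u * int_A inv_density], and [mean u] is within [e / 2] of 1. *)
Lemma rho_inv_density_set (A : set R) : A `<=` I01 -> measurable A ->
  (\int[mu]_(x in A) (rho x)%:E = \int[mu]_(x in A) (inv_density x)%:E)%E.
Proof.
move=> AI mA.
have bi := lip_bmeas (@lip_inv_density R).
have iA (v : R -> R) (B : set R) : mu.-integrable I01 (EFin \o v) -> measurable B -> B `<=` I01 ->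
    mu.-integrable B (EFin \o v).
  by move=> iv mB BI; apply: integrableS iv => //; exact: measurable_I01.
have meanA (v : R -> R) (B : set R) : B `<=` I01 -> mean (fun x => \1_B x * v x) = Rintegral mu B v.
  move=> BI; rewrite -[in RHS](setIidr BI) Rintegral_mkcondr; apply: eq_Rintegral => x _.
  by rewrite patchE indicE; case: ifP; rewrite ?mul1r ?mul0r.
suff eqR : Rintegral mu A rho = Rintegral mu A inv_density.
  have f1 : (\int[mu]_(x in A) (rho x)%:E)%E \is a fin_num.
    by apply: integrable_fin_num => //; exact: iA rho_integrable mA AI.
  have f2 : (\int[mu]_(x in A) (inv_density x)%:E)%E \is a fin_num.
    by apply: integrable_fin_num => //; exact: iA (bmeas_integrable bi) mA AI.
  by rewrite -(fineK f1) -(fineK f2); congr EFin.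
apply/eqP; rewrite -subr_eq0 -normr_le0; apply/ler_addgt0Pr => e e0; rewrite add0r.
have e2' : 0 < e / 2 by lra.
have [u [L [lu ue]]] := rho_approx e2'.
have bu := lip_bmeas lu.
apply: (@le_geometric R _ _ (L / 2 + 2 * `|mean u|)) => n.
have [B [mB BI e1 e2]] := mean_indic_iter n lu mA.
rewrite (setIidr AI) in e2.
have iru := integrable_sub measurable_I01 rho_integrable (bmeas_integrable bu).
have L1 (C : set R) : measurable C -> C `<=` I01 ->
    `|Rintegral mu C (fun x => rho x - u x)| <= e / 2.
  move=> mC CI; apply: le_trans ue.
  apply: le_trans (le_normr_Rintegral _ (iA _ _ iru mC CI)) _; first exact: mC.
  have fI : (\int[mu]_(x in I01) `|rho x - u x|%:E)%E \is a fin_num.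
    apply: integrable_fin_num.
    + exact: measurable_I01.
    + exact: integrable_norm iru.
  have fC : (\int[mu]_(x in C) `|rho x - u x|%:E)%E \is a fin_num.
    apply: integrable_fin_num => //.
    exact: integrable_norm (iA _ _ iru mC CI).
  apply: fine_le => //; apply: ge0_subset_integral => //.
  - exact: measurable_I01.
  - have /integrableP[/measurable_EFinP h _] := iru.
    by apply/measurable_EFinP; exact: measurableT_comp.
have h1 : Rintegral mu A rho - mean (fun x => \1_A x * iter n transfer u x) =
    Rintegral mu B (fun x => rho x - u x).
  rewrite -e1 meanA// RintegralB//; [|exact: iA rho_integrable mB BI|exact: iA (bmeas_integrable bu) mB BI].
  by congr (_ - _); rewrite /Rintegral e2.
have h2 : mean u - 1 = - Rintegral mu I01 (fun x => rho x - u x).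
  rewrite RintegralB; [|exact: measurable_I01|exact: rho_integrable|exact: bmeas_integrable].
  by rewrite -/(mean rho) -/(mean u) rho_mean opprB.
have [Ln lPn] := lip_iter n lu.
have bA := bmeas_indic mA.
have h3 : `|mean (fun x => \1_A x * iter n transfer u x) - mean u * Rintegral mu A inv_density|
    <= (L / 2 + 2 * `|mean u|) * theta ^+ n.
  rewrite -meanA// -meanZ; last exact: bmeasM.
  rewrite -meanB; [|exact: bmeasM bA (lip_bmeas lPn)|
    by apply: bmeasM; [exact: bmeas_cst|exact: bmeasM]].
  apply: le_mean_norm => [|x Ix].
    by apply: bmeasB; [exact: bmeasM bA (lip_bmeas lPn)|
      by apply: bmeasM; [exact: bmeas_cst|exact: bmeasM]].
  rewrite (_ : _ - _ = \1_A x * (iter n transfer u x - mean u * inv_density x)); last by ring.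
  rewrite normrM; apply: le_trans (iter_cvg n lu Ix).
  by rewrite ler_piMl// indicE; case: (x \in A); rewrite ?normr1 ?normr0.
have h4 : 0 <= Rintegral mu A inv_density <= 1.
  rewrite -meanA//; apply/andP; split.
    rewrite -(mean_cst 0); apply: le_mean; [exact: bmeas_cst|exact: bmeasM|].
    by move=> x Ix; rewrite mulr_ge0 ?inv_density_ge0// indicE.
  rewrite -(@mean_inv_density R); apply: le_mean; [exact: bmeasM|by []|].
  by move=> x Ix; rewrite ler_piMl ?inv_density_ge0// indicE; case: (x \in A).
have h6 : `|mean u - 1| <= e / 2.
  by rewrite h2 normrN; apply: L1 => //; exact: measurable_I01.
have h7 : `|Rintegral mu A rho - mean (fun x => \1_A x * iter n transfer u x)| <= e / 2.
  by rewrite h1; exact: L1.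
move: h4 => /andP[h4 h5].
have h8 : `|mean u * Rintegral mu A inv_density - Rintegral mu A inv_density| <= e / 2.
  by rewrite -{2}[Rintegral _ _ _]mul1r -mulrBl normrM -[e / 2]mulr1 ler_pM// ger0_norm.
apply: le_trans (dist_chain h7 h3 h8) _.
by rewrite addrAC -splitr.
Qed.

Lemma rho_ae : ae_eq mu I01 (EFin \o rho) (EFin \o inv_density).
Proof.
apply: integral_ae_eq.
- exact: measurable_I01.
- exact: rho_integrable.
- by apply/measurable_EFinP; case: (lip_bmeas (@lip_inv_density R)).
- by move=> A AI mA; exact: rho_inv_density_set.
Qed.

Lemma integral_rho psi : measurable_fun I01 psi ->
  (\int[mu]_(x in I01) (psi x * rho x)%:E =
   \int[mu]_(x in I01) (psi x * inv_density x)%:E)%E.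
Proof.
move=> mpsi; have [mr _] := rhoP; have [mi _] := lip_bmeas (@lip_inv_density R).
apply: ae_eq_integral.
- exact: measurable_I01.
- by apply/measurable_EFinP; exact: measurable_funM.
- by apply/measurable_EFinP; exact: measurable_funM.
have := rho_ae; apply: filterS => x h Ix /=.
by have [->] := h Ix.
Qed.

Lemma mean_rho psi : measurable_fun I01 psi ->
  mean (fun x => psi x * rho x) = mean (fun x => psi x * inv_density x).
Proof. by move=> mpsi; rewrite /mean /Rintegral integral_rho. Qed.

End Uniqueness.

(** * Diffusion coefficient and Lyapunov exponent *)

Section Diffusion.
Context {R : realType}.
Local Notation mu := (@lebesgue_measure R).
Implicit Types (g u w psi : R -> R) (x y z a b c L M e t : R) (i n m N k : nat).
Local Notation inv := (@inv_density R).

Lemma bmeas_iter_lanford psi k : bmeas psi -> bmeas (fun x => psi (iter k lanford x)).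
Proof.
move=> bpsi; elim: k => [//|k IH].
by apply: bmeas_ext (bmeas_lanford IH) => x _; rewrite iterSr.
Qed.

Lemma mean_iter_lanford psi u L k : bmeas psi -> lip u L ->
  mean (fun x => psi (iter k lanford x) * u x) = mean (fun x => psi x * iter k transfer u x).
Proof.
move=> bpsi; elim: k u L => [//|k IH] u L lu.
have [L' lPu] := lip_transfer lu.
rewrite [RHS](_ : _ = mean (fun x => psi x * iter k transfer (transfer u) x)); last first.
  by apply: eq_mean => x _; rewrite iterSr.
rewrite -(IH _ _ lPu) -(mean_lanford (bmeas_iter_lanford k bpsi) lu).
by apply: eq_mean => x _; rewrite iterSr.
Qed.

Variable phi : R -> R.
Variables (Lphi Mphi : R).
Hypothesis lip_phi : lip phi Lphi.
Hypothesis phi_le : forall x, I01 x -> `|phi x| <= Mphi.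

Definition mphi := mean (fun x => phi x * inv x).
Definition cphi x := phi x - mphi.
Definition corr k := mean (fun x => cphi (iter k lanford x) * (cphi x * inv x)).

Let bphi : bmeas phi := lip_bmeas lip_phi.
Let binv : bmeas inv := lip_bmeas (@lip_inv_density R).

Let lip_cphi : lip cphi Lphi.
Proof. by rewrite -[Lphi]addr0; exact: lipB lip_phi (lip_cst _). Qed.
Let bcphi : bmeas cphi := lip_bmeas lip_cphi.

Lemma mean_cphi : mean (fun x => cphi x * inv x) = 0.
Proof.
transitivity (mean (fun x => phi x * inv x) - mean (fun x => mphi * inv x)).
  rewrite -meanB; [|exact: bmeasM|by apply: bmeasM => //; exact: bmeas_cst].
  by apply: eq_mean => x _; rewrite mulrBl.
by rewrite meanZ// mean_inv_density mulr1 subrr.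
Qed.

Lemma mphi_le : `|mphi| <= Mphi.
Proof.
have hm c : mean (fun x => c * inv x) = c by rewrite meanZ// mean_inv_density mulr1.
have bc c : bmeas (fun x => c * inv x) by apply: bmeasM => //; exact: bmeas_cst.
have bp : bmeas (fun x => phi x * inv x) by exact: bmeasM.
have [h1 h2] : mean (fun x => - Mphi * inv x) <= mphi /\ mphi <= mean (fun x => Mphi * inv x).
  split; apply: le_mean => // x Ix; apply: ler_wpM2r (inv_density_ge0 Ix) _ _ _;
    by have := phi_le Ix; rewrite ler_norml => /andP[].
by rewrite !hm in h1 h2; rewrite ler_norml h1 h2.
Qed.

Lemma cphi_le x : I01 x -> `|cphi x| <= 2 * Mphi.
Proof.
move=> Ix; apply: le_trans (ler_normB _ _) _.
by have := phi_le Ix; have := mphi_le; lra.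
Qed.

Let w x := cphi x * inv x.

Lemma lip_w : lip w (Lphi * 3 + 2 * Mphi * (37 / 10)).
Proof.
have i3 x : I01 x -> `|inv x| <= 3.
  by move=> Ix; rewrite ger0_norm ?inv_density_ge0// inv_density_le3.
exact: lipM lip_cphi (@lip_inv_density R) cphi_le i3.
Qed.

Lemma corrE k : corr k = mean (fun x => cphi x * iter k transfer w x).
Proof. by have lw := lip_w; rewrite /corr (mean_iter_lanford k bcphi lw). Qed.

Lemma corr_geo : exists c, forall k, `|corr k| <= c * theta ^+ k.
Proof.
have lw := lip_w; set L := (_ + _) in lw; exists (2 * Mphi * (L / 2)) => k.
have [Lk lk] := lip_iter k lw.
rewrite corrE; apply: le_mean_norm => [|x Ix]; first exact: bmeasM bcphi (lip_bmeas lk).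
rewrite normrM -mulrA ler_pM ?cphi_le//.
have := iter_bound k lw mean_cphi Ix.
by rewrite (_ : theta ^+ k * L / 2 = L / 2 * theta ^+ k)//; ring.
Qed.

Definition csum N := \sum_(k < N) corr k.

Lemma csum_cvg : exists s : R, csum @ \oo --> s.
Proof.
have [c hc] := corr_geo.
(* Makes [c theta^k] equal to the telescoping difference [c' theta^k - c' theta^(k+1)]. *)
pose c' := c / (1 - theta).
have c0 : 0 <= c by have := hc 0%N; rewrite expr0 mulr1; exact: le_trans.
have t1 := @theta_lt1 R.
have step k : `|csum k.+1 - csum k| <= c' * theta ^+ k - c' * theta ^+ k.+1.
  rewrite /csum big_ord_recr/= [_ + corr k]addrC addrK; apply: le_trans (hc k) _.
  rewrite exprS le_eqVlt; apply/orP; left; apply/eqP; rewrite /c'; field.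
  by rewrite subr_eq0 gt_eqF.
exists (geo_lim csum c'); apply/cvgrPdist_le => e e0.
have cv : c' * theta ^+ n @[n --> \oo] --> c' * 0.
  by apply: cvgMr; apply: cvg_expr; rewrite ger0_norm// ltW// theta_gt0.
rewrite mulr0 in cv; have := cv; move=> /cvgrPdist_le/(_ e e0).
apply: filterS => n; rewrite sub0r normrN => h.
rewrite distrC; apply: le_trans (geo_limP n step) _; exact: le_trans (ler_norm _) h.
Qed.

(** With [r] the residual of [chi - P chi = w], the sum of [P^k w] over [k < K] is [chi - P^K chi]
    plus the sum of [P^k r]. Pairing with [cphi] turns the left side into a partial sum of
    correlations. *)
Lemma csum_near chi L M m e : lip chi L ->
  lip (fun x => w x - (chi x - transfer chi x)) M ->
  (forall x, I01 x -> `|w x - (chi x - transfer chi x)| <= e) ->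
  exists c, forall N, `|csum N - mean (fun x => cphi x * chi x)| <=
    2 * Mphi * (m%:R * (3 * e) + 5 * M * theta ^+ m) + c * theta ^+ N.
Proof.
move=> lchi lr hr; pose r x := w x - (chi x - transfer chi x).
have lw := lip_w; have [LP lP] := lip_transfer lchi.
have r0 : mean r = 0.
  rewrite meanB ?meanB ?(mean_transfer lchi) ?mean_cphi; first by rewrite subrr subrr.
  - exact: lip_bmeas lchi.
  - exact: lip_bmeas lP.
  - exact: lip_bmeas lw.
  - by apply: bmeasB; [exact: lip_bmeas lchi|exact: lip_bmeas lP].
have M0 : 0 <= Mphi := le_trans (normr_ge0 _) (phi_le (@I01_0 R)).
pose B := m%:R * (3 * e) + 5 * M * theta ^+ m.
pose c := L / 2 + 2 * `|mean chi|.
exists (2 * Mphi * c) => K.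
have bw k := lip_bmeas (proj2_sig (cid (lip_iter k lw))).
have br k := lip_bmeas (proj2_sig (cid (lip_iter k lr))).
have bchi k := lip_bmeas (proj2_sig (cid (lip_iter k lchi))).
have tel x : I01 x -> \sum_(k < K) iter k transfer w x =
    chi x - iter K transfer chi x + \sum_(k < K) iter k transfer r x.
  move=> Ix; elim: K => [|K IH]; first by rewrite !big_ord0 subrr addr0.
  rewrite !big_ord_recr/= IH.
  have -> : iter K transfer r x =
      iter K transfer w x - (iter K transfer chi x - iter K.+1 transfer chi x).
    by rewrite iterSr -iterB// -iterB//.
  by rewrite /=; lra.
have csumE : csum K = mean (fun x => cphi x * \sum_(k < K) iter k transfer w x).
  rewrite /csum; transitivity (\sum_(k < K) mean (fun x => cphi x * iter k transfer w x)).
    by apply: eq_bigr => k _; exact: corrE.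
  rewrite -(mean_sum K (F := fun k x => cphi x * iter k transfer w x)).
    by apply: eq_mean => x _; rewrite mulr_sumr.
  by move=> k; exact: bmeasM.
have bsw : bmeas (fun x => \sum_(k < K) iter k transfer w x) by exact: (bmeas_sum K bw).
rewrite csumE -meanB; [|exact: bmeasM..|exact: (bmeasM bcphi (bchi 0%N))].
have -> : mean (fun x => cphi x * \sum_(k < K) iter k transfer w x - cphi x * chi x) =
    mean (fun x => cphi x * (\sum_(k < K) iter k transfer r x -
      (iter K transfer chi x - mean chi * inv x))).
  (* Since [cphi] has mean zero against the density, the limit [mean chi * inv] of [P^K chi] can be
     subtracted for free; [chi] may thus have any mean. *)
  have e2 : mean (fun x => cphi x * (mean chi * inv x)) = 0.
    transitivity (mean (fun x => mean chi * w x)).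
      by apply: eq_mean => x _; rewrite /w mulrCA.
    by rewrite meanZ ?mean_cphi ?mulr0//; exact: lip_bmeas lw.
  have bsr : bmeas (fun x => \sum_(k < K) iter k transfer r x) by exact: (bmeas_sum K br).
  have bmi : bmeas (fun x => mean chi * inv x) by apply: bmeasM => //; exact: bmeas_cst.
  rewrite -[LHS]addr0 -[X in _ + X = _]e2 -meanD.
  - by apply: eq_mean => x Ix /=; rewrite (tel x Ix); ring.
  - by apply: bmeasB; [exact: bmeasM|exact: (bmeasM bcphi (bchi 0%N))].
  - exact: bmeasM.
apply: le_mean_norm => [|x Ix].
  apply: bmeasM => //; apply: bmeasB; first exact: (bmeas_sum K br).
  by apply: bmeasB => //; apply: bmeasM => //; exact: bmeas_cst.
rewrite normrM -(mulrA _ c) -mulrDr ler_pM ?cphi_le//.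
apply: le_trans (ler_normB _ _) _; apply: lerD; last exact: iter_cvg.
exact: le_trans (ler_norm_sum _ _ _) (sum_iter_bound m K lr r0 hr Ix).
Qed.

Definition second_moment n := mean (fun x => (\sum_(k < n) cphi (iter k lanford x)) ^+ 2 * inv x).

(** Write the sum of length [n + 1] as [cphi] plus the sum of length [n] composed with the map.
    Invariance removes the composition from its square, and the cross terms are the correlations of
    positive order. *)
Lemma second_momentS n :
  second_moment n.+1 = second_moment n + (2 * csum n.+1 - corr 0).
Proof.
pose S n x := \sum_(k < n) cphi (iter k lanford x).
have bS k : bmeas (S k).
  by apply: (bmeas_sum k (F := fun j x => cphi (iter j lanford x))) => j; exact: bmeas_iter_lanford.
have bw : bmeas w by have lw := lip_w; exact: lip_bmeas lw.
have bSl := bmeas_lanford (bS n).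
have e1 : second_moment n = mean (fun x => S n (lanford x) * S n (lanford x) * inv x).
  transitivity (mean (fun x => S n x * S n x * inv x)).
    by apply: eq_mean => x _; rewrite expr2.
  exact/esym/(mean_inv_lanford (bmeasM (bS n) (bS n))).
have e2 : csum n.+1 - corr 0 = mean (fun x => S n (lanford x) * w x).
  rewrite /csum big_ord_recl/= addrC addKr.
  rewrite -(mean_sum n (F := fun k x => cphi (iter k.+1 lanford x) * w x)); last first.
    by move=> k; apply: bmeasM => //; exact: (bmeas_iter_lanford k.+1).
  apply: eq_mean => x _; rewrite mulr_suml; apply: eq_bigr => k _.
  by rewrite iterSr.
have e3 : corr 0 = mean (fun x => cphi x * w x) by [].
rewrite (_ : 2 * csum n.+1 - corr 0 = 2 * (csum n.+1 - corr 0) + corr 0); last by ring.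
rewrite e1 e2 e3 -meanZ; last exact: bmeasM.
rewrite -meanD; [|by apply: bmeasM; [exact: bmeas_cst|exact: bmeasM]|exact: bmeasM].
rewrite -meanD; last first.
- by apply: bmeasD; [apply: bmeasM; [exact: bmeas_cst|exact: bmeasM]|exact: bmeasM].
- by apply: bmeasM => //; exact: bmeasM.
apply: eq_mean => x _; rewrite /S /w big_ord_recl/=.
rewrite [X in (_ + X) ^+ 2](_ : _ = \sum_(k < n) cphi (iter k lanford (lanford x))); last first.
  by apply: eq_bigr => k _; rewrite -iterS iterSr.
ring.
Qed.

(** The increments of the second moment converge to the Green-Kubo value, so their Cesaro means
    do. *)
Lemma second_moment_cvg (s : R) : csum @ \oo --> s ->
  (n%:R^-1 * second_moment n) @[n --> \oo] --> 2 * s - corr 0.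
Proof.
move=> cs; pose d n := 2 * csum n.+1 - corr 0.
have cd : d @ \oo --> 2 * s - corr 0.
  apply: cvgB; last exact: cvg_cst.
  apply: cvgMr; rewrite (_ : (fun n => csum n.+1) = [sequence csum n.+1]_n)//.
  by rewrite (cvg_shiftS csum).
have := cesaro cd; rewrite -(cvg_shiftS (fun n => n%:R^-1 * second_moment n)).
apply: cvg_trans; apply: near_eq_cvg; near=> n; rewrite /arithmetic_mean/=; congr (_ * _).
elim: n.+1 => [|k IH].
  rewrite /series/= big_geq// /second_moment -[LHS](mean_cst 0).
  by apply: eq_mean => x _; rewrite big_ord0 expr0n mul0r.
by rewrite second_momentS -IH seriesSr.
Unshelve. all: by end_near. Qed.

Variable rho : R -> R.
Hypothesis rhoP : acip_density lanford rho.

Lemma diffusion_seqE n : diffusion_seq lanford rho phi n = n%:R^-1 * second_moment n.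
Proof.
rewrite /diffusion_seq /second_moment; congr (_ * _).
have -> : Rintegral mu I01 (fun x => phi x * rho x) = mphi.
  by rewrite -/(mean _) (mean_rho rhoP)//; case: bphi.
rewrite -/(mean _).
have e x : birkhoff lanford phi n x - n%:R * mphi = \sum_(k < n) cphi (iter k lanford x).
  by rewrite /birkhoff /cphi sumrB sumr_const card_ord mulr_natl.
transitivity (mean (fun x => (\sum_(k < n) cphi (iter k lanford x)) ^+ 2 * rho x)).
  by apply: eq_mean => x _; rewrite e.
have bS : bmeas (fun x => \sum_(k < n) cphi (iter k lanford x)).
  by apply: (bmeas_sum n (F := fun k x => cphi (iter k lanford x))) => j; exact: bmeas_iter_lanford.
apply: (mean_rho rhoP (psi := fun x => (\sum_(k < n) cphi (iter k lanford x)) ^+ 2)).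
by have [] := bmeasM bS bS.
Qed.

End Diffusion.

(** * The Lyapunov exponent as an integral of [ln (5/2 - x)] *)

Section Lyapunov.
Context {R : realType}.
Local Notation mu := (@lebesgue_measure R).
Implicit Types (x y : R).
Local Notation inv := (@inv_density R).

Lemma quad_derive x : is_derive x 1 (@quad R) (5 / 2 - x).
Proof. by apply: is_derive_eq; rewrite /GRing.scale/=; field. Qed.

Lemma lanford_derive x : I01 x -> x != 0 -> x != cut -> x != 1 ->
  derive1 (@lanford R) x = 5 / 2 - x.
Proof.
move=> /I01E/andP[x0 x1] xn0 xnc xn1.
have {}x0 : 0 < x by rewrite lt_def xn0.
have {}x1 : x < 1 by rewrite lt_neqAle xn1.
have dq := quad_derive x.
have /I01E/andP[c0 c1] := @I01_cut R.
rewrite derive1E; have [xc|cx] := ltP x cut.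
  transitivity ('D_1 (@quad R) x); last by rewrite derive_val.
  apply: near_eq_derive.
  near=> y; apply: lanford_lt_cut.
    apply/I01E; apply/andP; split; apply/ltW; near: y.
      exact: lt_nbhsr.
    exact: lt_nbhsl.
  near: y; exact: lt_nbhsl.
have {}cx : cut < x by rewrite lt_neqAle eq_sym xnc.
have dq1 : is_derive x 1 (fun y => quad y - 1) (5 / 2 - x).
  by rewrite -[5 / 2 - x]subr0; exact: is_deriveB.
transitivity ('D_1 (fun y => quad y - 1) x); last by rewrite derive_val.
apply: near_eq_derive.
near=> y; apply: lanford_ge_cut.
- apply/I01E; apply/andP; split; apply/ltW; near: y.
    exact: lt_nbhsr.
  exact: lt_nbhsl.
- apply/ltW; near: y; exact: lt_nbhsr.
- near: y; exact: lt_nbhsl.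
Unshelve. all: by end_near. Qed.

Lemma ln_bounds x : I01 x -> `|ln (5 / 2 - x)| <= 2.
Proof.
move=> /I01E/andP[x0 x1]; have h1 : 0 < 5 / 2 - x by lra.
rewrite ger0_norm; last by apply: ln_ge0; lra.
rewrite -ler_expR lnK ?posrE//; have := @expR_ge1Dx R 2; lra.
Qed.

Lemma bmeas_ln : bmeas (fun x => ln (5 / 2 - x)).
Proof.
split; last by exists 2 => x; exact: ln_bounds.
apply: subspace_continuous_measurable_fun; first exact: measurable_I01.
apply: continuous_in_subspaceT => x /[!inE] /I01E/andP[x0 x1].
apply: (@continuous_comp _ _ _ (fun y : R => 5 / 2 - y) (@ln R)).
  by apply: continuousB; [exact: cst_continuous|exact: cvg_id].
by apply: continuous_ln; lra.
Qed.

(** The derivative is [5/2 - x] away from the three discontinuities [0], [cut], [1] of the map on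
    the line, which form a null set. *)
Lemma lyap_integralE (rho : R -> R) : acip_density lanford rho ->
  lyap_integral lanford rho = (mean (fun x => ln (5 / 2 - x) * inv x))%:E.
Proof.
move=> rhoP; have [mln _] := bmeas_ln.
have bl := bmeasM bmeas_ln (lip_bmeas (@lip_inv_density R)).
have e x : I01 x -> ~ [set 0; cut; 1] x ->
    ln `|derive1 lanford x| = ln (5 / 2 - x).
  move=> Ix nx; rewrite lanford_derive//.
  - by move/I01E : Ix => /andP[x0 x1]; rewrite ger0_norm//; lra.
  - by apply/eqP => x0; apply: nx; left; left.
  - by apply/eqP => x0; apply: nx; left; right.
  - by apply/eqP => x0; apply: nx; right.
pose D x := ln `|derive1 lanford x|; pose l x := ln (5 / 2 - x).
have c0 : 0 < cut :> R.
  by have := br_lt (leq0n 1) (@I01_0 R) (@I01_1 R); rewrite br0_0 ltr01.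
have c1 : cut < 1 :> R.
  by have := br_lt (leqnn 1) (@I01_0 R) (@I01_1 R); rewrite br1_0 br1_1 ltr01.
(* At the exceptional points [derive1] has no useful value; [D] is nevertheless bounded and
   measurable, being [l] corrected by multiples of three point indicators. *)
have bD : bmeas D.
  have b1 (p : R) : bmeas (fun x => (D p - l p) * \1_[set p] x).
    by apply: bmeasM (bmeas_cst _) (bmeas_indic _); exact: measurable_set1.
  apply: bmeas_ext (bmeasD (bmeasD (bmeasD bmeas_ln (b1 0)) (b1 cut)) (b1 1)) => x Ix.
  have i1 (p : R) : \1_[set p] x = (x == p)%:R :> R.
    by rewrite indicE (_ : (x \in [set p]) = (x == p))//; apply/idP/eqP; rewrite inE.
  rewrite !i1 -/(l x).
  have [->|x0] := eqVneq x 0; first by rewrite !lt_eqF//= !mulr0 mulr1 !addr0 addrC subrK.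
  have [->|xc] := eqVneq x cut; first by rewrite lt_eqF//= !mulr0 mulr1 !addr0 addrC subrK.
  have [->|x1] := eqVneq x 1; first by rewrite !mulr0 mulr1 !addr0 addrC subrK.
  rewrite !mulr0 !addr0 /D e// => -[[]|]; exact/eqP.
have mD : measurable_fun I01 D by case: bD.
rewrite /lyap_integral (integral_rho rhoP mD).
transitivity (\int[mu]_(x in I01) (ln (5 / 2 - x) * inv x)%:E)%E.
  apply: ae_eq_integral.
  - exact: measurable_I01.
  - apply/measurable_EFinP; apply: measurable_funM => //.
    by case: (lip_bmeas (@lip_inv_density R)).
  - by apply/measurable_EFinP; case: bl.
  exists [set 0; cut; 1]; split.
  - by apply: measurableU; [apply: measurableU|]; exact: measurable_set1.
  - apply: countable_lebesgue_measure0; apply: finite_set_countable.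
    by rewrite !finite_setU; do !split; exact: finite_set1.
  - by move=> x /= h; apply: contrapT => nx; apply: h => Ix; rewrite /D e.
rewrite -[LHS]fineK//; apply: integrable_fin_num (bmeas_integrable bl).
exact: measurable_I01.
Qed.

End Lyapunov.

(** * Integer polynomials in the Chebyshev basis *)

Section IntegerPolynomials.

(** Never puts a zero on the empty list. Divisions truncate towards zero, so negligible top
    coefficients disappear and the lists stay much shorter than the degree of the exact
    composition. *)
Definition zcons (c : Z) (p : seq Z) : seq Z :=
  match c, p with Z0, [::] => [::] | _, _ => c :: p end.

Fixpoint padd (p q : seq Z) : seq Z :=
  match p, q with
  | [::], _ => q
  | _, [::] => p
  | a :: p', b :: q' => zcons (Z.add a b) (padd p' q')
  end.

Fixpoint pmapz (f : Z -> Z) (p : seq Z) : seq Z :=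
  match p with [::] => [::] | a :: p' => zcons (f a) (pmapz f p') end.

Definition popp := pmapz Z.opp.

Definition pscale (c : Z) := pmapz (Z.mul c).

(* Multiplication by [2 z] in the basis of Chebyshev polynomials of the second
   kind, where [2 z U_k = U_(k+1) + U_(k-1)] and [U_(-1) = 0]. *)
Definition pdbl (p : seq Z) : seq Z := padd (Z0 :: p) (behead p).

(** The Clenshaw recurrence [b_k = h_k + 2 w b_(k+1) - b_(k+2)] with polynomials as values: [st]
    multiplies by [2 w] up to rounding, so the first component represents the composition of [h]
    with [w]. *)
Fixpoint clenshaw (st : seq Z -> seq Z) (h : seq Z) : seq Z * seq Z :=
  match h with
  | [::] => ([::], [::])
  | c :: h' => let '(b1, b2) := clenshaw st h' in
      (padd [:: c] (padd (st b1) (popp b2)), b1)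
  end.

(** Started at [k = 1], it bounds the sup norm on [[-1, 1]], because [U_j] is at most [j + 1]
    there. *)
Fixpoint wnorm (k : Z) (p : seq Z) : Z :=
  match p with
  | [::] => Z0
  | a :: p' => Z.add (Z.mul (Z.abs a) k) (wnorm (Z.succ k) p')
  end.

End IntegerPolynomials.

(** * Chebyshev polynomials and evaluation of coefficient lists *)

Section ChebyshevBasis.
Context {R : realType}.
Implicit Types (z x X e d : R) (p q h : seq Z) (g : seq R) (u : nat -> R).

Definition zr (a : Z) : R := (int_of_Z a)%:~R.

Lemma zrD a b : zr (Z.add a b) = zr a + zr b.
Proof. by rewrite /zr -intrD; congr (_%:~R); lia. Qed.

Lemma zrM a b : zr (Z.mul a b) = zr a * zr b.
Proof. by rewrite /zr -intrM; congr (_%:~R); lia. Qed.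

Lemma zrN a : zr (Z.opp a) = - zr a.
Proof. by rewrite /zr -mulrNz; congr (_%:~R); lia. Qed.

Lemma zrB a b : zr (Z.sub a b) = zr a - zr b.
Proof. by rewrite /Z.sub zrD zrN. Qed.

Lemma zr_norm a : zr (Z.abs a) = `|zr a|.
Proof. by rewrite /zr -intr_norm; congr (_%:~R); lia. Qed.

Lemma zr_le a b : Z.leb a b -> zr a <= zr b.
Proof. by move=> ab; rewrite /zr ler_int; lia. Qed.

Lemma zr0 : zr Z0 = 0. Proof. by []. Qed.

Lemma zr_nat (n : nat) : zr (Z.of_nat n) = n%:R.
Proof. by rewrite /zr (_ : int_of_Z _ = n)//; lia. Qed.

(** The pair [(T_n, U_(n-1))], that is [cos (n t)] and [sin (n t) / sin t] for [z = cos t]; the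
    recurrence is the addition formula. The index shift makes [U_(-1) = 0] the initial value. *)
Fixpoint TW z (n : nat) : R * R :=
  if n is n'.+1 then
    let '(t, w) := TW z n' in (z * t - (1 - z ^+ 2) * w, z * w + t)
  else (1, 0).

Definition chT n z := (TW z n).1.
Definition chW n z := (TW z n).2.

Lemma chTS n z : chT n.+1 z = z * chT n z - (1 - z ^+ 2) * chW n z.
Proof. by rewrite /chT /chW/=; case: (TW z n). Qed.

Lemma chWS n z : chW n.+1 z = z * chW n z + chT n z.
Proof. by rewrite /chT /chW/=; case: (TW z n). Qed.

Lemma chWSS n z : chW n.+2 z = 2 * z * chW n.+1 z - chW n z.
Proof. by rewrite !chWS chTS; ring. Qed.

Lemma pell n z : chT n z ^+ 2 + (1 - z ^+ 2) * chW n z ^+ 2 = 1.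
Proof.
elim: n => [|n IH]; first by rewrite /chT /chW/=; ring.
by rewrite chTS chWS -[RHS]IH; ring.
Qed.

Lemma chT_le1 n z : `|z| <= 1 -> `|chT n z| <= 1.
Proof.
move=> z1; rewrite -(@ler_pXn2r _ 2)// ?nnegrE// expr1n real_normK ?num_real//.
have z2 : z ^+ 2 <= 1 by rewrite -real_normK ?num_real// expr_le1.
rewrite -(pell n z) lerDl mulr_ge0// ?sqr_ge0//.
by rewrite subr_ge0.
Qed.

Lemma chW_le n z : `|z| <= 1 -> `|chW n z| <= n%:R.
Proof.
move=> z1; elim: n => [|n IH]; first by rewrite normr0.
rewrite chWS; apply: le_trans (ler_normD _ _) _.
rewrite -natr1 lerD ?chT_le1// normrM.
by rewrite -[leRHS]mul1r ler_pM.
Qed.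

Lemma chT1 n : chT n 1 = 1.
Proof. by elim: n => [//|n IH]; rewrite chTS IH expr1n subrr mul0r subr0 mulr1. Qed.

Lemma chTN1 n : chT n (-1) = (-1) ^+ n.
Proof.
by elim: n => [//|n IH]; rewrite chTS IH sqrrN expr1n subrr mul0r subr0 -exprS.
Qed.

Fixpoint lin u g : R :=
  if g is a :: g' then a * u 0%N + lin (fun n => u n.+1) g' else 0.

Lemma lin_le u g d : (forall n, `|u n| <= d * n.+1%:R) -> 0 <= d ->
  forall e, (forall a, a \in g -> `|a| <= e) -> 0 <= e ->
  `|lin u g| <= e * (d * (size g)%:R ^+ 2).
Proof.
move=> ud d0 e ge e0.
(* Generalised to weights that start at [m + 1], since the induction shifts [u]. *)
suff h m : (forall n, `|u n| <= d * (n + m).+1%:R) ->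
    `|lin u g| <= e * (d * ((size g)%:R * (size g + m)%:R)).
  by have := h 0%N; rewrite addn0 expr2; apply => n; rewrite addn0.
move: ge; elim: g u m {ud} => [|a g IH] u m ge ud /=.
  by rewrite normr0 !mul0r !mulr0.
apply: le_trans (ler_normD _ _) _.
have h1 : `|a * u 0%N| <= e * (d * m.+1%:R).
  by rewrite normrM ler_pM ?ge ?mem_head//; have := ud 0%N; rewrite add0n.
have h2 : `|lin (fun n => u n.+1) g| <= e * (d * ((size g)%:R * (size g + m.+1)%:R)).
  apply: IH => [b bg|n]; first by apply: ge; rewrite inE bg orbT.
  by have := ud n.+1; rewrite addSnnS.
apply: le_trans (lerD h1 h2) _; rewrite -mulrDr ler_wpM2l// -mulrDr ler_wpM2l//.
rewrite -natrM -natrD -natrM ler_nat; nia.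
Qed.

Definition chebU z := fun n => chW n.+1 z.

Definition ev p z : R := lin (chebU z) (map zr p).

Lemma lin_zcons u c p : lin u (map zr (zcons c p)) = zr c * u 0%N + lin (fun n => u n.+1) (map zr p).
Proof. by case: c p => [|c|c] [|a p]//=; rewrite zr0 mul0r addr0. Qed.

Lemma lin_padd u p q : lin u (map zr (padd p q)) = lin u (map zr p) + lin u (map zr q).
Proof.
elim: p q u => [|a p IH] [|b q] u; rewrite /= ?add0r ?addr0//.
by rewrite lin_zcons IH zrD; ring.
Qed.

Lemma lin_pmapz u f c p : (forall a, zr (f a) = c * zr a) ->
  lin u (map zr (pmapz f p)) = c * lin u (map zr p).
Proof.
move=> fc; elim: p u => [|a p IH] u /=; first by rewrite mulr0.
by rewrite lin_zcons IH fc; ring.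
Qed.

Lemma evD p q z : ev (padd p q) z = ev p z + ev q z.
Proof. exact: lin_padd. Qed.

Lemma evN p z : ev (popp p) z = - ev p z.
Proof. by rewrite /ev (@lin_pmapz _ _ (-1)) ?mulN1r// => a; rewrite zrN mulN1r. Qed.

Lemma evZ c p z : ev (pscale c p) z = zr c * ev p z.
Proof. by apply: lin_pmapz => a; rewrite zrM. Qed.

(** The condition [v 0 = 0], which is [U_(-1) = 0] in the application, is what turns the downward
    shift into [behead] on coefficients. *)
Lemma lin_recur (v : nat -> R) X g : v 0%N = 0 -> (forall n, v n.+2 = X * v n.+1 - v n) ->
  lin (fun n => v n.+2) g = X * lin (fun n => v n.+1) g - lin (fun n => v n.+1) (behead g).
Proof.
move=> v0 vS; have h w g' : (forall n, w n.+2 = X * w n.+1 - w n) ->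
    lin (fun n => w n.+2) g' = X * lin (fun n => w n.+1) g' - lin w g'.
  elim: g' w => [|a g' IH] w wS /=; first by rewrite mulr0 subr0.
  by rewrite (IH (fun n => w n.+1))// wS; ring.
by rewrite (h v)//; case: g => [//|a g] /=; rewrite v0 mulr0 add0r.
Qed.

Lemma lin_chebUS g z :
  lin (fun n => chebU z n.+1) g = 2 * z * lin (chebU z) g - lin (chebU z) (behead g).
Proof. by apply: (@lin_recur (fun n => chW n z)) => // n; exact: chWSS. Qed.

Lemma ev_pdbl p z : ev (pdbl p) z = 2 * z * ev p z.
Proof.
rewrite /ev /pdbl lin_padd /= zr0 mul0r add0r lin_chebUS.
by rewrite behead_map subrK.
Qed.

Lemma chebU_le z n : `|z| <= 1 -> `|chebU z n| <= n.+1%:R.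
Proof. exact: chW_le. Qed.

Lemma ev_wnorm p z : `|z| <= 1 -> `|ev p z| <= zr (wnorm 1 p).
Proof.
move=> z1; rewrite /ev.
suff h u m : (forall n, `|u n| <= (n + m)%:R) ->
    `|lin u (map zr p)| <= zr (wnorm (Z.of_nat m) p).
  by apply: (h _ 1%N) => n; rewrite addn1; exact: chebU_le.
elim: p u m => [|a p IH] u m um /=; first by rewrite normr0 zr0.
rewrite zrD zrM zr_norm zr_nat; apply: le_trans (ler_normD _ _) _; apply: lerD.
  by rewrite normrM ler_wpM2l//; have := um 0%N.
rewrite (_ : Z.succ (Z.of_nat m) = Z.of_nat m.+1); last by lia.
by apply: IH => n; have := um n.+1; rewrite addSnnS.
Qed.

Lemma size_zcons c p : (size (zcons c p) <= (size p).+1)%N.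
Proof. by case: c p => [|c|c] [|a p]. Qed.

Lemma size_padd p q : (size (padd p q) <= maxn (size p) (size q))%N.
Proof.
elim: p q => [|a p IH] [|b q]; rewrite /= ?maxn0//.
by apply: leq_trans (size_zcons _ _) _; rewrite maxnSS ltnS.
Qed.

Lemma size_pmapz f p : (size (pmapz f p) <= size p)%N.
Proof. by elim: p => [//|a p IH] /=; apply: leq_trans (size_zcons _ _) _. Qed.

Lemma size_pdbl p : (size (pdbl p) <= (size p).+1)%N.
Proof.
apply: leq_trans (size_padd _ _) _; rewrite geq_max leqnn/= size_behead.
by apply: leq_trans (leq_pred _) _.
Qed.

Lemma ev_round f X p z e : (forall a, `|zr (f a) - X * zr a| <= e) -> 0 <= e ->
  `|z| <= 1 -> `|ev (pmapz f p) z - X * ev p z| <= e * (size p)%:R ^+ 2.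
Proof.
move=> fe e0 z1.
have -> : ev (pmapz f p) z - X * ev p z =
    lin (chebU z) (map (fun a => zr (f a) - X * zr a) p).
  rewrite /ev; elim: p (chebU z) => [|a p IH] u /=; first by rewrite mulr0 subr0.
  by rewrite lin_zcons -IH; ring.
apply: le_trans (@lin_le _ _ 1 _ ler01 e _ e0) _.
- by move=> n; rewrite mul1r; exact: chebU_le.
- by move=> _ /mapP[a _ ->].
- by rewrite size_map mul1r.
Qed.

Lemma lin_chebU_cons (a : R) g z :
  lin (chebU z) (a :: g) = a + (2 * z * lin (chebU z) g - lin (chebU z) (behead g)).
Proof.
by rewrite /= lin_chebUS /chebU chWS /chW /chT/= mulr0 add0r mulr1.
Qed.

Lemma ev_cons c h z : ev (c :: h) z = zr c + (2 * z * ev h z - ev (behead h) z).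
Proof. by rewrite /ev map_cons lin_chebU_cons behead_map. Qed.

Lemma clenshaw_cons st c h : clenshaw st (c :: h) =
  (padd [:: c] (padd (st (clenshaw st h).1) (popp (clenshaw st h).2)), (clenshaw st h).1).
Proof. by rewrite [LHS]/=; case: (clenshaw st h). Qed.

(* A rounding error committed at stage [k] is amplified by [U_k(w)], like the
   coefficient [h_k] itself. *)
Lemma clenshaw_error st h s z w e N : `|w| <= 1 -> 0 <= e ->
  (forall p, (size (st p) <= size p + s)%N) -> (0 < s)%N ->
  (forall p, (size p <= N)%N -> `|ev (st p) z - 2 * w * ev p z| <= e) ->
  (size h * s <= N)%N ->
  `|ev (clenshaw st h).1 z - ev h w| <= e * (size h)%:R ^+ 2.
Proof.
move=> w1 e0 sts s0 ste hN.
(* A backward error statement: the rounded recurrence computes the exact value for the coefficients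
   [h + d], where [d_k] is the error committed at stage [k]. *)
suff [d [sd de _ _ ->]] : exists d : seq R, [/\ size d = size h,
    forall a, a \in d -> `|a| <= e,
    (size (clenshaw st h).1 <= size h * s)%N /\ (size (clenshaw st h).2 <= size h * s)%N,
    ev (clenshaw st h).2 z = ev (behead h) w + lin (chebU w) (behead d) &
    ev (clenshaw st h).1 z = ev h w + lin (chebU w) d].
  rewrite addrC addKr -sd -[(size d)%:R ^+ 2]mul1r; apply: lin_le => //.
  by move=> n; rewrite mul1r; exact: chebU_le.
elim: h hN => [|c h IH] hN.
  by exists [::]; split => //; rewrite /ev/= addr0.
have {}hN' : (size h * s <= N)%N by apply: leq_trans hN; rewrite /= mulSn leq_addl.
have [d [sd de [s1 s2] e2 e1]] := IH hN'.
rewrite clenshaw_cons; case: (clenshaw st h) s1 s2 e2 e1 => b1 b2 s1 s2 e2 e1.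
pose a := ev (st b1) z - 2 * w * ev b1 z.
exists (a :: d); split.
- by rewrite /= sd.
- move=> b; rewrite inE => /predU1P[->|]; last exact: de.
  by apply: ste; exact: leq_trans s1 hN'.
- rewrite [size (c :: h)]/= mulSn; split; last by apply: leq_trans s1 _; exact: leq_addl.
  apply: leq_trans (size_padd _ _) _; rewrite geq_max; apply/andP; split.
    by apply: leq_trans s0 _; rewrite leq_addr.
  apply: leq_trans (size_padd _ _) _; rewrite geq_max; apply/andP; split.
    by apply: leq_trans (sts _) _; rewrite addnC leq_add2l.
  apply: leq_trans (size_pmapz _ _) _; apply: leq_trans s2 _.
  exact: leq_addl.
- exact: e1.
- rewrite [LHS]evD evD evN e2.
  have -> : ev (st b1) z = a + 2 * w * ev b1 z by rewrite /a subrK.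
  by rewrite e1 !ev_cons lin_chebU_cons [ev [::] _]/ev/=; ring.
Qed.

End ChebyshevBasis.

(** * Rounded integer versions of the operations *)

Section CompositionSteps.

Definition quarter (a : Z) : Z := Z.quot2 (Z.quot2 a).

(** Multiplies by [2 w] for [w = z^2 / 8 + z - 1 / 8], which is [1 - quad x] at [z = 1 - 2 x]. *)
Definition step_quad (b : seq Z) : seq Z :=
  padd (pdbl (padd b (pmapz (fun a => quarter (quarter a)) (pdbl b))))
    (popp (pmapz quarter b)).

(** This and [step_down] multiply by [2 w] for [w = (1 + z) / 2 = 1 - y] and
    [w = (z - 1) / 2 = - y], the values of [1 - quad] on the two branches over [y]. *)
Definition step_up (b : seq Z) : seq Z := padd b (pmapz Z.quot2 (pdbl b)).

Definition step_down (b : seq Z) : seq Z :=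
  padd (popp b) (pmapz Z.quot2 (pdbl b)).

(** Represents [4 s E]: the factor 4 makes [4 (5/2 - x) = 8 + 2 z] integral. *)
Definition odd_ext (g : seq Z) : seq Z :=
  let A := (clenshaw step_quad g).1 in padd (pscale 8 A) (pdbl A).

Definition transfer_poly (g : seq Z) : seq Z :=
  padd (clenshaw step_up g).1 (clenshaw step_down g).1.

(** Multiplies by [16 x^2 = 4 (1 - z)^2]. *)
Definition pphi (p : seq Z) : seq Z :=
  padd (pscale 4 p) (padd (pscale (-4) (pdbl p)) (pdbl (pdbl p))).

(** The mean of [U_k (1 - 2 x)] over [[0, 1]] is [1 / (k + 1)] for even [k] and 0 for odd [k]. *)
Fixpoint pmean_from (even : bool) (k : Z) (p : seq Z) : Z :=
  match p with
  | [::] => Z0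
  | a :: p' => let r := pmean_from (~~ even) (Z.succ k) p' in
      if even then Z.add (Z.quot a k) r else r
  end.

Definition pmean (p : seq Z) : Z := pmean_from true 1 p.

Fixpoint pquot_from (k : Z) (p : seq Z) : seq Z :=
  match p with
  | [::] => [::]
  | a :: p' => Z.quot (Z.mul 2 a) k :: pquot_from (Z.succ k) p'
  end.

Fixpoint alt_sum (p : seq Z) : Z :=
  match p with [::] => Z0 | a :: p' => Z.sub a (alt_sum p') end.

(* Four times the antiderivative that vanishes at [-1], from
   [int U_k = T_(k+1) / (k + 1)] and [2 T_(k+1) = U_(k+1) - U_(k-1)]. *)
Definition pint (p : seq Z) : seq Z :=
  let q := pquot_from 1 p in
  padd [:: Z.mul 2 (alt_sum q)] (padd (Z0 :: q) (popp (behead q))).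

End CompositionSteps.

(** * A priori bounds for the rounding errors *)

Section CompositionErrors.
Context {R : realType}.
Implicit Types (z x y X e d c : R) (p q h b : seq Z) (g : seq Z).

Lemma zr_quot2 a : `|zr (Z.quot2 a) - 2^-1 * zr a| <= 2^-1 :> R.
Proof.
have h : Z.leb (Z.abs (Z.sub (Z.mul 2 (Z.quot2 a)) a)) 1.
  by case: a => [|[a|a|]|[a|a|]]; cbn [Z.quot2 Pos.div2]; lia.
have := zr_le (R := R) h; rewrite zr_norm zrB zrM.
have -> : zr 2 = 2 :> R by [].
have -> : zr 1 = 1 :> R by [].
by norm_lra.
Qed.

Lemma zr_quarter a : `|zr (quarter a) - 4^-1 * zr a| <= 1 :> R.
Proof.
have := zr_quot2 a; have := zr_quot2 (Z.quot2 a); rewrite -/(quarter a).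
by norm_lra.
Qed.

Lemma zr_sixteenth a : `|zr (quarter (quarter a)) - 16^-1 * zr a| <= 2 :> R.
Proof.
have := zr_quarter a; have := zr_quarter (quarter a).
by norm_lra.
Qed.

Lemma size_step_quad p : (size (step_quad p) <= size p + 2)%N.
Proof.
apply: leq_trans (size_padd _ _) _; rewrite geq_max; apply/andP; split.
  apply: leq_trans (size_pdbl _) _; rewrite addn2 ltnS.
  apply: leq_trans (size_padd _ _) _; rewrite geq_max leqnSn/=.
  by apply: leq_trans (size_pmapz _ _) _; exact: size_pdbl.
apply: leq_trans (size_pmapz _ _) _; apply: leq_trans (size_pmapz _ _) _.
exact: leq_addr.
Qed.

Lemma size_step_up p : (size (step_up p) <= size p + 2)%N.
Proof.
apply: leq_trans (size_padd _ _) _; rewrite geq_max leq_addr/=.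
apply: leq_trans (size_pmapz _ _) _; apply: leq_trans (size_pdbl _) _.
by rewrite addn2 leqnSn.
Qed.

Lemma size_step_down p : (size (step_down p) <= size p + 2)%N.
Proof.
apply: leq_trans (size_padd _ _) _; rewrite geq_max; apply/andP; split.
  by apply: leq_trans (size_pmapz _ _) _; rewrite leq_addr.
apply: leq_trans (size_pmapz _ _) _; apply: leq_trans (size_pdbl _) _.
by rewrite addn2 leqnSn.
Qed.

(** The worst case is [step_quad]: rounding the division by 16 costs 2 per coefficient, doubled by
    the factor [2 z], and rounding the division by 4 costs 1 more. *)
Definition step_err (N : nat) : R := 5 * N.+1%:R ^+ 2.

Lemma step_err_ge0 N : 0 <= step_err N.
Proof. by rewrite mulr_ge0// exprn_ge0. Qed.

Lemma le_size_sqr p (N : nat) : (size p <= N.+1)%N -> (size p)%:R ^+ 2 <= N.+1%:R ^+ 2 :> R.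
Proof. by move=> pN; rewrite ler_pXn2r ?nnegrE// ler_nat. Qed.

Lemma step_quad_err N p z : `|z| <= 1 -> (size p <= N)%N ->
  `|ev (step_quad p) z - 2 * (z ^+ 2 / 8 + z - 8^-1) * ev p z| <= step_err N.
Proof.
move=> z1 pN; rewrite /step_quad /step_err evD ev_pdbl evD evN.
have d1 := ev_round (pdbl p) zr_sixteenth (ler0n R 2) z1.
have d2 := ev_round p zr_quarter ler01 z1.
have := le_size_sqr (leq_trans (size_pdbl p) (_ : _ <= N.+1)%N); rewrite ltnS => /(_ pN) s1.
have s2 := le_size_sqr (leqW pN).
move: d1 d2; rewrite ev_pdbl mul1r.
set a := ev (pmapz _ (pdbl p)) z; set b := ev (pmapz quarter p) z.
set A := (size (pdbl p))%:R ^+ 2 in s1 *; set B := (size p)%:R ^+ 2 in s2 *.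
set C := N.+1%:R ^+ 2 in s1 s2 *.
move=> d1 d2.
rewrite (_ : _ - _ = 2 * z * (a - 16^-1 * (2 * z * ev p z)) - (b - 4^-1 * ev p z)); last by field.
apply: le_trans (ler_normB _ _) _.
have : `|2 * z * (a - 16^-1 * (2 * z * ev p z))| <= 2 * (2 * A).
  by rewrite normrM ler_pM// normrM ger0_norm//; lra.
lra.
Qed.

Lemma step_up_err N p z : `|z| <= 1 -> (size p <= N)%N ->
  `|ev (step_up p) z - 2 * ((1 + z) / 2) * ev p z| <= step_err N.
Proof.
move=> z1 pN; rewrite /step_up /step_err evD.
have h : 0 <= 2^-1 :> R by lra.
have d1 := ev_round (pdbl p) zr_quot2 h z1.
have := le_size_sqr (leq_trans (size_pdbl p) (_ : _ <= N.+1)%N); rewrite ltnS => /(_ pN) s1.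
move: d1; rewrite ev_pdbl; set a := ev (pmapz _ _) z => d1.
rewrite (_ : _ - _ = a - 2^-1 * (2 * z * ev p z)); last by field.
apply: le_trans d1 _; have : 0 <= N.+1%:R ^+ 2 :> R by exact: exprn_ge0.
by move: s1; lra.
Qed.

Lemma step_down_err N p z : `|z| <= 1 -> (size p <= N)%N ->
  `|ev (step_down p) z - 2 * ((z - 1) / 2) * ev p z| <= step_err N.
Proof.
move=> z1 pN; rewrite /step_down /step_err evD evN.
have h : 0 <= 2^-1 :> R by lra.
have d1 := ev_round (pdbl p) zr_quot2 h z1.
have := le_size_sqr (leq_trans (size_pdbl p) (_ : _ <= N.+1)%N); rewrite ltnS => /(_ pN) s1.
move: d1; rewrite ev_pdbl; set a := ev (pmapz _ _) z => d1.
rewrite (_ : _ - _ = a - 2^-1 * (2 * z * ev p z)); last by field.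
apply: le_trans d1 _; have : 0 <= N.+1%:R ^+ 2 :> R by exact: exprn_ge0.
by move: s1; lra.
Qed.

(** Each of the [n] stages lengthens the list by at most 2, hence the size bound [n * 2]. *)
Definition comp_err (n : nat) : R := step_err (n * 2) * n%:R ^+ 2.

Lemma comp_quad g z : `|z| <= 1 ->
  `|ev (clenshaw step_quad g).1 z - ev g (z ^+ 2 / 8 + z - 8^-1)| <= comp_err (size g).
Proof.
move=> z1; have w1 : `|z ^+ 2 / 8 + z - 8^-1| <= 1.
  by move: z1; rewrite !ler_norml => /andP[? ?]; apply/andP; split; nra.
apply: (clenshaw_error w1 (step_err_ge0 _) size_step_quad _ _ (leqnn _)) => // p.
exact: step_quad_err.
Qed.

Lemma comp_up g z : `|z| <= 1 ->
  `|ev (clenshaw step_up g).1 z - ev g ((1 + z) / 2)| <= comp_err (size g).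
Proof.
move=> z1; have w1 : `|(1 + z) / 2| <= 1.
  by move: z1; norm_lra.
apply: (clenshaw_error w1 (step_err_ge0 _) size_step_up _ _ (leqnn _)) => // p.
exact: step_up_err.
Qed.

Lemma comp_down g z : `|z| <= 1 ->
  `|ev (clenshaw step_down g).1 z - ev g ((z - 1) / 2)| <= comp_err (size g).
Proof.
move=> z1; have w1 : `|(z - 1) / 2| <= 1.
  by move: z1; norm_lra.
apply: (clenshaw_error w1 (step_err_ge0 _) size_step_down _ _ (leqnn _)) => // p.
exact: step_down_err.
Qed.

(** The function [s E] of the overview; the argument of [ev] runs over [[-1, 1]] because [s] runs
    over [[3/2, 5/2]]. *)
Definition odd_fun g x : R := (5 / 2 - x) * ev g (((5 / 2 - x) ^+ 2 - 17 / 4) / 2).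

Lemma transfer_odd_fun g y : I01 y -> transfer (odd_fun g) y = ev g (1 - y) + ev g (- y).
Proof.
move=> Iy; have h i : (i <= 1)%N -> odd_fun g (br i y) / root_br i y = ev g (1 - y - i%:R).
  move=> i1; have r0 := root_br_gt0 i1 Iy; have r2 := sqr_root_br i1 Iy.
  rewrite /odd_fun /br; have -> : 5 / 2 - (5 / 2 - root_br i y) = root_br i y :> R by ring.
  rewrite r2 mulrC mulKf ?gt_eqF//; congr (ev g _); lra.
rewrite /transfer !h// subr0; congr (_ + ev g _); lra.
Qed.

Lemma abs_1B2x x : I01 x -> `|1 - 2 * x| <= 1 :> R.
Proof. by move=> /I01E/andP[? ?]; rewrite ler_norml; apply/andP; split; lra. Qed.

Lemma odd_ext_err g x : I01 x ->
  `|ev (odd_ext g) (1 - 2 * x) - 4 * odd_fun g x| <= 10 * comp_err (size g).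
Proof.
move=> Ix; have z1 := abs_1B2x Ix; have := comp_quad g z1.
rewrite /odd_ext /odd_fun evD evZ ev_pdbl.
have -> : ((5 / 2 - x) ^+ 2 - 17 / 4) / 2 = (1 - 2 * x) ^+ 2 / 8 + (1 - 2 * x) - 8^-1 by field.
have -> : zr 8 = 8 :> R by [].
set a := ev _ _; set b := ev g _ => h.
rewrite (_ : _ - _ = (10 - 4 * x) * (a - b)); last by field.
rewrite normrM ler_pM//; move/I01E : Ix => /andP[? ?].
by rewrite ger0_norm; lra.
Qed.

Lemma transfer_poly_err g y : I01 y ->
  `|ev (transfer_poly g) (1 - 2 * y) - transfer (odd_fun g) y| <= 2 * comp_err (size g).
Proof.
move=> Iy; have z1 := abs_1B2x Iy; rewrite transfer_odd_fun// /transfer_poly evD.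
have := comp_up g z1; have := comp_down g z1.
have -> : (1 - 2 * y - 1) / 2 = - y by field.
have -> : (1 + (1 - 2 * y)) / 2 = 1 - y by field.
by norm_lra.
Qed.

Lemma ev_pphi p x : ev (pphi p) (1 - 2 * x) = 16 * x ^+ 2 * ev p (1 - 2 * x).
Proof.
rewrite /pphi evD evZ [ev (padd (pscale _ _) _) _]evD evZ !ev_pdbl.
have -> : zr (-4) = - 4 :> R by [].
have -> : zr 4 = 4 :> R by [].
by ring.
Qed.

End CompositionErrors.

(** * Derivatives and crude Lipschitz bounds *)

Section Calculus.
Context {R : realType}.
Implicit Types (z x y X e d c : R) (p q h b : seq Z) (g : seq Z).

(** The derivative of [chW n], from the recurrence for [chW] and [T_n' = n U_(n-1)]. *)
Fixpoint chV (n : nat) z : R :=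
  if n is n'.+1 then n'.+1%:R * chW n' z + z * chV n' z else 0.

(** Needed to recognise [(n + 1) U_n] in the derivative of the recurrence for [T_(n+1)]. *)
Lemma chV_eq n z : (1 - z ^+ 2) * chV n z = z * chW n z - n%:R * chT n z.
Proof.
elim: n => [|n IH] /=; first by rewrite /chW/=; ring.
have -> : (1 - z ^+ 2) * (n.+1%:R * chW n z + z * chV n z) =
    n.+1%:R * (1 - z ^+ 2) * chW n z + z * ((1 - z ^+ 2) * chV n z) by ring.
by rewrite IH chTS chWS -natr1; ring.
Qed.

Lemma chTW_derive n z :
  is_derive z 1 (chT n) (n%:R * chW n z) /\ is_derive z 1 (chW n) (chV n z).
Proof.
elim: n => [|n [IHT IHW]].
  by split; [rewrite mul0r; exact: is_derive_cst|exact: is_derive_cst].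
split.
  rewrite (_ : chT n.+1 = (fun y => y * chT n y - (1 - y ^+ 2) * chW n y)); last first.
    by apply/funext => y; rewrite chTS.
  apply: is_derive_eq; rewrite /GRing.scale/=.
  have := chV_eq n z; rewrite -natr1 chWS => e; lra.
rewrite (_ : chW n.+1 = (fun y => y * chW n y + chT n y)); last first.
  by apply/funext => y; rewrite chWS.
apply: is_derive_eq; rewrite /GRing.scale/= -natr1; lra.
Qed.

Lemma chV_le n z : `|z| <= 1 -> `|chV n z| <= n%:R ^+ 3.
Proof.
move=> z1; elim: n => [|n IH] /=; first by rewrite normr0 expr0n.
apply: le_trans (ler_normD _ _) _.
have h1 : `|n.+1%:R * chW n z| <= n.+1%:R * n%:R.
  by rewrite normrM ger0_norm// ler_wpM2l// chW_le.
have h2 : `|z * chV n z| <= n%:R ^+ 3.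
  by rewrite normrM -[leRHS]mul1r ler_pM.
apply: le_trans (lerD h1 h2) _; rewrite -natr1.
have : 0 <= n%:R :> R by []; nra.
Qed.

Lemma chW_lip n x y : `|x| <= 1 -> `|y| <= 1 ->
  `|chW n x - chW n y| <= n%:R ^+ 3 * `|x - y|.
Proof.
wlog xy : x y / x <= y => [hw|].
  have [xy|/ltW yx] := leP x y; first exact: hw.
  by move=> x1 y1; rewrite distrC [`|x - y|]distrC; exact: hw.
move=> x1 y1; have dW z : is_derive z 1 (chW n) (chV n z) by exact: (chTW_derive n z).2.
have cW : {within `[x, y], continuous (chW n)}.
  apply: continuous_subspaceT => z; apply/differentiable_continuous/derivable1_diffP.
  by have := dW z => ?; exact: ex_derive.
have [c /[!in_itv]/= /andP[xc cy] e] := MVT_segment xy (fun z _ => dW z) cW.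
rewrite distrC e normrM [`|x - y|]distrC ler_wpM2r//; apply: chV_le.
by move: x1 y1; norm_lra.
Qed.

Lemma lin_le_size (u : nat -> R) (l : seq R) e d : (forall n, (n < size l)%N -> `|u n| <= d) ->
  (forall a, a \in l -> `|a| <= e) -> 0 <= e ->
  `|lin u l| <= (size l)%:R * (e * d).
Proof.
elim: l u => [|a l IH] u ud le e0 /=; first by rewrite normr0 mul0r.
apply: le_trans (ler_normD _ _) _; rewrite -natr1 mulrDl mul1r addrC lerD//.
  by apply: IH => // [n nl|b bl]; [exact: ud|apply: le; rewrite inE bl orbT].
by rewrite normrM ler_pM ?ud// le ?mem_head.
Qed.

Lemma ev_lip g e x y : (forall a, a \in g -> `|zr a| <= e) -> 0 <= e -> `|x| <= 1 -> `|y| <= 1 ->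
  `|ev g x - ev g y| <= (size g)%:R ^+ 4 * e * `|x - y|.
Proof.
move=> ge e0 x1 y1.
have -> : ev g x - ev g y = lin (fun n => chebU x n - chebU y n) (map zr g).
  by rewrite /ev; elim: g (chebU x) (chebU y) {ge} => [|a g IH] u v /=; [rewrite subrr|rewrite -IH; ring].
apply: le_trans (lin_le_size (d := (size g)%:R ^+ 3 * `|x - y|) _ _ e0) _.
- move=> n; rewrite size_map => ng; apply: le_trans (chW_lip _ x1 y1) _.
  by rewrite ler_wpM2r// ler_pXn2r ?nnegrE// ler_nat.
- by move=> _ /mapP[a ag ->]; exact: ge.
- by rewrite size_map le_eqVlt; apply/orP; left; apply/eqP; ring.
Qed.

Lemma ev_sup g e x : (forall a, a \in g -> `|zr a| <= e) -> 0 <= e -> `|x| <= 1 ->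
  `|ev g x| <= (size g)%:R ^+ 4 * e.
Proof.
move=> ge e0 x1; apply: le_trans (lin_le_size (d := (size g)%:R) _ _ e0) _.
- move=> n; rewrite size_map => ng; apply: le_trans (chW_le _ x1) _.
  by rewrite ler_nat.
- by move=> _ /mapP[a ag ->]; exact: ge.
rewrite size_map mulrCA mulrC ler_wpM2r// -expr2.
have : (size g)%:R ^+ 2 <= (size g)%:R ^+ 4 :> R.
  by rewrite -!natrX ler_nat; case: (size g) => // n; exact: leq_pexp2l.
by [].
Qed.

Lemma odd_fun_lip g e : (forall a, a \in g -> `|zr a| <= e) -> 0 <= e ->
  lip (odd_fun g : R -> R) (8 * ((size g)%:R ^+ 4 * e)) /\
  forall x : R, I01 x -> `|odd_fun g x| <= 3 * ((size g)%:R ^+ 4 * e).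
Proof.
move=> ge e0; set B := (size g)%:R ^+ 4 * e.
have B0 : 0 <= B by rewrite mulr_ge0// exprn_ge0.
pose w x : R := ((5 / 2 - x) ^+ 2 - 17 / 4) / 2.
have w1 x : I01 x -> `|w x| <= 1.
  by move=> /I01E/andP[? ?]; rewrite ler_norml /w; apply/andP; split; nra.
have wl x y : I01 x -> I01 y -> `|w x - w y| <= 5 / 2 * `|x - y|.
  move=> /I01E/andP[? ?] /I01E/andP[? ?].
  rewrite (_ : w x - w y = (x - y) * ((x + y) / 2 - 5 / 2)); last by rewrite /w; field.
  by rewrite normrM mulrC ler_wpM2r// ler_norml; apply/andP; split; lra.
have sup x : I01 x -> `|ev g (w x)| <= B by move=> Ix; apply: ev_sup => //; exact: w1.
have s1 x : I01 x -> `|5 / 2 - x| <= 5 / 2.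
  by move=> /I01E/andP[? ?]; rewrite ger0_norm; lra.
split; last first.
  move=> x Ix; rewrite /odd_fun normrM; apply: le_trans (ler_pM _ _ (s1 _ Ix) (sup _ Ix)) _ => //.
  by lra.
have l1 : lip (fun x : R => 5 / 2 - x) (0 + 1) by exact: lipB (lip_cst _) lip_id.
have l2 : lip (fun x => ev g (w x)) (B * (5 / 2)).
  move=> x y Ix Iy; apply: le_trans (ev_lip ge e0 (w1 _ Ix) (w1 _ Iy)) _.
  by rewrite -/B -mulrA ler_wpM2l// wl.
(* The product rule gives [1 * B + 5/2 * (5/2 * B) = 7.25 B]. *)
by apply: lip_le (lipM l1 l2 s1 sup); lra.
Qed.

End Calculus.

(** * Integrals of Chebyshev sums, alone and against the logarithm *)

Section Integration.
Context {R : realType}.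
Implicit Types (z x y X e d c : R) (p q h b : seq Z) (g : seq Z) (l : seq R).

Lemma eq_lin (u v : nat -> R) l : u =1 v -> lin u l = lin v l.
Proof. by elim: l u v => [//|a l IH] u v uv /=; rewrite uv (IH _ (fun n => v n.+1)). Qed.

(** The antiderivative of [U_k] that vanishes at [z = -1], that is at [x = 1]. *)
Definition prim_term k z : R := (chT k.+1 z - (-1) ^+ k.+1) / k.+1%:R.

Definition prim p z : R := lin (fun k => prim_term k z) (map zr p).

Lemma prim_term_derive k z : is_derive z 1 (prim_term k) (chW k.+1 z).
Proof.
have dT := (chTW_derive k.+1 z).1.
rewrite (_ : chW k.+1 z = k.+1%:R^-1 * (k.+1%:R * chW k.+1 z - 0)); last first.
  by rewrite subr0 mulKf// pnatr_eq0.
rewrite (_ : prim_term k = fun y => k.+1%:R^-1 * (chT k.+1 y - (-1) ^+ k.+1)); last first.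
  by apply/funext => y; rewrite /prim_term mulrC.
by apply: is_derive_eq; rewrite /GRing.scale/=; ring.
Qed.

Lemma prim_derive p z : is_derive z 1 (prim p) (ev p z).
Proof.
rewrite /prim /ev.
suff h m l : is_derive z 1 (fun y => lin (fun k => prim_term (k + m) y) l)
    (lin (fun k => chW (k + m).+1 z) l).
  have := h 0%N (map zr p); rewrite (@eq_lin _ (chebU z)) => [|k]; last by rewrite addn0.
  congr (is_derive _ _ _ _); apply/funext => y; apply: eq_lin => k.
  by rewrite addn0.
elim: l m => [|a l IH] m /=; first exact: is_derive_cst.
have d1 := prim_term_derive m z; have d2 := IH m.+1.
have -> : lin (fun k => chW (k.+1 + m).+1 z) l = lin (fun k => chW (k + m.+1).+1 z) l.
  by apply: eq_lin => k; rewrite addSnnS.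
rewrite (_ : (fun y => _) = (fun y => a * prim_term m y + lin (fun k => prim_term (k + m.+1) y) l)).
  by apply: is_derive_eq; rewrite /GRing.scale/=; ring.
by apply/funext => y; congr (_ + _); apply: eq_lin => k; rewrite addSnnS.
Qed.

Lemma ev_continuous p : continuous (ev p : R -> R).
Proof.
move=> z; rewrite /ev /chebU.
suff h m l : {for z, continuous (fun y => lin (fun k => chW (k + m).+1 y) l)}.
  rewrite (_ : (fun y => _) = (fun y => lin (fun k => chW (k + 0).+1 y) (map zr p))).
    exact: h.
  by apply/funext => y; apply: eq_lin => k; rewrite addn0.
elim: l m => [|a l IH] m /=; first exact: cst_continuous.
apply: continuousD.
  apply: continuousM; first exact: cst_continuous.
  apply/differentiable_continuous/derivable1_diffP.
  by have := (chTW_derive m.+1 z).2 => ?; exact: ex_derive.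
rewrite (_ : (fun y => _) = (fun y => lin (fun k => chW (k + m.+1).+1 y) l)).
  exact: IH.
by apply/funext => y; apply: eq_lin => k; rewrite addSnnS.
Qed.

Lemma contM (f1 f2 : R -> R) x : {for x, continuous f1} -> {for x, continuous f2} ->
  {for x, continuous (fun y => f1 y * f2 y)}.
Proof. by move=> c1 c2; exact: continuousM. Qed.

Lemma cont_aff x : {for x, continuous (fun y : R => 1 - 2 * y)}.
Proof.
apply: continuousB; first exact: cst_continuous.
by apply: continuousM; [exact: cst_continuous|exact: cvg_id].
Qed.

Lemma continuous_ev_aff p : continuous (fun x : R => ev p (1 - 2 * x)).
Proof.
move=> x; apply: (@continuous_comp _ _ _ (fun y : R => 1 - 2 * y) (ev p)).
  exact: cont_aff.
exact: ev_continuous.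
Qed.

Lemma continuous_bmeas (u : R -> R) : {within I01, continuous u} -> bmeas u.
Proof.
move=> cu; split.
  by apply: subspace_continuous_measurable_fun => //; exact: measurable_I01.
have cI : compact (@I01 R) by exact: segment_compact.
have /compact_bounded[M [_ hM]] := continuous_compact cu cI.
by exists (M + 1) => y Iy; apply: (hM (M + 1)); [lra|exists y].
Qed.

Lemma bmeas_ev p : bmeas (fun x : R => ev p (1 - 2 * x)).
Proof. by apply: continuous_bmeas; apply: continuous_subspaceT; exact: continuous_ev_aff. Qed.

Lemma prim_aff_derive p x : is_derive x 1 (fun y => prim p (1 - 2 * y)) (- 2 * ev p (1 - 2 * x)).
Proof.
have da : is_derive x 1 (fun y : R => 1 - 2 * y) (- 2).
  by apply: is_derive_eq; rewrite /GRing.scale/=; ring.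
have dc := @is_derive1_comp _ (prim p) (fun y : R => 1 - 2 * y) x _ _ (prim_derive p _) da.
by rewrite mulrC; exact: dc.
Qed.

Lemma prim_aff1 p : prim p (1 - 2 * 1) = 0 :> R.
Proof.
rewrite /prim (_ : 1 - 2 * 1 = -1 :> R); last by ring.
rewrite (@eq_lin _ (fun=> 0)) => [|k]; last by rewrite /prim_term chTN1 subrr mul0r.
by elim: (map zr p) => [//|a l IH] /=; rewrite mulr0 add0r.
Qed.

Lemma mean_ev_prim p : prim p 1 = 2 * mean (fun x => ev p (1 - 2 * x)) :> R.
Proof.
have dP x : I01 x -> is_derive x 1 (fun y => prim p (1 - 2 * y)) (- 2 * ev p (1 - 2 * x)).
  by move=> _; exact: prim_aff_derive.
have ce : {within I01, continuous (fun x : R => - 2 * ev p (1 - 2 * x))}.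
  apply: continuous_subspaceT.
  have h x : {for x, continuous (fun x : R => - 2 * ev p (1 - 2 * x))}.
    by apply: (contM (f1 := fun=> - 2)); [exact: cst_continuous|exact: continuous_ev_aff].
  by move=> x; exact: h.
have := mean_FTC dP ce; rewrite prim_aff1 mulr0 subr0 sub0r meanZ; last exact: bmeas_ev.
by lra.
Qed.

Lemma zr_quot a (k : nat) : `|zr (Z.quot a (Z.of_nat k.+1)) - zr a / k.+1%:R| <= 1 :> R.
Proof.
have k0 : 0 < k.+1%:R :> R by rewrite ltr0n.
have e := Z.quot_rem' a (Z.of_nat k.+1).
have [r1 r2] : Z.leb (Z.abs (Z.rem a (Z.of_nat k.+1))) (Z.of_nat k.+1) /\ True.
  split => //; have := Z.rem_bound_abs a (Z.of_nat k.+1); lia.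
have := zr_le (R := R) r1; rewrite zr_norm zr_nat => h.
rewrite [X in _ - zr X / _]e zrD zrM zr_nat.
rewrite (_ : _ - _ = - (zr (Z.rem a (Z.of_nat k.+1)) / k.+1%:R)); last by field; rewrite gt_eqF.
by rewrite normrN normrM normfV (ger0_norm (ltW k0)) ler_pdivrMr// mul1r.
Qed.

Lemma mean_ev p : `|mean (fun x => ev p (1 - 2 * x)) - zr (pmean p)| <= (size p)%:R :> R.
Proof.
have -> : mean (fun x => ev p (1 - 2 * x)) = lin (fun k => prim_term k 1 / 2) (map zr p) :> R.
  have hh u l : lin (fun k => u k / 2) l = lin u l / 2 :> R.
    by elim: l u => [|a l IH] u /=; [rewrite mul0r|rewrite IH; field].
  have := mean_ev_prim p; rewrite /prim hh => ->; by field.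
suff h m k : k = Z.of_nat m.+1 -> `|lin (fun k => prim_term (k + m) 1 / 2) (map zr p) -
    zr (pmean_from (~~ odd m) k p)| <= (size p)%:R :> R.
  have := h 0%N (Zpos xH) erefl; rewrite (@eq_lin _ (fun k => prim_term k 1 / 2)) => [|j]; last by rewrite addn0.
  exact.
elim: p m k => [|a p IH] m k hk; first by rewrite subrr normr0.
have := IH m.+1 (Z.succ k) ltac:(lia).
rewrite (@eq_lin _ (fun k => prim_term (k.+1 + m) 1 / 2)) => [|n]; last by rewrite addSnnS.
rewrite /= negbK; set r := pmean_from _ _ p; set l := lin _ _ => hr.
rewrite add0n -[(size p).+1%:R]natr1; case: ifPn => om.
  have -> : prim_term m 1 / 2 = m.+1%:R^-1 :> R.
    rewrite /prim_term chT1 exprS -signr_odd (negbTE om) expr0.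
    by field; rewrite nat1r pnatr_eq0.
  rewrite zrD; have := zr_quot a m; rewrite -hk; set q := zr (Z.quot _ _); set b := zr a / _.
  by move: hr; norm_lra.
have -> : prim_term m 1 = 0 :> R.
  rewrite /prim_term chT1 exprS -signr_odd; move: om; rewrite negbK => ->.
  by rewrite expr1 mulrN1 opprK subrr mul0r.
rewrite mul0r mulr0 add0r; apply: le_trans hr _; lra.
Qed.

Lemma pint_err p z : `|z| <= 1 ->
  `|ev (pint p) z - 4 * prim p z| <= 4 * (size p)%:R :> R.
Proof.
move=> z1; pose t k : R := 2 * (chT k.+1 z - (-1) ^+ k.+1).
have lin_sub u v l : lin (fun k => u k - v k) l = lin u l - lin v l :> R.
  by elim: l u v => [|a l IH] u v /=; [rewrite subr0|rewrite IH; ring].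
have linZ c u l : lin (fun k => c * u k) l = c * lin u l :> R.
  by elim: l u => [|a l IH] u /=; [rewrite mulr0|rewrite IH; ring].
set q := pquot_from 1 p.
have e0 (c : Z) : ev [:: Z.mul 2 c] z = 2 * zr c :> R.
  by rewrite ev_cons zrM [ev _ _]/ev/= mulr0 !subr0 addr0.
have e1 : ev (Z0 :: q) z = lin (fun k => chW k.+2 z) (map zr q) :> R.
  by rewrite /ev/= zr0 mul0r add0r.
have e2 : ev (behead q) z = lin (fun k => chW k z) (map zr q) :> R.
  by rewrite /ev; case: q {e1} => [//|a q] /=; rewrite mulr0 add0r.
have e3 : 2 * zr (alt_sum q) = - lin (fun k => 2 * (-1) ^+ k.+1) (map zr q) :> R.
  rewrite linZ -mulrN; congr (_ * _).
  elim: q {e1 e2} => [|a q IH] /=; first by rewrite zr0 oppr0.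
  rewrite zrB IH (@eq_lin (fun k => (-1) ^+ k.+2) (fun k => - 1 * (-1) ^+ k.+1)).
    by rewrite linZ; ring.
  by move=> k; rewrite [LHS]exprS.
have -> : ev (pint p) z = lin t (map zr q).
  rewrite /pint -/q evD e0 e3 evD evN e1 e2 addrC -!lin_sub; apply: eq_lin => k.
  by rewrite /t !chWS !chTS; ring.
rewrite /q /prim.
suff h m k : k = Z.of_nat m.+1 -> `|lin (fun k => t (k + m)%N) (map zr (pquot_from k p)) -
    4 * lin (fun k => prim_term (k + m) z) (map zr p)| <= 4 * (size p)%:R :> R.
  have := h 0%N (Zpos xH) erefl; rewrite (@eq_lin _ t) => [|k]; last by rewrite addn0.
  rewrite (@eq_lin (fun k => prim_term (k + 0) z) (fun k => prim_term k z))// => k.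
  by rewrite addn0.
elim: p {q e1 e2 e3} m k => [|a p IH] m k hk; first by rewrite /= mulr0 subrr normr0.
have := IH m.+1 (Z.succ k) ltac:(lia).
rewrite (@eq_lin _ (fun k => t (k.+1 + m)%N)) => [|n]; last by rewrite addSnnS.
rewrite (@eq_lin (fun k => prim_term (k + m.+1) z) (fun k => prim_term (k.+1 + m) z)) => [|n]; last by rewrite addSnnS.
cbn [pquot_from map lin size].
set A := lin _ _; set B := lin (fun k => prim_term _ _) _ => AB.
have t4 : `|t m| <= 4.
  have := chT_le1 m.+1 z1; rewrite /t normrM ger0_norm// => h.
  have := ler_normB (chT m.+1 z) ((-1) ^+ m.+1); rewrite normrX normrN1 expr1n; lra.
have hq := zr_quot (Z.mul 2 a) m; rewrite -hk in hq; have h1 := ler_pM (normr_ge0 _) (normr_ge0 _) hq t4.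
move: h1; rewrite -normrM zrM add0n -[(size p).+1%:R]natr1 (_ : zr 2 = 2)//.
set Q := zr (Z.quot _ _) => h1.
rewrite (_ : _ - _ = (Q - 2 * zr a / m.+1%:R) * t m + (A - 4 * B)); last first.
  by rewrite /prim_term /t; field; rewrite nat1r pnatr_eq0.
apply: le_trans (ler_normD _ _) _; lra.
Qed.

(** Integration by parts against [prim H (1 - 2 x)]. As it vanishes at [x = 1], the boundary term
    involves [ln (5/2)] but not [ln (3/2)]. What remains is the mean of [prim H / s], for which [D]
    is an approximate polynomial quotient: [8 + 2 z = 4 s], and [4 s >= 6] turns the residual [6 e]
    into an error [e]. *)
Lemma mean_ln_ev (H D : seq Z) e :
  (forall z, `|z| <= 1 -> `|(8 + 2 * z) * ev D z - 4 * prim H z| <= 6 * e) ->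
  `|2 * mean (fun x => ln (5 / 2 - x) * ev H (1 - 2 * x)) -
    (ln (5 / 2) * (2 * mean (fun x => ev H (1 - 2 * x))) - mean (fun x => ev D (1 - 2 * x)))| <= e :> R.
Proof.
move=> hD; pose A x : R := prim H (1 - 2 * x).
have sgt0 x : I01 x -> 0 < 5 / 2 - x by move=> /I01E/andP[? ?]; lra.
pose F x : R := ln (5 / 2 - x) * A x.
pose f1 x : R := ln (5 / 2 - x) * ev H (1 - 2 * x).
pose f2 x : R := A x / (5 / 2 - x).
have dl x : I01 x -> is_derive x 1 (fun y : R => ln (5 / 2 - y)) (- (5 / 2 - x)^-1).
  move=> Ix; have ds : is_derive x 1 (fun y : R => 5 / 2 - y) (- 1).
    by apply: is_derive_eq; rewrite /GRing.scale/=; ring.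
  have dc := @is_derive1_comp _ (@ln R) (fun y : R => 5 / 2 - y) x _ _ (is_derive1_ln (sgt0 _ Ix)) ds.
  by rewrite -[- _]mulrN1; exact: dc.
have cs x : {for x, continuous (fun y : R => 5 / 2 - y)}.
  by apply: continuousB; [exact: cst_continuous|exact: cvg_id].
have cA x : {for x, continuous A}.
  apply/differentiable_continuous/derivable1_diffP.
  by have := prim_aff_derive H x => ?; exact: ex_derive.
have cln x : I01 x -> {for x, continuous (fun y : R => ln (5 / 2 - y))}.
  move=> Ix; apply: (@continuous_comp _ _ _ (fun y : R => 5 / 2 - y) (@ln R)); first exact: cs.
  exact/continuous_ln/sgt0.
have h1 x : I01 x -> {for x, continuous f1}.
  by move=> Ix; apply: contM; [exact: cln|exact: continuous_ev_aff].
have h2 x : I01 x -> {for x, continuous f2}.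
  move=> Ix; apply: (contM (f1 := A)); first exact: cA.
  by apply: continuousV; [rewrite gt_eqF ?sgt0|exact: cs].
have c1 : {within I01, continuous f1}.
  by apply: continuous_in_subspaceT => x /[!inE]; exact: h1.
have c2 : {within I01, continuous f2}.
  by apply: continuous_in_subspaceT => x /[!inE]; exact: h2.
have b1 := continuous_bmeas c1; have b2 := continuous_bmeas c2.
have dF x : I01 x -> is_derive x 1 F (- 2 * f1 x - f2 x).
  move=> Ix; have d1 := dl _ Ix; have d2 := prim_aff_derive H x; rewrite -/A in d2.
  by apply: is_derive_eq; rewrite /f1 /f2 /GRing.scale/=; ring.
have cF : {within I01, continuous (fun x => - 2 * f1 x - f2 x)}.
  have h x : I01 x -> {for x, continuous (fun x => - 2 * f1 x - f2 x)}.
    move=> Ix; apply: (@continuousB _ _ _ (fun x => - 2 * f1 x) f2); last exact: h2.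
    by apply: (contM (f1 := fun=> - 2)); [exact: cst_continuous|exact: h1].
  by apply: continuous_in_subspaceT => x /[!inE]; exact: h.
have := mean_FTC dF cF.
rewrite meanB//; last by apply: bmeasM => //; exact: bmeas_cst.
rewrite meanZ// /F [A 1]/A prim_aff1 mulr0 sub0r subr0 /A mulr0 subr0 mean_ev_prim => e1.
have e2 : `|mean (fun x => ev D (1 - 2 * x)) - mean f2| <= e.
  rewrite -meanB//; last exact: bmeas_ev.
  apply: le_mean_norm => [|x Ix]; first by apply: bmeasB => //; exact: bmeas_ev.
  have := hD _ (abs_1B2x Ix); have s0 := sgt0 _ Ix.
  rewrite /f2 /A; set d := ev D _; set a := prim H _.
  have s6 : 6 <= 4 * (5 / 2 - x) by move/I01E : Ix => /andP[? ?]; lra.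
  rewrite (_ : 8 + 2 * (1 - 2 * x) = 4 * (5 / 2 - x)); last by field.
  move: s0 s6; set s := 5 / 2 - x => s0 s6.
  rewrite (_ : _ - _ = 4 * s * (d - a / s)); last by field; rewrite gt_eqF.
  rewrite normrM ger0_norm; last by lra.
  have := normr_ge0 (d - a / (5 / 2 - x)); nra.
rewrite (_ : _ - _ = mean (fun x => ev D (1 - 2 * x)) - mean f2)//.
rewrite -/f1; lra.
Qed.

End Integration.

(** * Certified approximations *)

Section Data.
Local Open Scope Z_scope.

(** Larger than [10^146]: the 130 decimals of [tol] and 16 guard digits. *)
Definition scale : Z := 2 ^ 486.

(* The coefficients of [E] and [F] in the basis [U_k ((s^2 - 17/4) / 2)],
   multiplied by [scale] and with their irrelevant low bits set to zero. *)
Definition E_coefs : seq Z := Eval vm_compute in map (Z.mul (2 ^ 26)) [::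
0x7ce02e597024ebacf523ec5fb0c57078a96aa8ad204f2b66b52ba24d427db582760a5956216d19d87d7fb87b4a15e3744e1670c31ebadbd87e5;
-0x2175d929f47e839ca78c6de9a3d90c7a4d9dfa080d729e061811adb11874edc6a282ab3e31dbed1a3eb52687e3173f22ea08429f67390ab19ee;
0x8f7364e61d522c5a90dcb46de9ec1708d0d3f73157b4cb1ab1b14771f560198140053a2a6029a907d54e1a4424719175a0a99ba7e294eedfd4;
-0x267000f92d60779fcaabf31d6a1f947e69703c4487a94c0945aa42b64e31899ad7ea34c662e7d27b69e60092605253a7e22244a916c3106563;
0xa4c9efe982fb22499d31807be923af0d4ecf9e0c6f0650a64f7c36743660cea1fa398ef2b75a0e5d249e8055cd7bd29e7df76fc787752b5b7;
-0x2c27b01335e50f29ca06d0190295744ea43ab3e941848204e34cae6bf66aa0da6a42ef64aeeb11bdf419f83130ca0ffbd5b9748cb1a3a717a;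
0xbd4d06354991a5d8ae9bfe82132222d421b3198970bb76d3db6833ba349b4c7aed22ea00452389aabc9606ef5ac6d50d8ee626b3f1971030;
-0x32b917a1c7f5a4c61a02f8782331466643212791aaa5bb0138d5e8296bc32445105cb1b625dd0acbb0b898aa5e7a5478e0015204ac21cf45;
0xd975851d644ed3fb96fe35e79a2f6c4ead184bd39db753107ef6ceb7a714499544fdcd85250a184064c5bba1f227cd5f11f215ebef02ce6;
-0x3a449a5911e1038cbbc9501c35a94ad6824eb633cc819c2e6e7cb847e01ee2040e2c1ab23657b446878d63e1e0f9edee47b33764f9ee452;
0xf9ce446e3353a3758270a893c75bf0b5c228cfb944f1da93afc1267d9673e7af3b29d43b454b8d9b96fd3e591bfea5a0cdac7a7f8b6462;
-0x42ef6c27af3e550a4d2da08bc2db156ee3b7dba84bada767d739157857e17e7c09e5a5c9afb2f205e31ebb46605bb79ebb7e73ae8ead37;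
0x11ef6c3089a5b0b3b245d99b44106505ccb69ee7e9c4c30bad232f63c9121240ec6cc2eb79803a7bf57daec0657038da204d543aaf507a;
-0x4ce449a77586dc47be9c5e14d667ea84f229ff75b6564c6dd53a816cc66ca87a7cd65e4364df7e9f2d7ffbb35652bc9c5b6dd3c2e94b0;
0x149a63953bc065e3d613de9f189959b6fd3e0f583d0d00fc82b70f7688917ddb2c8d4a55fb7a52bd5e2502c7024764cf68e20b60b0246;
-0x58544ad797abb4799b31c678bfd7c5702ce3deb3dddb78435a1bc6d5bd94ef2355ecb148909cc564b140f68b2cad6a1481a59bfd7469;
0x17aaf20aa2a873a90b892ff175c97a50dfae854ba69dd1453cfe23ee6d3bdeda8ede1fc28acde9bce2b3adbc8e3f5b5b7875b9eacf5d;
-0x6577d52f2f61a2a92f2f94d174e23d351d6367abc9bccd199dcc8e3f75a8c46e58bcdc19a9ae18ed98dc0670c50035960314badc90b;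
0x1b30341292ff5014042b542e76f14fc67aa549f4bd162012a74ffa1702e524107511743df9d9c7e838353dfa300b20a084f74cc54ce;
-0x748fb1b1c9b9da6e17dbbe866e301e4cd31c0272a9bb330ff735a1c95ebcbd37b88f4de3db906b347f8f177fb2c4cec10c87838a2e;
0x1f3b859df6f268781cb9b73249ab7ccba21b6a7ed58acb1567d6e5b54ca0b3d79125f3afd0a52e4e7ae87e5bca6130fbe2a941d3ea;
-0x85e64c6120fc7725b0b1e42b87dd4e1b551a788ac6ff945a825f50bd3c612268c0880db67044e056c12e1ef76bff52e7e1d83c579;
0x23e0d7a514cb5514f72c1d8984bd6bb332b33a3dc351a0138c0ee7a027794c29efc0fbdcb6c09c735630962109ea3be15cccd41fa;
-0x99d12333230dd2e2bfe91fa8b1860b175b2706c4646ebf3addc4dc361840e3efe7be1bc6abd91769794398cbba99c9d915b14271;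
0x2937127b3f81fa3b8ce2a60a7a41712a416877355ca0fbb2b624f6d5e96ecd20a2e8b14f435a96708205011e4bc3694e89f7c7c9;
-0xb0b26b9dafa160b73a17881377fb991aa7ad6110e152f8ffaceff218d7a5092a3e4a976619142588ed06bad7473db61122ddcb4;
0x2f5886c2c665df241a33bfa63bd751c6882e10edbb3c28d351705b04c7a7529eca9f48a42ea72f1b93cad97860c0435bebfab07;
-0xcafaf6d69f61bd92eb776857761adff790ae2a60b9daa4d98d179fa46f84150ec328b2aa18896e56224ab0a3bc3575e8d0cf66;
0x36636f2e1729040a0aa1a6fa1af66375bfd79aa733a806311d58ce45439b2a4e62ae406577b2c79f4c7d2b08e4d1a1e4839293;
-0xe92c5e1bd4252953f0f3390f5beaddf6eb0403c14c573eae84b99709ee8942ac7904eebc641b0270fa9fb7fd71111a93d7ae5;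
0x3e7a858dde0464af19b2749bc045407fae966491f6dc97a83d5977d3807265cbb92fb49a153f8fcf22ac2f67772a4c0725902;
-0x10bdb81ba3ec696875d6995fa52a2407cf558e868f1b1ff270ac4844134054826bb9e3abf0e33ccb901105a06b981588be923;
0x47c5ae0b1ad40f2bda7f0e2d4634f9f8ebfd588458fe8218557a93ccc8eec3df5b7da15ae4d635f1d97e71a37360a1bd4b8b;
-0x133b36722c89a6280c92a2bac631a766ba9c79a87248093a4b25caf1efb5c756b2584aac85250b0e64e96c8714012e694507;
0x5272bbd9752897457cb7cbdd291a3a1fe748e1d7021a2d0d71c97faf5e8597b6de389572fbdf647ba274078dca417e7c891;
-0x161788430c07fa9529b503c8414e7213f35becd4e3e8209114c94f9e7eb9e970535dab039d2ce1083b3955c5e8f3135dd3f;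
0x5eb6532baf7530f2a1c4343dc1f8e2fe626d17c8d865536e15bbeca9c620e0a6f3e169b78d41fa54a714f89d98acefac69;
-0x1960c87dfd551a77ebc09472f2fc6aba53f591d5231344a70a5ab8bf2ce4eb9699aaf6a46239d8cee8be8617d38288d467;
0x6cccecc45df38ed0d3e1d8e09f8c7eaed692f8bb3e7bf2e13aef652ed72cdb372ca70d9fba568e6fbe51fc1b55d33a532;
-0x1d272b31a27c93c4937e1c534e6b4f161af2c59ac8bb8114461208c88e64b37317eccc38c5bcacd06d5f8ef01f245c062;
0x7cfc0022bfec0417a16986c9a20bda995381dafe472116fdd58bdf36265f295330c23435c9c24d1f72c3fa526be35c55;
-0x217d4d70d7e6d4154dc455f1a17a79039edb124c90cc4ab2f50ef04fb3316e1b443c0d4acb3e6776f516fa47bd47b0f2;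
0x8f935a09faf4c3d95a7d0fce3de097527ea6e33fc1013cdfeafe208a6668f19e02e00f5633750bc6197eecc893b6772;
-0x2678911a6d65ce108daee01edfdacd100cea6835f74048505b097d2e668ce4c3c7bf68ac19edb7a9148c0ea67a5ecd8;
0xa4eea5fbaa27468dc3e70ad418a9cedb502bd981bffe4618127d42f33caa1711c1d935a3441d2de38b14dd155c4bec;
-0x2c318647d240392e34ae296264fa6a6c7208e2a78bf4935a995d38e689da100a8b6e4bcb71993cfce39289edcb42d9;
0xbd773239ed99e2b0ed19ab57b3fdad677f7b11c6fd4075252f7a0a6eabe29186bdff98a8247c61003354aa1d0bf78;
-0x32c4646a9263f7e06984173880500ed6dd5e1ca335b89eeb28149b5211e945724119a5e9785db432942a09977bb07;
0xd9a5f705bf5fcd0b8f6b18a4d428df3f5fd60c5d9a2068770d862d99bc284424666fefdbcfa6fca1d537c40e2ca3;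
-0x3a51956dd73fb627a56aef0b4ba28f8fa97667430cf7b329b4cf0145d20cb96d882560d7b8c0af5e123e76c0f786;
0xfa05eb19d9f0b930640a3885a615eff460390ae99be642fc5b5d77d8c0aa191ba259383135bc0d673c216f5b175;
-0x42fe5589f3c782473979f161de2ec6d6e97db775a01dd9562085cb05e1dccd96070ed3494ae53fbbcc9e515ce4d;
0x11f36b0df52d4fec81dd8d01d2a52b6745bdd2ece491225c26b9b43ec6c91d3c79e214f3f5d8f187f657d6187c0;
-0x4cf56ade0edbd6acdfc42a56c65e6c62d79943df226b01a7a6105f53947a75be07980868c7e86640cc107050b2;
0x149efa98e89a5beb6137d93def26fb170287e0ae4099e0dc2ca63961e5580330803ed263c2128083cac45fbb08;
-0x5867f85938d9900a51b3aa0f63d7ff932863ed9dffc81c90c88863400e59703f963412640619bce5f010e9b70;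
0x17b037d659c081733351145e9cf04cdc7911ab93f582648057bdf6e1e3e58df654e32353f73eeb5b13fdab2b6;
-0x658e7002e2875c27b90a76b0fe933debbe2c0b1d6417570966f7847813cc799bd587aebd6e1f0865fe5c2f68;
0x1b3642a5ee15596baf1894da2b4829e767957336383714201ffea3c210d9070a07ec85b6448d6be6b9960aec;
-0x74a9a94d5ce09870357dcb7ae8d69b1e029c1bb7cc4f97719030a902f97a28c4a2a681ba416a734e7fbfc47;
0x1f427ad6922ccb05e46de048eed7ce0191193b7badcd1bc440d867ead85832720bd1ab84bcd30ece659e631;
-0x860420cebd293a75c39b5a8d2889ce841c8d236eae4d79f7330f6a867e6a1038ca02c58b1e1c7eb16b9c7e;
0x23e8d5d1d1d83978c78f65a5b4aa59f760a0d5ffdc642b98beb72b6c742519c26af05de0ab410ddf548bc6;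
-0x99f36788a37ab6d5aa23c09aa1f995965f63490c343346bc7cd432b522a56d0e1beb1f78ee7b8cbe6929b;
0x29404105706743ca2f98a80f3d40b6e3737fc4330a8a616607de140d48441811c0a69fd905dd55045bea7;
-0xb0d9c8d1e225853143edfa2530945f76e9bc7bff5f63edba2a41d7ffe6af338e6af5feb28f9c75306801;
0x2f6312f08221d822162d67a0ee460fa46ef5acccd4e9a0882b261f2b167b4d1da16dfd39e09c847be15d;
-0xcb282f02661db5714c7a45e8883df1ad21a3733f44294668256a4ac733e00e81ac1f634f2d59cbf1d74;
0x366f8d01765953a3cf129d933c96cc6d9733002fc20b111de347386b67cb682c999db99eab9ee809474;
-0xe9605037347991defd030646a1d40093b288d7fc402fe0f67b296e66b4d9230ba57832b8121d43345b;
0x3e8870c56c510d3f02e23fe6bde33b7556f35cf4e00e71fbb83232e456ae0964fc0530f58e868c3cf7;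
-0x10c172de7ccaa31d0e85f95455b8ed41a9449bd74009e6f8659f5d2aa5df02884a9c911e27fcedbf81;
0x47d5ab486d97f353735a56a990079914e1f1268201929e5de4b41c640ce00bc2e6d1383116d2ac10c;
-0x133f7f39e9b59b7ce509c560e48f9038f37adc9405ac09f138da9ee5d5900686f17bcee1db7bd44ad;
0x528519f393e7aa020ccbeda0236a7ceebfa4bce151d8966feb65f3349600e58df1e0356571ca51aa;
-0x161c742fb444f039e293607244b0f02bc6e52a44eca1baac1fedde74ff032dc8afc3e7780f6c01fb;
0x5ecb6cb3d2c16e57d819428ef5943c05befec3260ae54409451869f660bd194cd2f687acbe5b644;
-0x19666fd406b6b5c1372f03178b41ed5a8da86849617965631583c08992c188a84f9ba73202ad713;
0x6ce529c481968ad04a2c9cf3773796477a2ddff7b00518310f6982fea4909546b78151b4c5a608;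
-0x1d2da9d19aeecf2db5c2425528bf83750e30fb48a87e0a92e56a03616629ca95e44ad3b2ebc10e;
0x7d17d81ea24b1e68cdc6c612bc6778cbe960d2af1f3121a863e8a86f4169510d9a9fd16e95e31;
-0x2184c360da3f86c7daf6f2f865a5abdec2739631f4e3dd7339026ba6a3089ad825d20a8b9b7b5;
0x8fb3564c6b2fcb69e1505ceda2f36af206d8618b45e54248021062b4ab91a52fca858bfd80a2; -0x2681232408c6c129d5d244303172eddbf428230dc95731ec781ad0687dbce73cccf5873c4ad3;
0xa513643b7eb393d75f8b3d322d84c7dc9c82aabdf778569de5adeed4b61f7c3695090f3aaac; -0x2c3b5ead6e623cc02108b1c59ee441b32f887a1b486e3bb0150ab4cafcaf7d0d84cbc925fdc;
0xbda167a3ad55f29249789e44e0c3ef0219f3daf2a4098226e7ce4573c9e77ff7e26155d4c3; -0x32cfb3b7cf33fe4715575cb994cba0d56f47ca1609424d9a4e8dc91f5ca62f073cc8c4f330;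
0xd9d673b8f7a068a0be4d4a1726a9453a32b4d6580ffb4425268df09a8b13c2510c1bdf7fb; -0x3a5e9366eb41be11a3bf5cc34deb0791d656b7ffabc836efb15b307461ec18d063e32ecbe;
0xfa3d9e2b5668fa5d0b028f61102d90d26a609a69f2597999eded136fc9ca0f08370dbafb; -0x430d423ea5880859f014714f6205ca2c4416e9ad0ce2776ca20146790866af1a9e03ff2e;
0x11f76acf3fb7270ab54f35dc77e997dea5fb0c4a413064189a18067457d0ad62410241be; -0x4d068fe595493d0e52866227da0954e53d5477bf7df18f5c65ed35856dc066e660507ca;
0x14a392a259b2838df5262ad7e98bd5aa95a11a59e4bffbe7f6346ed039f6c575711dd6b; -0x587baa3d180d12982124937cc2601c5192ff1a8150e604372e485bb7a1aaeef6426de2;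
0x17b57ecec50c1181322fa07470c3169cf1eac466f798525d55da81dae73f6481f7da1c; -0x65a50fdfc23336ca799ee5500ac3e2234abf71a8d7b453e2921abb3fb52a3119cfa8e;
0x1b3c5292b80bc316c3818df91ede1ebe0c518033e54c29b4eac2cf5060b27c47c101d; -0x74c3a6b1dfbd5909467529470b498d4e6868f26bd7c52f118f08201cd9fc005345e6;
0x1f49719bfe3932b8e1bbc58a3f444958dc8bc6710a5220f78ff38b6d5cc83cd1077d; -0x8621fbe192771da4079ece1f1c7981509c62758518354ccb0c60d989924f2f0d80c;
0x23f0d5c666494b0202bedfd87da16fb4a8cd6f03bbb323b3324aaf507cb8ef258b2; -0x9a15b3806ae0e64035cb142da0c3d8206d34689d6974201bcc9e3b860948d88abe;
0x2949719b46eee8e0ab3e532ea8f8653727fab239ea9e453c0dcdf91059946fd244; -0xb1012ecb0dabd42772e388d031dbcbc32b6604a4104f4d46a99a8bb5d08e6be54;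
0x2f6da177c7c0c29317a8f05637e8db9a2deceef19758e159c98a9dd1a8f2b270b; -0xcb5571411573624ebc03888adc7a2a58c4db7224d1438207c8feb90d33c5ddd7;
0x367bad87d9c16009757f1cc7f35aefc0349ed979cf7ff2828b51071a3fec5052; -0xe9944de51921dd719f8ea94f0f194a80d9ff3c26cbc48026445635bcbeb6372;
0x3e965f16c871752f2648d8bd06b62e001e0f58fe3712d8705c48654efc13d77; -0x10c52e7608a3f74af994b9a50bbf6d7f9e3e27d21086e19b2ccb5f7f319926b;
0x47e5ac15a1e67fcc00a0dd7284787fe5ae9464a0b08adfc56e518adca50c35; -0x1343c8f5fd5a8a806937db7955eb279cd66f1561b9bd6562ec90337f7a9e67;
0x52977c25383aa35a43e9072d3341e8dab27f0e6366ab5c643ef4321456d68; -0x162161350b41e5627c26651f6e55299d630ae371fed71b6232cd9059b1738;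
0x5ee08aef4ccf22facb08d508612bd9ad9ac7f6494b111248c420f526ef7a; -0x196c186c7f1e35c369bd022a9f5ccce03a71a2053ed292ffe3aacf00a6af;
0x6cfd6c2afa9b412dbeb33a21c4759d34efe91cbb03939b6ca8a46dbab41; -0x1d3429e3f889a8805efcc5dd1c09a6d0188a529821253db467e4c6e0654;
0x7d33b64e78b60d3bd3fdd52abb0fe0b72402da581015b64f6eeadc6e0e; -0x218c3afa5a3dace9602af6d92ba515db07663fde2e02fdf73d5f03b1e3;
0x8fd359af040a669acae0639f38476b4f9962520a7f6418d869132597d; -0x2689b7166c4ecbd528d220ea26cc4f8def254a471d6083edce5c5b411;
0xa5382aaad30c8b9d868200962e9d2e82332d711f61df6ded05e476c8; -0x2c453944874571238ce5f3b64dafc129da61200bb17578d731cc2710;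
0xbdcba674a0938f0ad15ce430821d62536570f0f63f6756fc14c2577; -0x32db058a0df729f27714555d2d7976afefb1c31de645ce7d3646ece;
0xda06fb3974918bf0af4714433c8786c59561b8159afe2f8c4595c1; -0x3a6b9444f2d3909b4bd6fb3a1a86b0175a6aae78079bd65db1e834;
0xfa755da56bcb67c8014d8a52d933997d44901ca837129ea820b11; -0x431c324681f4956b47c675a9bc63647f6b958b20628d14c56440f;
0x11fb6b749c06ede51dcc4c541859f88069c60fd95321b46d7052c; -0x4d17b8bee2722292f6abba6a5047d823b82b444e9f9bcf05d0a1;
0x14a82bb1c959abf9fdea2467bb7fd888444c13a54c53f5403d58; -0x588f60842f48d5500fcd7349db789fd59050a4691b405fb24c0;
0x17bac6f4278895a0609386abb5e4f6d1fc81574fa7c22ac55a9; -0x65bbb4c6ed981317280a764fc1b3b7261b4b8d583c84b631e5;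
0x1b4263d93dd6f25696f16e83a87f6f78a518c06675f02c71ea; -0x74dda9e09c3b64333bb43bee04a06bc791774419b3bfb95c2; 0x1f5069ee937e6b637fba077d8a8ab793f45109ff6ffc1e520;
-0x863fdd9b1be495ac333e208258a72883fcce3e40c30bfebd; 0x23f8d78337aba078d1580a30b9f128d0ae28590c0c6e15d4; -0x9a38071c2c9ec37122208408f1d7abebbd325ef6eac5894;
0x2952a43d37c1063773016d18284c22a41243eb1ae434c7b; -0xb1289d8b265556ca9e53057af58dea48bdd4d74a60d956; 0x2f7832591d44f7b34935446951757ee1d314ab7b4018df;
-0xcb82bd94ebe880286820c2a5048113e8e7dd6a29f8a26; 0x3687d0c1db52856d0d2ec3fefaac61866e2af0f3e0fb9; -0xe9c85728161958bcc9a4d56e6307230d0ce59a58b4be;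
0x3ea45082a33d0c2253a715c9e15673cd50e75a24c33e; -0x10c8eae276dad7cc84f781b92252ac2836b7ce3a5839; 0x47f5b07382e530fc036f11aa7f43cd389f7dec49da7;
-0x134813a69de74727be442b17d7e4725f127acd81e62; 0x52a9e26f4b7eba2f5a19ab4e04dfc43aa6d49bdbe0; -0x16264f534f8676418423fbba9537eaf973a597511e;
0x5ef5addf29b1ed6b676439c4fffe7ab27c1c16898; -0x1971c247ae6051955b512b6aac7b3b32b616e5142; 0x6d15b3f8fcf58ea05e073e5b1ee72185c3f7dc6f;
-0x1d3aab690dd1212bc30a42c1b3e8d2ebae712079; 0x7d4f9ab3a4ef60eae21ccabb0bc2a28f5cca574; -0x2193b43db6ab70ef57cefed0f07d5b828c17558;
0x8ff364335be62d27d1f3088b632cb7ad392fed; -0x26924cf204e1a5a9cadc351e84dd268c234a5c; 0xa55cf94b7a0697f597dcbeeb047e28353f985;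
-0x2c4f160d9a000539b1afa9c3c4263812c9bb6; 0xbdf5eeaedf97cf12ee1e8240c1ab815e7555; -0x32e659e1de5ee8b09d7f6cc6c44a844d399e;
0xda378d899e3d3af87df30da4f7e8fd67122; -0x3a789808930660d81fd56a279afbb0c8ae9; 0xfaad298addc486801629af97405c5bba82; -0x432b25a246ac0c7e5b501be351b6625f20;
0x11ff6cfe3cebab795716bff6067d2dc1fe; -0x4d28e56ad02a167010ae3f4c83e54a8d9; 0x14acc5c771eda22ad14cfdd1a7c24e165; -0x58a31b2f78c723b3485b7fa1b23edcbb;
0x17c01046c4426c200c9e216c4cd69188; -0x65d25eb98428cccea1d060f811b6965; 0x1b487679cc7c7139bd5f6d1b797140c; -0x74f7b2dadc8f81853ad5375d40e6cc;
0x1f5763ceaa76f279155e0bbd6c8722; -0x865dc5fcd4c485f1aa2f7987135bd; 0x2400db08aba2f03552dd2a4584fd3; -0x9a5a625d9c73ae3a1452f8f00990;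
0x295bd8ebb79fb59323793f67d66b; -0xb150151420b2812799204af501c; 0x2f82c59508ceab6c2ced3556a06; -0xcbb014002882c891a948a657fc; 0x3693f6b015206b83d64f43f5ea;
-0xe9fc6c02bfee57daff4697fac; 0x3eb24509adb2a72e9826208c6; -0x10cca823f6dc44df6151ea36b; 0x4805b862dbe6c4eed21884e7; -0x134c5f4c01d6c5c533437030;
0x52bc4cd2b745225faf53bd8; -0x162b3e8abfa82d2b8917f30; 0x5f0ad58475b924e750c0e8; -0x19776d65dc61c0e4b18470; 0x6d2e012fbcddeab7550d7; -0x1d412e612d5b9c923beed;
0x7d6b854f89087919aadb; -0x219b2f2b4e681b42ec80; 0x901375db097f3f20726; -0x269ae4b73f7b4853019; 0xa581d01f46de22b93f; -0x2c58f50923c405b4e3;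
0xbe204054831f41a4e; -0x32f1b0bfd03cab456; 0xda682aabdd36b709; -0x3a859eb2711027ce; 0xfae501de709e82f; -0x433a1c52b1778ed; 0x12036f6c553fb87; -0x4d3a15ea38752f;
0x14b160e38dd934; -0x58b6da3feefa0; 0x17c55ac6de54e; -0x65e90db8a598; 0x1b4e8a74b113; -0x7511c1a1eb4; 0x1f5e5f3c9bb; -0x867bb50839; 0x2408e05728; -0x9a7cc5467;
0x29650fa74; -0xb1779568; 0x2f8d5b2c; -0xcbdd748; 0x36a01f5; -0xea308c; 0x3ec03d; -0x10d066; 0x4815c; -0x1350b; 0x52cf; -0x1630; 0x5f2; -0x198; 0x6d; -0x1d].

Definition F_coefs : seq Z := Eval vm_compute in map (Z.mul (2 ^ 40)) [::
-0x3707db5be922aa76c270511e8352d2da66f64e5a0f2a5c80826708daff5e0d7a62cb611dc7d49ffbed8b9c8db38ba7d4471bba33f4dcc3b;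
-0x12357bd8be4df1f97af0d4ff7273563dbf7918710b4d61f98b3aa14483063bd91492653ff59b6c37093fa8eb78171ea47e234111ce0c800a;
0x9a56bd24af9e4e2302af3c1091a6b83e4133ffb728d7493b1d09c5160629b1802b6f3ed7f01887bdaf4a9682b926c418fc6a1ddf4c1cb8d;
-0x35c0ccc3fac6a0b4639a0624c6c19a64ca456dde605f5388137551db497dd06607b1c2f504da2bf0a8b3cb8ef71864dadfc057642ff481b;
0x10cf77feb5d25221bc1348aff15e24b629e0a0306db5c871e4565ade75ab91da61e8f1b6fa091f3f64666246b4e2a2cf21b052aa7b492ea;
-0x503ec0f14f79d241b6ddfd2b654fde9ff020bef88ea2379c61a0eb57a815b5ee0ea5cff8a86f1e2d5e0374a1d4df854227bbf3c56e5182;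
0x1754bec97e7edb6d770cb942cf9a93a2bec05968cf957e241f1315f2c2e773e75059ff6ed2a075c1280a37c7577fd4807c2130233fb646;
-0x6acda23f48f75bda64d3daedb7e4960ec13741e93c46e940c78c9c15f66d6cc630ad7c112703c523bb86a00a2955a7541516a9d1349f2;
0x1e39c2071cacc8d831ca364c9d3a65a0dc2ec0dd9a3e9f6155578b16de7b17137b176bdf4bb3233536735294cdbe158ebe363b34bc2a9;
-0x87ca715e9c30ecfa8279ac0a4fb3b3359374bd245625b3a0021fd5e675184d0eba26e7780488e87093db407de3214154d295dbfd3723;
0x25e72016b19a00795217f9349a2b1177e7dffbe44f0f12bfe48c466884ccf22d65f9691bf7e850187eab939506d1cda1d43c73d33b75;
-0xa87e8dbb98f29d921ed3f2373bc1465c5ca1a758ceb93de494f5109a80a2063fedfb19afb5f41f76b8a718c8686e2d23d29e9458c7f;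
0x2ea4242ff3e0e3ed5628cc3a81322a51e1603f3dd4f5bcab51f94a1af363e8bff75d0195e6690fe99cb8069e1375244a299455ebfff;
-0xcdf24c9dbe2cca1a0028d3410993a86c0f14dd5c2b3f0a3bac563768a0d2768b038d7d1e83d2ffdf71e6cf73aac87a8da253aa5d2b;
0x38b106504c54f1b073236f0e154e063b7e12b5f271662ee8b46f27cd904af36016fdce9e3456220b2ba1e7894217f1de342d166742;
-0xf9277361bcb6dfd67f469b3902f1e93adda90506a8d2aaa2d8f1f859931fe01a3156b2dbda7bdc0c15cd9c49d0525dc7790eea00c;
0x444fdaf1fe34a0c8cf5c96b5f133d26f4f8468f0fb8d137384ffcdcf54d910bd615d3aa58bb971ba05b6fef259f1658b5704c0735;
-0x12b31035c42480e7c20d8ff8f0e5bdeb609025cd30e6069844dbf072a96ae3e62f9c68f25b06e43cd3eb6fe1744d5a91e48296c0c;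
0x51c8df084694b65ef24711f7a06e7bd844c6c0a9c1395d6898f4559733a3e62a1d07db4751c4ebd7c517f0388b89b5367b0311da;
-0x16540a42da8765607298b097fa81baaf0b1984c7d31ca512dadd395d1e71995aa87c4fda713784dfa6ec9073abbbf9a72b316dc2;
0x616d477e213d0534ca05fc731fc2da14696d19f023eeeb9d8f405d776fc1c533c70cfd7da605898794e04daac00cb3f42fefb37;
-0x1a8b0a8352ea19dac69649ad3e78b7dfe3a1ea64ffefcc04f06c2747738ef00f7b058fc97f6a74b13d73681a8257e6f78155ff0;
0x739999b871c8a48b2a4643a351c91fc84ffbaf9075cd8b2d9d1417e6ea28a675fb459162999ec7eed864e02e9d75ecaee19d0e;
-0x1f70d2ebc4a8b77c5b5cea8f2e27636655d57d5e3c6c8f103620e1e6028a245cabcd5658c8dda98dbe50c7fc47e38ea118d1a9;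
0x88b7f50590b2251d09310a7c4645d4ac75dfd374815ce365071e6eb8d84461a7390cf6a2037941ec4900fb2ababe696536e71;
-0x2521d7dd5cfe0880a77c0d22cd3d707588a6dba1967468d5ca60591d52a76ad53a8fd381db311d2990b8d666dbc765e663c6e;
0xa1427f56921736ca3126ebd937c135c9762b4cb3a7490301ceba22651af28ad8bdc85d3066690099daec2afa2b9d3000f462;
-0x2bbee2bec7b6db9203f487eb455500dc50291bdda8df995e378872513e839e1c9d97f2ec748be79e4070159899f88d57210c;
0xbdc61396df6b8fc5aa4cfa86169b6d04c4f77227f586a4657aec95a611267ae38212fb94a362f377acd29752ccaafa87031;
-0x336dc7f64cdda0066e8c5bec729dde5166aa0eb0e02a9230c718bed0394b22a867f79d0e82cffc72bf5a69960dabae9f446;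
0xdee548620c38ec0d2c8a842bfbffd55577dc85900dda06b84f7d878565ac92f6d7f8079eba876dca8054cace0a9631bd87;
-0x3c5a358ec04ef4b1bf1c47c556b65c440d0110c712ca917ab1fabbea1bec667988f8dfedc07087a1d9e3adff8474871f48;
0x1055be37f5999d53857b56c3a6463ad04f59634c0f29755e1f587a4015011c4288f57be065455af61656156cbcb4c36197;
-0x46b69f97ffa83950f15394c6076052e0b0108bc1757b710dc5a6df51771ba8b1785418855c65464c279271e964cbf47b2;
0x13202ceb2d290f8be11bbd27ad04b39e5a5f826af91a75bbbb4af8c57ecb939178068fca56fec16378ea001bb3fda28f9;
-0x52bd4f8ff2ad3d95e18f775e5765727f93d43661a6d559805a190709c92ce4b820184df9bf8732abc8b32eaf9ab2265c;
0x165d4a40169f20e2cd48d9e979d7d33a5a2dccf011585a74ece263f145a6a403f7bfb328879683ba99fc6cc590555ffc;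
-0x60b19ca4737d3ceaf75d1994a7337ba09626c1b8bc0f9ccc02f39bd6cc3bd4fdf66f4d3cd3a9b17d7fc093bc142ce32;
0x1a1f2ea016d5861bd1696bdee683da3f35bbb57207c84351f14cc54d3b09da61697f64453ebcdb762c5e80d82f6433a;
-0x70e153563a89b1975fe64171408c61efc3d5a45279df295811fc8cfb1c4b032125b3b6c25a113c7a7248826ca5f8fd;
0x1e7ac1c0bfcefaaecdc4f3b13e071c4de50aed7c276f882dcfd3fa60c5cea4eb2154c585d63277ecaa703a69460101;
-0x83a653ea1f598e082a692e27e40a13f1e75ea8a5f220e5a81f182b35b01a27407c59f751efdf11468fb8b226ef410;
0x238829e11f32757c2f20ee0364be8ecb6422b79397a89f77167cabe4f2958006f2c023f506274dc0225a01852d02d;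
-0x99687027fa6e362aafb149b12d5694a06771ec8ecf5c7cfc55eefd3a8cc3bff872e6342bb137e88a5af101422338;
0x29634c07b84b4d8627546b6e021b763bf92d7289feee4041d0dbc7c8362babe88f0c03e05bd329cc5ecb85d3b08c;
-0xb29f9227e2f2ac623d0adaba9d9d326cc6ef496dc9dda31dfd083c72dd39c24c6c2ac47ebce3f2081446087324e;
0x302c5fde561eb3c9e74b3a94e30b098ddb4a4de251247741d2d75b815eea745815b753feba107efaa21e7c9132f;
-0xcfd63764481eacc48c0c90baf2a671cfda16d89e0730e12b2a658fcc2f824da2e7d87aa862d7cc6b475adce373;
0x38089a2d768641329fd43b9d8a0ca4518c9a5f634f73b17ff602259899b78f8b54be4a8989c5ab4f5e23a81348;
-0xf1ac4cf81c762fc7767b64420e41e3eb8ff6c94e03ebb4e3abebda2d634ebc9355281ec13b80525d5c9ff5be6;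
0x4122f16d583a8472ad8a4f4817bc94325c8c00412aa7761958f68640baf81bcb427fb60dcef03e5f6049d4dd9;
-0x118da7be414255306b835ecd103891b06455a8d5371670ed1916b1ba38319e728c8559991c39404fde11831af;
0x4bad0068ed0f0581f1c7876c5439b04e6c7e73f4c0be39117b2de91264cccb32a9a408924d078a95583a3584;
-0x14635f67685c816202ba0044916c011dd88a858efaa8d98878aa28e8e19149f6cd8158d1ceca9ced4144a09d;
0x57e00b89b65b7558b1bcc31dedb896eef762e349b137a73ea97b2ed1ff0a7efdaf53e9394a52dc3bd4c2ad4;
-0x17ab4da8a215f8175fb194bf3d9e6e9dab450b9191221be9aeacb93e56fa74540bd7547946fcd087ae74bf1;
0x65fe2e15f12f247c65c0a9ddb62e9a970dcc45e36ed246143bf9df59dee26326111cfe704432d6957e47ba;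
-0x1b7733f4d91f13378b92b1f085bf9e066135e477d65759bca5178512ea3d0194702bfa3ad47e2fe1c39ef4;
0x7653b577fba0b17a2c351305ff8c4ba27d2d4eb69b208c10996e98f4c3e043a7d986ac9809d7b77b73a16;
-0x1fdb908b86f6bd3453ed431d71b7e52946c663d6ba676ce1f0a3160fbcce1be953a20edb252e4ae52d47e;
0x8938b19299c4f67125f3c11ece51e5be68eb1bb5ac9aaaeca576099a9606f0aad71cfc41729c312dde24;
-0x24f009eca33445dd37138fbf6c62ce36a44610938a0fc6b381c75a940a07801e99ff8d6ed561635f0df0;
0x9f12c2366d39e0e4414be70c61548ca0110c9e1814985d4538ce86751779859f317aa8074e20675de76;
-0x2acfeab42640416df6544dd9b2faf0398b30c4973722a4ad853e2fc26bf77291946b977854fc1be11a1;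
0xb8572b06faff1108b4f995109fde19074981c8c2837f979b0d878508a8e6b2760d68bf70912381fbaa;
-0x319ab05c52ecb83d96ed22f10dd1ca64507e7624d069c38b2c16d203c6547887f34c67957c62b88ce6;
0xd58d388740acd5411d70811e7271a2e7c643e4c0b3bff4f4d525066271f88f91bbb2f856619a14f25;
-0x3974afc6ffdf03874f3a9c8a030d2b11940175ad07138bfc6983293d6fc0cd48aebe786efd299228c;
0xf75102a64e772f65bdf69a878c38db165fd8150e95ffbffa5b08d87774efa9d9a78db51d3136eea5;
-0x4287d2ddd2d40e9d74b3094dd955dc4df65d7266b91724e54c0431276852ed20d8d6137b18532267;
0x11e569b03e8097e38c7c2884f18deba18fc4899eb00da55114a8fb4e4eb2241229fd39ad6096c3ff;
-0x4d04731a056f0e6b6fd7fd97df2f4d14fb40063e999aa6bfbde85cc970d08b5d30698e777b00b3b;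
0x14b6db74d5d0ec93e75465a8433f5a74d261938dabe5e0b3a54e195ed6478cb1d23930c25e63e3e;
-0x592255586c75553f809d592d4703ac9a31770f9b5c6e3e39b87adde88e92eac7e0a42187736c84;
0x17f85ea8e96059aebf961fcbbd3477cb54d76a4326e32d66e2ccc37f36677387cb449f4073ed03;
-0x6721cc090903632b9838e3c3fcb5f185cf93b3ed371cba7722f6199075aa1ce7c8fee32695517;
0x1bbb3832f5e3387f5284c3ab3f07b0dfae8421c897969281a10a5c68c26385ef23be1b0e09092;
-0x774d058dcb2de7f56a6bff507ddcf6f88e9879c23d844d42b5e9822399d01ac197bbdcf41fb8; 0x20135269fcc1aa45abdc4a6b4741e0b35dee2476368bac75e05867d4d2915a59a76a1b404f52;
-0x89f98d7e456efd9f8a0d84f3fdffb193b8ab812c11b0e235abdbe3b48f6ec292e5e75936df9; 0x2517a47810cd413b8038dce1e85c3ee8c7627e707b685fa6a88007b59ea26b2c0b285ee0b30;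
-0x9f8a088a5dc1a59d147bdab8398ffbf0d932872075ba5fa7599f01ca5203c66af0d9790169; 0x2ae2a97750928d2cfad4e01573b22fc0756b2b03b27acfaccf18bd1c2ce77e07aee19a6488;
-0xb87033e1b76da72a9edca1e939c16563d613f119cf81ff40844fa6245c9e354d360d88dd2; 0x3192e9ac58a99812f5981b53d25fbfd8c07a63ac54610b04cef08761198276b2f26b958f4;
-0xd52f325e91f1822b511c2ecc67752ca06222ecc7b0a539812e34863a12bcc1789bd40c51; 0x394b989dc38c9196673fe1f17c87869d0721b65697a0820350f6be64da91f95bd89149ba;
-0xf65e33400695f41a475398d530f1ec29c31698d43d9f70d5d717ba0b486173b863ae766; 0x42354b32d5caca1d3d13a8d2a14293dce66ae26514dda5db067a5a2a3658eeee12fee4f;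
-0x11cab8008c7c53c9b12331cfa8518ce2552e2592164485c6ac2e9bc88e20d7331502a49; 0x4c7ec97e19c796be0ae297eb70d4371703795ea8d5a0fc7c8be2678aec2373e045851d;
-0x148e00125dc2b829dab83b3241935c656c4f70048cc81fd73117de064f793a7ba05698; 0x585e0065dc0b0a79ffdc23f0ad392839c8a217fda24a96ace2778d99da9d6c29a44d8;
-0x17be34b5eb2da25a3cf6c06073a6e4fa561d58d8b2cfb3322c40c26a0c3e1267502ef; 0x661117fefccc50c8288c4fd3e5b35aba76356caea6433da1446e5a9f2362ec3c29a5;
-0x1b6c04ac95ecd7e751d96a1e91c9ae05fdb68a2e7d758f9129189115e07899d9e907; 0x75dfb4299d19aac4c6d5937802b32920e9c733e933c12ba682913c7eef8757f80a2;
-0x1faaaa3209859229a67ae294e1479f770973418e1bbce3de6a35b158f960a52d8a2; 0x881c65d6826beffe382abaeeee83c7dba75c191f2e5f9b2dac7b941b28ee07b2f7;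
-0x24904e0f538609317419d628146e91eac7e4d7f2f2851f6a5152558c4eec771707; 0x9d265453e61a10925aa11794d9c672c66c9581c1a858508933b4bfc25a0e276a4;
-0x2a3679b5c879cee1a77268e468c09ff649fa68544f1af3aab5d75ec60700b8b6b; 0xb56b271daf176f5537c888a816050ca4fa8e9fecf9d836eb80522df5aaf15f39;
-0x30ba9aa85011df7c52b3997b85c849adf65f9e00fc70227052f79dfc436474c5; 0xd16939f5710a8073654e35d712fb0fc92d4b58e5ff7295461feffe102cc1b3d;
-0x383e99d1c4476256f181d10a8ee6aa15315ab588c6cd534a106b78fbb298587; 0xf1b226807b3d9bfcd1690e1a785448246cf32f7739d24e6cac8ecbe53a3a69;
-0x40e989cc6c9c2309fd8aa1b065e1655236ca8b2c1d11cb2605bbf894c68c87; 0x116edb05d3dea7f23e3d1f98cff99be0c56f3b8889072d9d17937c0310f88e;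
-0x4ae86f9348b3df411a1af1b8500b96017732c5fc08aa58cf51847b27d4c8f; 0x141dd2295eeebd4dd37e4f79975b5325c820ab3d8abf57cde253f5340f1f8;
-0x566f299c22d81dff9ef22cc7efc299633211852a9462c4b54fca37e1b3c8; 0x1735f2f9685a7de842d3916690fb9eaf5a22aa5e1946211e3a2951c894a5;
-0x63b979f3eb00dc9a22200c9f3f96dcbbf1f5ad326ab8645075709173b00; 0x1ac74676344557fb0d8c1277070eab9a154c07d5f8f561363174ab8527a;
-0x730c38a8b37de46b744541a2c8a0bc5b21d95c80995b149ae7fee8d8e9; 0x1ee445ac82ce06c502966a537b4b2a35a1ab556d54b24c0707f92c9684;
-0x84b6b49954d7380d37f8dbd039df7b48e092420a927b47b462d694ef3; 0x23a2385a8050d2da9e67b21953f857ee5fc4794e9ca4ce805ac08bfff;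
-0x991449ae49de81d0f2de3a70bf166cec42a77b81d7d3619693985261; 0x2919a1e8448871901dd2f466c4f35fc96d957626ddbf3e7c196abedb;
-0xb08e348e65f76671ef3516c2d75cad2d0d18a37f0b2a134640c92c5; 0x2f66bede28d2a32d570872976197e429f1aa6041cf457d54c25200b;
-0xcb9dad19f850eae352532c1801b41e1a5b5e8a1b5e6b931a98fb51; 0x36aa1556e641cdcdccc60a5ac4adb2159b6f3a9f1aed649c044daf;
-0xeace525de75d2673b17409ad950b31255c30c24832db2eac67d6c; 0x3f091b4bb13db1672b704a049d8640137978ec77a88f5794806e8;
-0x10ec0f44d65b72c0e57cab8420796bc707044c3e9e26216a245f6; 0x48aef607508a661111c0a16827856896fc0033e1b43cdec5e7e0;
-0x1382ec96c3b321868c6aa0c183030f14099eccaefe3c77a93284; 0x53cd568ca812d0664d13d2c8744d4743ef71547d583c1e67267;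
-0x167ed20b69a49d72f2ac09a429d5978ee0ff4c14a8ee1ae9e98; 0x609d774fe06d6ed9de6783d6f41c53d5b557e436c783e20d63;
-0x19ef1a288e50f1a2f777a2da0844d243c7a38237182c4ab9b5; 0x6f61404a1f390af917bcf90b90c7e693425799982ae8e2832;
-0x1de57361e05cfb77cdf6af68677449f9b0e7a867a7a1170d7; 0x80649731fe011e61a6bcda6e77295fc8affcaa0620391a11; -0x22763a47c5df6d55e3a48a663332005f7024a7235c3a0e1c;
0x93fee282695ad3c45d2131d55493e67ac1f4a9ab2e8b2fd; -0x27b8e1568357827115f0c4a123d419fc20cc2dc18e793f2; 0xaa94c6fab7c6637161105476d9a0d90a79fb1442930155;
-0x2dc868741eb7c29cb8831b4576ff97dcabb7cfecb11384; 0xc49a286aa88fb0396ea6613b1796b6d19b00f157adf94; -0x34c3e67abaa4c1e2f46447b6c0993846581939b5a1d31;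
0xe29477f16a72a43706b04a58f25e8cd4e3dfd32332cc; -0x3ccf278870dc80455b3d947a3507ca7329600b06427d; 0x1051d5b5e7c8d7ad2e53b96c4ecfdf9c945d00c36e28;
-0x46136336bc89bd038cd53d1f6d1d527be6b15296e49; 0x12ce5bb25e8a0df60182dc721cadf49b9afeac61bbe; -0x50c00e545f7b17d0f1a06c985304d6ab25479aa1c8;
0x15ab9465fdb10fe0f93e3bbca3ad69fef9d97067ff; -0x5d0bcc47b8d3ceabdd078431f6b72220d2633d4fc; 0x18f827ea0304c1f606111b565a5ad3082159b082d;
-0x6b3584df7d63dd04a224579a5c32f51aaf98e022; 0x1cc4f6020edababdbaf480b807a5400f97a6587e; -0x7b85a40fcf45c4aafb5f2a2ce44a6a4f07feaf4;
0x21256bdd046d40fcd533225e5bac210ff25d2e7; -0x8e4f89ed72a780015fdb61ff950246974d0a4e; 0x262fe6c5f50e378845260cd9e7960970d1c1a1;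
-0xa3f3322c7b116756c76dc6100046dc935af8c; 0x2bfe25b83b8eb8e4715d474ddf58c5d461ee7; -0xbcdf1b80119ea93c642c1112bbbbfc2f0a57;
0x32adcc151492fa1aba33e2b97c91d59219fb; -0xd992787b644bed7726a6f1cb7578173486a; 0x3a60f80f76508a09a79d99852a2b48bfbde; -0xfa9fb506bf9b5f027a62c3fd29c5518aa4;
0x433eefc661820fef9937e4625375754d1f; -0x120af5d2690fd9500aee09f88e01d97a4a; 0x4d74e87852ae6887dd797b8a368a9dea1; -0x14c8373bcfccf78884224ce59c5281acb;
0x5936ebbe1de897b11e2355986bd167eb; -0x17efb4a2373f3421168be1cc760539a4; 0x66c0df52ee139b582cdc002a6251257; -0x1b917ec0363b1d1b4d0226781fc16e4;
0x7657b49d551782e3946d7cb6a0feef; -0x1fc0135c079edd1538adb377184ffd; 0x884ac5f5c056f79a58922a6698c28; -0x2490baf22b5bb85e34d171bb132b5;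
0x9cf5688d2ba828820d88d546a446; -0x2a1bf47cb7b7c46a35a893bd7e5d; 0xb4c0bae01bfba2887c2b72e0237; -0x307df17728f135de392fb1fba88; 0xd025b8d2f69e0da3d96a0cc222;
-0x37d7249048491c55b6bdbcdc3f; 0xefaf9ff3afa9741586eaf589a; -0x404ce5d9d983b7b4ccb7eadcb; 0x113feaff06cfe881fee188acb; -0x4a0a2fb1f7dd656217ea1ff8;
0x13dcb552306ec4b7648060a2; -0x5540781e89019776d1b2922; 0x16de9cd2760e29173d0787a; -0x6228aae25f113bd4c992a9; 0x1a54e57d8e5a652246a172;
-0x710449385969299fac4f3; 0x1e51209d610a03bf465d5; -0x821eb4de49c487efe5b4; 0x22e7858d5b53842441b9; -0x95ceacf34fd4d0a5740; 0x282f57dc0967d6784cd;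
-0xac78042806883c2e45; 0x2e435ccb531bb95922; -0xc68d98df2e36e39d0; 0x3542627f073862896; -0xe49399291cde2754; 0x3d4fdb824a77d5d0; -0x107221e01a9a30f1;
0x469491b2c326ed4; -0x12ee82aeefced7c; 0x513f7415f9e3e6; -0x15caf2118439c6; 0x5d8683a4b10d8; -0x1915eb72f9d5c; 0x6ba7e3b38dd5; -0x1ce018a261b0; 0x7beb135363f;
-0x213ca5da056; 0x8ea255d149; -0x2641a26952; 0xa42c516b5; -0x2c086fe77; 0xbcf5ec5f; -0x32ae421e; 0xd97c71b; -0x3a54b23; 0xfa5008; -0x432268; 0x120169; -0x4d43e;
0x14b8f; -0x58ec; 0x17d9; -0x665; 0x1b7; -0x76].

(** [scale] times the mean of [x^2] under the density, as checked in [phi_H]. *)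
Definition m_coef : Z := 0x189213e112dbbc0d18ef31fab2200e5f32a9a6698c12b399a5f891f05de1b9d915c1feb2e271b43c10f319ad4a8f52128b6f63465971a13f4ac45d4305.

End Data.

(** * Integer data derived from the coefficients *)

Section Checks.
Local Open Scope Z_scope.

Definition eqZs (p q : seq Z) : bool := all2 Z.eqb p q.

Definition H_coefs : seq Z := Eval vm_compute in odd_ext E_coefs.
Definition X_coefs : seq Z := Eval vm_compute in odd_ext F_coefs.

Definition m_mul (a : Z) : Z := Z.shiftr (m_coef * a) 486.

(* The tridiagonal system [(8 + 2 z) D = p] factors through the root
   [r = 4 - sqrt 15] of [r + 1 / r = 8]. *)
Definition mul_r (a : Z) : Z := Z.shiftr ((2 ^ 502 - Z.sqrt (15 * 2 ^ 1000)) * a) 500.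

Fixpoint sweep_down (p : seq Z) : seq Z :=
  if p is a :: p' then
    let q := sweep_down p' in mul_r (a - head 0 q) :: q
  else [::].

Fixpoint sweep_up (d : Z) (p : seq Z) : seq Z :=
  if p is a :: p' then
    let d' := a - mul_r d in d' :: sweep_up d' p'
  else [::].

(** The two sweeps only guess the quotient; what the proof relies on is the residual bounded in
    [D_res_le]. *)
Definition D_coefs : seq Z := Eval vm_compute in sweep_up 0 (sweep_down (pint H_coefs)).

(* [2 * artanh (3 / 7) = ln (5 / 2)] *)
Fixpoint artanh_sum (n : nat) (k t : Z) : Z :=
  if n is n'.+1 then t ÷ k + artanh_sum n' (k + 2) ((9 * t) ÷ 49) else 0.

(** The first term is [2 * 3 / 7 = 6 / 7], and 190 terms suffice because [(9/49)^19 <= 10^-13]. *)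
Definition ln_coef : Z := artanh_sum 190 1 ((6 * scale) ÷ 7).

End Checks.

(** * Integer inequalities decided by computation *)

Section Certificates.
Local Open Scope Z_scope.

Fixpoint digits (s : seq nat) : Z :=
  if s is d :: s' then Z.of_nat d * 10 ^ Z.of_nat (size s') + digits s' else 0.

Definition lyap_digits : seq nat := [:: 6;5;7;6;6;1;7;8;0;0;0;6;5;9;7;6;7;7;5;4;1;5;8;2;4;1;3;8;2;3;8;3;2;0;6;5;7;4;3;2;4;1;0;6;9;5;8;0;0;1;2;2;0;1;9;5;3;9;5;2;8;0;2;6;9;1;6;3;2;6;6;6;1;1;1;5;5;4;0;2;3;7;5;9;5;5;6;4;5;9;7;5;2;9;1;5;1;7;4;8;2;9;6;4;2;1;5;6;3;3;1;7;9;8;0;2;6;3;0;1;4;8;8;5;9;4;8;9]%N.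

Definition diffusion_digits : seq nat := [:: 3;6;0;1;0;9;4;8;6;1;9;9;1;6;0;6;7;2;8;9;8;8;2;4;1;8;6;8;2;8;5;7;6;7;4;9;2;4;1;6;6;9;9;9;7;7;9;7;2;2;8;8;6;4;3;5;8;9;7;7;8;6;5;8;3;8;1;7;4;4;0;3;1;0;3;6;1;7;4;7;7;9;8;1;4;0;2;7;8;3;2;1;1;0;8;3;6;4;6;7;6;9;0;3;9;4;1;0;8;4;8;0;3;1;9;9;9;9;6;0;6;6;4;7]%N.

Lemma H_coefsE : eqZs (odd_ext E_coefs) H_coefs.
Proof. by vm_cast_no_check (erefl true). Qed.

Lemma X_coefsE : eqZs (odd_ext F_coefs) X_coefs.
Proof. by vm_cast_no_check (erefl true). Qed.

(** The residual of [h = P h], multiplied by [4 * scale]: [H_coefs] carries the factor 4 and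
    [transfer_poly] does not. *)
Lemma H_res_le : wnorm 1 (padd H_coefs (pscale (-4) (transfer_poly E_coefs))) <=? 2 ^ 44.
Proof. by vm_cast_no_check (erefl true). Qed.

(** The residual of [chi - P chi = (x^2 - m) h], multiplied by [64 * scale]: 4 from [odd_ext] and 16
    from [pphi]. *)
Lemma X_res_le : wnorm 1
  (padd (pscale 16 (padd X_coefs (pscale (-4) (transfer_poly F_coefs))))
    (padd (popp (pphi H_coefs)) (pscale 16 (pmapz m_mul H_coefs)))) <=? 2 ^ 64.
Proof. by vm_cast_no_check (erefl true). Qed.

Lemma D_res_le : wnorm 1
  (padd (padd (pscale 8 D_coefs) (pdbl D_coefs)) (popp (pint H_coefs))) <=? 2 ^ 20.
Proof. by vm_cast_no_check (erefl true). Qed.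

Lemma E_coefs_le : all (fun a => Z.abs a <=? scale) E_coefs.
Proof. by vm_cast_no_check (erefl true). Qed.

Lemma F_coefs_le : all (fun a => Z.abs a <=? scale) F_coefs.
Proof. by vm_cast_no_check (erefl true). Qed.

Lemma mass_H : Z.abs (pmean H_coefs - 4 * scale) <=? 2 ^ 40.
Proof. by vm_cast_no_check (erefl true). Qed.

Lemma phi_H : Z.abs (pmean (pphi H_coefs) - 64 * m_coef) <=? 2 ^ 40.
Proof. by vm_cast_no_check (erefl true). Qed.

Lemma mass_X : Z.abs (pmean X_coefs) <=? 4 * scale.
Proof. by vm_cast_no_check (erefl true). Qed.

(** A tenth of the last digit is allowed here; [lyap_near] and [ln_near] add [19 * tol], or 0.19 of
    a last digit, against the 2 claimed. *)
Lemma lyap_cert :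
  10 * Z.abs ((8 * ln_coef - pmean D_coefs) * 10 ^ 128 - digits lyap_digits * (8 * scale))
    <=? 8 * scale.
Proof. by vm_cast_no_check (erefl true). Qed.

(** The formula for [sigma^2] cleared of the denominator [1024 * scale^2]. This check takes 0.2 of
    the last digit and [diffusion_near] takes 2.7, against the 6 claimed. *)
Lemma diffusion_cert :
  10 * Z.abs ((2 * (16 * scale * pmean (pphi X_coefs) - 256 * m_coef * pmean X_coefs)
      - (scale * pmean (pphi (pphi H_coefs)) - 1024 * m_coef ^ 2)) * 10 ^ 124
      - digits diffusion_digits * (1024 * scale ^ 2))
    <=? 2 * (1024 * scale ^ 2).
Proof. by vm_cast_no_check (erefl true). Qed.

End Certificates.

(** * Enclosures *)

Section DecimalDigits.
Context {R : realType}.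

Lemma zrX (a : Z) (k : nat) : zr (Z.pow a (Z.of_nat k)) = zr a ^+ k :> R.
Proof.
elim: k => [|k IH]; first by rewrite expr0.
rewrite (_ : Z.of_nat k.+1 = Z.succ (Z.of_nat k)); last by lia.
by rewrite Z.pow_succ_r; [rewrite zrM IH exprS|lia].
Qed.

Lemma decfracE (l : seq nat) : decfrac l = zr (digits l) / 10 ^+ size l :> R.
Proof.
rewrite /decfrac; elim: l => [|d l IH]; first by rewrite big_ord0 zr0 mul0r.
rewrite big_ord_recl [size _]/= expr1.
rewrite (eq_bigr (fun i : 'I_(size l) => 10^-1 * ((nth 0%N l i)%:R / 10 ^+ i.+1))); last first.
  by move=> i _; rewrite [nth _ _ _]/= exprS invfM; ring.
rewrite -mulr_sumr IH [digits _]/= zrD zrM zrX !zr_nat (_ : zr 10 = 10)// exprS.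
by field; rewrite expf_neq0.
Qed.

End DecimalDigits.

(** * Numerical value of [ln (5/2)] *)

Section Logarithm.
Context {R : realType}.
Implicit Types x y : R.

(** The remainder after [n] terms vanishes at 0 and has derivative [2 x^(2n) / (1 - x^2)]; the mean
    value theorem bounds it by [2 * (49/40) * (3/7) * (9/49)^n]. *)
Lemma ln_ratio_series n y : 0 <= y <= 3 / 7 ->
  `|ln (1 + y) - ln (1 - y) - \sum_(k < n) 2 * y ^+ (2 * k).+1 / (2 * k).+1%:R|
    <= 3 * (9 / 49) ^+ n.
Proof.
move=> /andP[y0 y37].
pose S x := \sum_(k < n) 2 * x ^+ (2 * k).+1 / (2 * k).+1%:R.
pose f x := ln (1 + x) - ln (1 - x) - S x.
have dS x : is_derive x 1 S (\sum_(k < n) 2 * x ^+ (2 * k)).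
  pose g (k : 'I_n) (x : R) : R := 2 * x ^+ (2 * k).+1 / (2 * k).+1%:R.
  rewrite (_ : S = \sum_(k < n) g k); last first.
    by apply/funext => z; rewrite fct_sumE.
  apply: is_derive_sum => k.
  have dX : is_derive x 1 (fun z : R => z ^+ (2 * k).+1) ((2 * k).+1%:R * x ^+ (2 * k)).
    have := @is_deriveX _ _ id (2 * k).+1 x 1 1 (is_derive_id x 1).
    by rewrite exprfctE /GRing.scale/= mulr1.
  rewrite (_ : g k = fun z => (2 / (2 * k).+1%:R) * z ^+ (2 * k).+1); last first.
    by apply/funext => z; rewrite /g; ring.
  apply: is_derive_eq; rewrite /GRing.scale/=.
  by rewrite mulrA divfK ?pnatr_eq0.
have geo x : (1 - x ^+ 2) * \sum_(k < n) 2 * x ^+ (2 * k) = 2 - 2 * x ^+ (2 * n).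
  elim: (n) => [|k IH]; first by rewrite big_ord0 muln0 expr0; ring.
  by rewrite big_ord_recr/= mulrDr IH mulnS addSn add1n !exprS; ring.
have df x : 0 <= x <= 3 / 7 -> is_derive x 1 f ((1 - x ^+ 2)^-1 * (2 * x ^+ (2 * n))).
  move=> /andP[x0 x37].
  have x2 : 0 < 1 - x ^+ 2 by nra.
  have p1 : 0 < 1 + x by lra.
  have p2 : 0 < 1 - x by lra.
  have d1 : is_derive x 1 (fun z : R => ln (1 + z)) ((1 + x)^-1 * 1).
    have da : is_derive x 1 (fun z : R => 1 + z) 1.
      have := is_deriveD (is_derive_cst (1 : R) x 1) (is_derive_id x 1).
      by rewrite add0r.
    exact: (@is_derive1_comp _ (@ln R) (fun z : R => 1 + z) x _ _ (is_derive1_ln p1) da).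
  have d2 : is_derive x 1 (fun z : R => ln (1 - z)) ((1 - x)^-1 * (- 1)).
    have da : is_derive x 1 (fun z : R => 1 - z) (- 1).
      have := is_deriveB (is_derive_cst (1 : R) x 1) (is_derive_id x 1).
      by rewrite sub0r.
    exact: (@is_derive1_comp _ (@ln R) (fun z : R => 1 - z) x _ _ (is_derive1_ln p2) da).
  have d3 := dS x; rewrite /f; apply: is_derive_eq.
  have := geo x; set s := \sum_(k < n) _ => gx.
  have x0' : 1 - x ^+ 2 != 0 by rewrite gt_eqF.
  have q1 : 1 + x != 0 by rewrite gt_eqF.
  have q2 : 1 - x != 0 by rewrite gt_eqF.
  have -> : 2 * x ^+ (2 * n) = 2 - (1 - x ^+ 2) * s by rewrite gx; ring.
  rewrite mulrN1 opprK mulr1 mulrBr mulKf//; congr (_ - _).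
  by field; rewrite q1 q2 x0'.
have c0 : f 0 = 0.
  rewrite /f /S addr0 subr0 subrr sub0r big1 ?oppr0// => k _.
  by rewrite expr0n/= mulr0 mul0r.
have cf : {within `[0, y], continuous f}.
  apply: derivable_within_continuous => x /[!in_itv]/= /andP[x0 xy].
  have d := df x; apply: ex_derive; apply: d; lra.
have [x /[!in_itv]/= /andP[x0 xy]] : exists2 x, x \in `[0, y] &
    f y - f 0 = (1 - x ^+ 2)^-1 * (2 * x ^+ (2 * n)) * (y - 0).
  apply: MVT_segment => // x /[!in_itv]/= /andP[x0 xy].
  by apply: df; lra.
rewrite c0 !subr0 -/(S y) -/(f y) => ->.
have x2 : 40 / 49 <= 1 - x ^+ 2 by nra.
have xn : 0 <= x ^+ (2 * n) <= (9 / 49) ^+ n.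
  rewrite exprn_ge0//= exprM lerXn2r ?nnegrE ?sqr_ge0//; nra.
have v0 : 0 < (1 - x ^+ 2)^-1 <= 49 / 40.
  rewrite invr_gt0; apply/andP; split; first lra.
  by rewrite -[49 / 40]invrK lef_pV2 ?posrE//; lra.
move: xn v0; set a := x ^+ (2 * n); set v := (1 - x ^+ 2)^-1; set b := (9 / 49) ^+ n => /andP[? ?] /andP[? ?].
have v0' : 0 <= v by exact: ltW.
have va : 0 <= v * a <= 49 / 40 * b by rewrite mulr_ge0 ?ler_pM.
have -> : v * (2 * a) * y = 2 * (v * a) * y by ring.
move: va => /andP[? ?]; rewrite ger0_norm; first nra.
by rewrite !mulr_ge0//; lra.
Qed.

(** The invariant [|t - X| <= 2] survives a step because [2 * 9 / 49 + 1 < 2]; a term then costs at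
    most 1 for its own quotient and 2 for the error of [t]. *)
Lemma artanh_sum_err n k t (X : R) : `|zr t - X| <= 2 ->
  `|zr (artanh_sum n (Z.of_nat (2 * k).+1) t) - \sum_(j < n) X * (9 / 49) ^+ j / (2 * (k + j)).+1%:R|
    <= 3 * n%:R.
Proof.
elim: n k t X => [|n IH] k t X tX; first by rewrite big_ord0 subr0 zr0 normr0 mulr0.
rewrite (_ : artanh_sum n.+1 _ t = Z.add (Z.quot t (Z.of_nat (2 * k).+1))
    (artanh_sum n (Z.of_nat (2 * k.+1).+1) (Z.quot (Z.mul 9 t) 49))); last first.
  by cbn [artanh_sum]; congr (Z.add _ (artanh_sum _ _ _)); lia.
rewrite big_ord_recl expr0 mulr1 addn0 zrD.
set t' := Z.quot (Z.mul 9 t) 49.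
have t'X : `|zr t' - X * (9 / 49)| <= 2.
  have := zr_quot (R := R) (Z.mul 9 t) 48; rewrite zrM -/t' (_ : zr 9 = 9)//.
  by move: tX; norm_lra.
have := IH k.+1 t' _ t'X.
rewrite (eq_bigr (fun j : 'I_n => X * (9 / 49) ^+ j.+1 / (2 * (k + j.+1)).+1%:R)); last first.
  by move=> j _; rewrite exprS addSnnS (mulrA X (9 / 49)).
have q := zr_quot (R := R) t (2 * k).
have h : `|zr t / (2 * k).+1%:R - X / (2 * k).+1%:R| <= 2.
  rewrite -mulrBl normrM normfV [`|_.+1%:R|]ger0_norm//.
  by rewrite ler_pdivrMr ?ltr0n//; apply: le_trans tX _; rewrite ler_peMr// ler1n.
move: q h; set a := zr (Z.quot _ _); set b := zr t / _; set c := X / _.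
set A := zr (artanh_sum _ _ _); set B := \sum_(j < n) _.
rewrite -[n.+1%:R]natr1 !ler_norml => /andP[? ?] /andP[? ?] /andP[? ?].
by apply/andP; split; lra.
Qed.

Lemma ln_five_halves_err n (a : Z) :
  `|zr (artanh_sum n 1 (Z.quot (Z.mul 6 a) 7)) - zr a * ln (5 / 2)|
    <= 3 * n%:R + `|zr a| * (3 * (9 / 49) ^+ n) :> R.
Proof.
pose X : R := zr a * (6 / 7).
have hX : `|zr (Z.quot (Z.mul 6 a) 7) - X| <= 2.
  have := zr_quot (R := R) (Z.mul 6 a) 6; rewrite zrM (_ : zr 6 = 6)//.
  by rewrite /X !ler_norml => /andP[? ?]; apply/andP; split; lra.
have h1 := artanh_sum_err n 0 hX.
have h2 := @ln_ratio_series n (3 / 7) ltac:(lra).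
have eln : ln (1 + 3 / 7) - ln (1 - 3 / 7) = ln (5 / 2) :> R.
  have p1 : (1 + 3 / 7 : R) \is Num.pos by rewrite posrE; lra.
  have p2 : (1 - 3 / 7 : R) \is Num.pos by rewrite posrE; lra.
  by rewrite -ln_div//; congr ln; field.
rewrite eln in h2.
have eS : \sum_(j < n) X * (9 / 49) ^+ j / (2 * (0 + j)).+1%:R =
    zr a * \sum_(k < n) 2 * (3 / 7) ^+ (2 * k).+1 / (2 * k).+1%:R.
  rewrite mulr_sumr; apply: eq_bigr => j _; rewrite add0n exprS exprM /X.
  rewrite (_ : (3 / 7) ^+ 2 = 9 / 49); last by field.
  by rewrite !mulrA; congr (_ * _ / _); field.
rewrite eS in h1; set S := \sum_(k < n) _ in h1 h2.
rewrite (_ : _ - _ = (zr (artanh_sum n 1 (Z.quot (Z.mul 6 a) 7)) - zr a * S) - zr a * (ln (5 / 2) - S)); last by ring.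
apply: le_trans (ler_normB _ _) _; apply: lerD; first exact: h1.
by rewrite normrM ler_wpM2l.
Qed.

End Logarithm.

(** * From integer certificates to real enclosures *)

Section Enclosures.
Context {R : realType}.
Local Notation inv := (@inv_density R).
Implicit Types (x c e : R) (g p : seq Z).

Definition tol : R := (10 ^+ 130)^-1.

Lemma tol_gt0 : 0 < tol. Proof. by rewrite invr_gt0 exprn_gt0. Qed.

Lemma tol_le : 10 ^+ 6 * tol <= 1.
Proof. by rewrite ler_pdivrMr ?exprn_gt0// mul1r ler_weXn2l ?ler1n. Qed.

Lemma tol_pow (k j : nat) : (k + j = 130)%N -> (10 ^+ k)^-1 = 10 ^+ j * tol.
Proof. by move=> kj; rewrite /tol -kj exprD invfM mulrCA divff ?mulr1// expf_neq0. Qed.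

(** The exponent is [20 * 146], since [theta^20 <= 1 / 10]; of the 146 digits gained, 16 absorb the
    crude Lipschitz constants. *)
Lemma theta_tol : 10 ^+ 16 * theta ^+ 2920 <= tol.
Proof.
have t0 := ltW (@theta_gt0 R).
have t4 : theta ^+ 4 <= 617 / 10 ^+ 3 :> R by rewrite /theta; lra.
have t20 : theta ^+ 20 <= 10^-1 :> R.
  rewrite (exprM _ 4 5); apply: le_trans (_ : (617 / 10 ^+ 3) ^+ 5 <= _); last by lra.
  by apply: lerXn2r t4; rewrite nnegrE; [exact: exprn_ge0|lra].
have -> : 2920%N = (20 * 146)%N by [].
have h : theta ^+ (20 * 146) <= (10^-1) ^+ 146 :> R.
  by rewrite exprM lerXn2r ?nnegrE ?exprn_ge0.
apply: le_trans (ler_wpM2l _ h) _; first exact: exprn_ge0.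
by rewrite exprVn (exprD _ 16 130) invfM mulrA divff ?mul1r// expf_neq0.
Qed.

(** The scale, the lists and the outcomes of the checks stay abstract in this section, so that no
    tactic computes with the numerical data. *)
Variable s : Z.
Hypothesis s_tol : 10 ^+ 16 <= tol * zr s.

Definition unit_s : R := (zr s)^-1.
Local Notation u := unit_s.

Let s_gt0 : 0 < zr s :> R.
Proof. by rewrite -(pmulr_rgt0 _ tol_gt0); apply: lt_le_trans s_tol. Qed.

Let u_gt0 : 0 < u. Proof. by rewrite invr_gt0. Qed.

Let bounds : [/\ 0 < u, 10 ^+ 16 * u <= tol & 0 < tol].
Proof. by split; [exact: u_gt0|rewrite ler_pdivrMr|exact: tol_gt0]. Qed.

Lemma comp_err_le g : (size g <= 240)%N -> comp_err (size g) <= 8 * 10 ^+ 10 :> R.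
Proof.
move=> gn; rewrite /comp_err /step_err.
have b0 : 0 <= (size g)%:R :> R by [].
have b1 : (size g)%:R <= 240 :> R by rewrite ler_nat.
rewrite -[(size g * 2).+1%:R]natr1 natrM; move: b0 b1; set b := (size g)%:R => b0 b1.
set a := _ + 1; have a0 : 0 <= a by rewrite /a; lra.
have a1 : a <= 481 by rewrite /a; lra.
have a2 : a ^+ 2 <= 481 ^+ 2 by nra.
have b2 : b ^+ 2 <= 240 ^+ 2 by nra.
have := ler_pM (sqr_ge0 a) (sqr_ge0 b) a2 b2; lra.
Qed.

Definition hfun g x : R := u * odd_fun g x.

Lemma hfun_near g x : (size g <= 240)%N -> I01 x ->
  `|hfun g x - u / 4 * ev (odd_ext g) (1 - 2 * x)| <= tol / 1000.
Proof.
move=> gn Ix; have h := odd_ext_err g Ix; have c := comp_err_le gn.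
rewrite (_ : _ - _ = - (u / 4) * (ev (odd_ext g) (1 - 2 * x) - 4 * odd_fun g x)); last first.
  by rewrite /hfun; field.
rewrite normrM normrN (gtr0_norm (_ : 0 < u / 4)); last by have := u_gt0; lra.
have := ler_wpM2l (ltW u_gt0) (le_trans h (_ : _ <= 8 * 10 ^+ 11)).
by move=> /(_ ltac:(lra)); have [_ ? ?] := bounds; lra.
Qed.

Lemma hfun_res g x : (size g <= 240)%N -> I01 x ->
  `|hfun g x - transfer (hfun g) x -
    u / 4 * (ev (odd_ext g) (1 - 2 * x) - 4 * ev (transfer_poly g) (1 - 2 * x))|
  <= 36 * 10 ^+ 10 * u.
Proof.
move=> gn Ix; have h1 := odd_ext_err g Ix; have h2 := transfer_poly_err g Ix.
have c := comp_err_le gn; rewrite /hfun transferZ.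
move: h1 h2; set a := ev _ _; set b := ev _ _; set v := odd_fun g x; set w := transfer _ x => h1 h2.
have h : `|(a - 4 * v) - 4 * (b - w)| <= 144 * 10 ^+ 10.
  by apply: le_trans (ler_normB _ _) _; rewrite [`|4 * _|]normrM ger0_norm//; lra.
rewrite (_ : _ - _ = - (u / 4) * ((a - 4 * v) - 4 * (b - w))); last by field.
rewrite normrM normrN (gtr0_norm (_ : 0 < u / 4)); last by have := u_gt0; lra.
by have := ler_wpM2l (ltW u_gt0) h; lra.
Qed.

(** The crude constant [M] of the overview; being multiplied by [theta^2920], its size is
    harmless. *)
Lemma hfun_lip g : (size g <= 240)%N -> all (fun a => Z.leb (Z.abs a) s) g ->
  lip (hfun g) (8 * 240 ^+ 4) /\ lip (fun x => hfun g x - transfer (hfun g) x) (10 ^+ 11).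
Proof.
move=> gn /allP gs.
have {}gs a : a \in g -> `|zr a| <= zr s :> R.
  by move=> /gs/(zr_le (R := R)); rewrite zr_norm.
have [l1 l2] := odd_fun_lip gs (ltW s_gt0).
have n4 : (size g)%:R ^+ 4 <= 240 ^+ 4 :> R.
  by rewrite lerXn2r ?nnegrE// ler_nat.
have us c : u * (c * zr s) = c by rewrite mulrCA mulVf ?mulr1// gt_eqF.
have u1 := gtr0_norm u_gt0.
have k1 : lip (hfun g) (8 * 240 ^+ 4).
  apply: lip_le (lipZ u l1); rewrite u1 mulrA mulrCA mulrA (mulrC 8) -mulrA.
  by rewrite mulVf ?gt_eqF//; lra.
have k2 x : I01 x -> `|hfun g x| <= 3 * 240 ^+ 4.
  move=> Ix; rewrite normrM u1; apply: le_trans (ler_wpM2l (ltW u_gt0) (l2 _ Ix)) _.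
  by rewrite mulrCA us; lra.
split => //; apply: lip_le (lipB k1 (transfer_lip k1 k2)); lra.
Qed.

(** The bound 310 leaves room for two applications of [pphi] to a list of length at most 300, each
    adding at most 2. *)
Lemma mean_ev_near p c : (size p <= 310)%N -> 0 <= c <= u ->
  `|mean (fun x => c * ev p (1 - 2 * x)) - c * zr (pmean p)| <= tol / 1000.
Proof.
move=> pn /andP[c0 cu]; rewrite meanZ; last exact: bmeas_ev.
rewrite -mulrBr normrM ger0_norm//.
have h : `|mean (fun x => ev p (1 - 2 * x)) - zr (pmean p)| <= 310 :> R.
  by apply: le_trans (mean_ev p) _; rewrite ler_nat.
by have := ler_pM c0 (normr_ge0 _) cu h; have [_ ? ?] := bounds; lra.
Qed.

Lemma size_pphi p : (size (pphi p) <= size p + 2)%N.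
Proof.
apply: leq_trans (size_padd _ _) _; rewrite geq_max; apply/andP; split.
  by apply: leq_trans (size_pmapz _ _) _; rewrite leq_addr.
apply: leq_trans (size_padd _ _) _; rewrite geq_max; apply/andP; split.
  apply: leq_trans (size_pmapz _ _) _; apply: leq_trans (size_pdbl _) _.
  by rewrite addn2 leqnSn.
by apply: leq_trans (size_pdbl _) _; rewrite addn2 ltnS size_pdbl.
Qed.

Variables (gE H D : seq Z).
Hypothesis size_E : (size gE <= 240)%N.
Hypothesis size_H : (size H <= 300)%N.
Hypothesis size_D : (size D <= 300)%N.
Hypothesis E_le : all (fun a => Z.leb (Z.abs a) s) gE.
Hypothesis odd_ext_E : odd_ext gE = H.
Hypothesis H_res : Z.leb (wnorm 1 (padd H (pscale (-4) (transfer_poly gE)))) (Z.pow 2 44).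
Hypothesis D_res : Z.leb (wnorm 1 (padd (padd (pscale 8 D) (pdbl D)) (popp (pint H))))
  (Z.pow 2 20).
Hypothesis mass_H : Z.leb (Z.abs (Z.sub (pmean H) (Z.mul 4 s))) (Z.pow 2 40).

(** The polynomial twin of [hfun gE], equal to it up to rounding: the operator acts nicely on
    [hfun], while means are computed from [hpol]. *)
Definition hpol x : R := u / 4 * ev H (1 - 2 * x).

Lemma bmeas_hpol : bmeas hpol.
Proof. by apply: bmeasM; [exact: bmeas_cst|exact: bmeas_ev]. Qed.

Lemma mean_hpol : `|mean hpol - 1| <= tol / 300.
Proof.
have [u0 ut t0] := bounds.
have h1 : `|mean hpol - u / 4 * zr (pmean H)| <= tol / 1000.
  by apply: mean_ev_near; [exact: leq_trans size_H _|lra].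
have h2 : `|u / 4 * zr (pmean H) - 1| <= tol / 1000.
  rewrite (_ : _ - 1 = u / 4 * (zr (pmean H) - 4 * zr s)); last first.
    by rewrite /u; field; rewrite gt_eqF.
  rewrite normrM gtr0_norm; last by lra.
  have := ler_wpM2l (ltW u0) (zr_le (R := R) mass_H).
  by rewrite zr_norm zrB zrM (zrX 2 40); lra.
by move: h1 h2; norm_lra.
Qed.

(** The certified [2^44] dominates the residual, which stays below [62 / 10^5] units of [tol];
    multiplied by [3 * 2920] this is less than 5.5 units. *)
Lemma inv_near x : I01 x -> `|inv x - hpol x| <= 6 * tol.
Proof.
move=> Ix; have [u0 ut t0] := bounds.
have [l1 l2] := hfun_lip size_E E_le.
have near y : I01 y -> `|hfun gE y - hpol y| <= tol / 1000.
  by move=> Iy; rewrite /hpol -odd_ext_E; exact: hfun_near.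
have hr y : I01 y -> `|hfun gE y - transfer (hfun gE) y| <= 62 / 10 ^+ 5 * tol.
  move=> Iy; have h := hfun_res size_E Iy; rewrite odd_ext_E in h.
  have w := le_trans (ev_wnorm _ (abs_1B2x Iy)) (zr_le H_res); rewrite (zrX 2 44) in w.
  move: h w; rewrite evD evZ (_ : zr (-4) = - 4)// mulNr.
  set a := _ - transfer _ y; set b := _ - 4 * _ => h w.
  have {}w : `|u / 4 * b| <= u / 4 * 2 ^+ 44.
    by rewrite normrM gtr0_norm ?ler_wpM2l//; lra.
  have := ler_normD (a - u / 4 * b) (u / 4 * b); rewrite subrK; lra.
have hm : `|mean (hfun gE) - 1| <= tol / 200.
  have b1 := lip_bmeas l1.
  have := le_mean_norm (bmeasB b1 bmeas_hpol) near; rewrite meanB//; last exact: bmeas_hpol.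
  have := mean_hpol; norm_lra.
have := inv_density_approx 2920 l1 l2 hr hm Ix; have := near _ Ix.
have := theta_tol; move: (theta ^+ 2920) => th tth.
by norm_lra.
Qed.

Let binv : bmeas inv := lip_bmeas (@lip_inv_density R).

Lemma lyap_near : `|mean (fun x => ln (5 / 2 - x) * inv x) -
  (ln (5 / 2) - u / 8 * zr (pmean D))| <= 15 * tol.
Proof.
have [u0 ut t0] := bounds.
have h1 : `|mean (fun x => ln (5 / 2 - x) * inv x) -
    mean (fun x => ln (5 / 2 - x) * hpol x)| <= 2 * (6 * tol).
  rewrite -meanB; [|exact: bmeasM bmeas_ln binv|exact: bmeasM bmeas_ln bmeas_hpol].
  apply: le_mean_norm => [|x Ix].
    by apply: bmeasB; [exact: bmeasM bmeas_ln binv|exact: bmeasM bmeas_ln bmeas_hpol].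
  by rewrite -mulrBr normrM ler_pM ?ln_bounds ?inv_near.
have h2 : `|2 * mean (fun x => ln (5 / 2 - x) * ev H (1 - 2 * x)) -
    (ln (5 / 2) * (2 * mean (fun x => ev H (1 - 2 * x))) - mean (fun x => ev D (1 - 2 * x)))|
    <= 2 * 10 ^+ 5 :> R.
  apply: mean_ln_ev => z z1; have := le_trans (ev_wnorm _ z1) (zr_le D_res).
  rewrite (zrX 2 20).
  have := pint_err H z1; have : (size H)%:R <= 300 :> R by rewrite ler_nat.
  rewrite evD evD evZ ev_pdbl evN (_ : zr 8 = 8)//.
  move: (size H)%:R (ev (pint H) z) (prim H z) (ev D z) => n a b d.
  rewrite !ler_norml => hn /andP[? ?] /andP[? ?].
  by rewrite mulrDl; apply/andP; split; lra.
have e3 : mean (fun x => ln (5 / 2 - x) * hpol x) =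
    u / 4 * mean (fun x => ln (5 / 2 - x) * ev H (1 - 2 * x)).
  rewrite -meanZ; last exact: bmeasM bmeas_ln (bmeas_ev _).
  by apply: eq_mean => x _; rewrite /hpol mulrCA.
have e4 : mean hpol = u / 4 * mean (fun x => ev H (1 - 2 * x)).
  by rewrite -meanZ//; exact: bmeas_ev.
have h5 := @mean_ev_near D (u / 8) (leq_trans size_D _) _.
have {}h5 := h5 isT ltac:(lra).
rewrite meanZ in h5; last exact: bmeas_ev.
have h6 : `|ln (5 / 2) * (mean hpol - 1)| <= 2 * (tol / 300).
  rewrite normrM ler_pM ?mean_hpol//.
  by have := ln_bounds (@I01_0 R); rewrite subr0.
have {}h2 := ler_wpM2l (ltW u0) h2.
rewrite e4 in h6; rewrite e3 in h1; move: h1 h2 h5 h6.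
set a := mean _; set b := mean (fun x => _ * ev H _); set d := mean (fun x => ev H _).
set f := mean (fun x => ev D _); set l := ln (5 / 2); set q := zr (pmean D).
rewrite -[u in u * `|_|](gtr0_norm u0) -normrM => h1 h2 h5 h6.
rewrite (_ : a - _ = (a - u / 4 * b) + (u * (2 * b - (l * (2 * d) - f)) / 8 +
  l * (u / 4 * d - 1) - (u / 8 * f - u / 8 * q))); last by field.
move: h1 h2 h5 h6; move: (a - _) (u * (_ - _)) (l * (_ - 1)) (_ - u / 8 * q) => v1 v2 v3 v4.
norm_lra.
Qed.

Lemma cert_near (a p d q w : R) : 0 < p -> 0 < q -> 10 * `|a * p - d * q| <= w * q ->
  `|a / q - d / p| <= w / 10 * p^-1.
Proof.
move=> p0 q0 h; rewrite (_ : _ - _ = (a * p - d * q) / (p * q)); last first.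
  by field; rewrite !gt_eqF.
rewrite normrM normfV (gtr0_norm (mulr_gt0 p0 q0)) ler_pdivrMr ?mulr_gt0//.
by rewrite (_ : w / 10 * p^-1 * (p * q) = w * q / 10); [lra|field; rewrite gt_eqF].
Qed.

Variables (l dl : Z).
Hypothesis ln_near : `|u * zr l - ln (5 / 2)| <= 4 * tol.
Hypothesis lyap_c : Z.leb
  (Z.mul 10 (Z.abs (Z.sub (Z.mul (Z.sub (Z.mul 8 l) (pmean D)) (Z.pow 10 128))
    (Z.mul dl (Z.mul 8 s)))))
  (Z.mul 8 s).

Lemma lyapunov_bound :
  `|mean (fun x => ln (5 / 2 - x) * inv x) - zr dl / 10 ^+ 128| <= 2 / 10 ^+ 128.
Proof.
have p0 : 0 < 10 ^+ 128 :> R by rewrite exprn_gt0.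
have q0 : 0 < 8 * zr s :> R by rewrite mulr_gt0.
move: (zrX (R := R) 10 128) lyap_c; move: (Z.pow _ _) => P eP /(zr_le (R := R)).
rewrite !(zrM, zr_norm, zrB) eP -[X in _ <= X]mul1r => /(cert_near p0 q0).
have := lyap_near; have := ln_near.
have -> : (8 * zr l - zr (pmean D)) / (8 * zr s) = u * zr l - u / 8 * zr (pmean D) :> R.
  by rewrite /u; field; rewrite gt_eqF.
rewrite (tol_pow (erefl : 128 + 2 = 130)%N); have := tol_gt0.
move: (mean _) (ln (5 / 2)) (_ / 8 * _) (_ * zr l) (zr dl * _) => v1 v2 v3 v4 v5 t0.
norm_lra.
Qed.

Variables (gF X Hm : seq Z) (m : Z).
Hypothesis size_F : (size gF <= 240)%N.
Hypothesis size_X : (size X <= 300)%N.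
Hypothesis F_le : all (fun a => Z.leb (Z.abs a) s) gF.
Hypothesis odd_ext_F : odd_ext gF = X.
Hypothesis Hm_near : forall z : R, `|z| <= 1 -> `|ev Hm z - u * zr m * ev H z| <= 300 ^+ 2.
Hypothesis X_res : Z.leb (wnorm 1
  (padd (pscale 16 (padd X (pscale (-4) (transfer_poly gF))))
    (padd (popp (pphi H)) (pscale 16 Hm)))) (Z.pow 2 64).
Hypothesis phi_H : Z.leb (Z.abs (Z.sub (pmean (pphi H)) (Z.mul 64 m))) (Z.pow 2 40).
Hypothesis mass_X : Z.leb (Z.abs (pmean X)) (Z.mul 4 s).

Local Notation sq := (fun x : R => x ^+ 2).

Lemma lip_sqr : lip sq 2.
Proof.
move=> x y /I01E/andP[? ?] /I01E/andP[? ?].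
rewrite (_ : x ^+ 2 - y ^+ 2 = (x + y) * (x - y)); last by ring.
by rewrite normrM ler_wpM2r// ger0_norm; lra.
Qed.

Lemma sqr_le1 x : I01 x -> `|x ^+ 2| <= 1.
Proof. by move=> /I01E/andP[? ?]; rewrite ger0_norm ?sqr_ge0//; nra. Qed.

Let bsq : bmeas sq := lip_bmeas lip_sqr.

Lemma mean_mul_near (psi : R -> R) a : bmeas psi -> (forall x, I01 x -> `|psi x| <= 1) ->
  `|mean (fun x => psi x * hpol x) - a| <= tol / 100 ->
  `|mean (fun x => psi x * inv x) - a| <= 7 * tol.
Proof.
move=> bpsi psi1 h; have t0 := tol_gt0.
have h1 : `|mean (fun x => psi x * inv x) - mean (fun x => psi x * hpol x)| <= 1 * (6 * tol).
  rewrite -meanB; [|exact: bmeasM|exact: bmeasM bpsi bmeas_hpol].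
  apply: le_mean_norm => [|x Ix].
    by apply: bmeasB; [exact: bmeasM|exact: bmeasM bpsi bmeas_hpol].
  by rewrite -mulrBr normrM ler_pM ?psi1 ?inv_near.
move: h h1; norm_lra.
Qed.

Let mu0 : R := u * zr m.

Lemma mphi_near : `|mphi sq - mu0| <= 7 * tol.
Proof.
have [u0 ut t0] := bounds.
apply: mean_mul_near => //; first exact: sqr_le1.
have -> : mean (fun x => x ^+ 2 * hpol x) = mean (fun x => u / 64 * ev (pphi H) (1 - 2 * x)).
  by apply: eq_mean => x _; rewrite /hpol ev_pphi; field.
have sz : (size (pphi H) <= 310)%N.
  by apply: leq_trans (size_pphi _) _; exact: leq_trans (leq_add size_H (leqnn 2)) _.
have h1 := mean_ev_near sz (_ : 0 <= u / 64 <= u); have {}h1 := h1 ltac:(lra).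
have h2 : `|u / 64 * zr (pmean (pphi H)) - mu0| <= tol / 1000.
  rewrite (_ : _ - _ = u / 64 * (zr (pmean (pphi H)) - 64 * zr m)); last by rewrite /mu0; field.
  rewrite normrM gtr0_norm; last by lra.
  have := ler_wpM2l (ltW u0) (zr_le (R := R) phi_H).
  by rewrite zr_norm zrB zrM (zrX 2 40); lra.
move: h1 h2; norm_lra.
Qed.

Lemma fourth_near :
  `|mean (fun x => x ^+ 2 * x ^+ 2 * inv x) - u / 1024 * zr (pmean (pphi (pphi H)))| <= 7 * tol.
Proof.
have [u0 ut t0] := bounds.
apply: (mean_mul_near (psi := fun x => x ^+ 2 * x ^+ 2)).
- exact: bmeasM.
- by move=> x Ix; rewrite normrM -[1]mulr1 ler_pM ?sqr_le1.
have -> : mean (fun x => x ^+ 2 * x ^+ 2 * hpol x) =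
    mean (fun x => u / 1024 * ev (pphi (pphi H)) (1 - 2 * x)).
  by apply: eq_mean => x _; rewrite /hpol !ev_pphi; field.
have sz : (size (pphi (pphi H)) <= 310)%N.
  apply: leq_trans (size_pphi _) _; apply: leq_trans (leq_add (size_pphi H) (leqnn 2)) _.
  exact: leq_trans (leq_add (leq_add size_H (leqnn 2)) (leqnn 2)) _.
have h1 := mean_ev_near sz (_ : 0 <= u / 1024 <= u); have {}h1 := h1 ltac:(lra).
by apply: le_trans h1 _; lra.
Qed.

Let chi := hfun gF.

Lemma chi_near x : I01 x -> `|chi x - u / 4 * ev X (1 - 2 * x)| <= tol / 1000.
Proof. by move=> Ix; rewrite -odd_ext_F; exact: hfun_near. Qed.

Let bchi : bmeas chi. Proof. exact: lip_bmeas (hfun_lip size_F F_le).1. Qed.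

Lemma mean_chi_near : `|mean chi - u / 4 * zr (pmean X)| <= tol / 200.
Proof.
have [u0 ut t0] := bounds.
have bX : bmeas (fun x => u / 4 * ev X (1 - 2 * x)).
  by apply: bmeasM; [exact: bmeas_cst|exact: bmeas_ev].
have h1 := le_mean_norm (bmeasB bchi bX) chi_near; rewrite meanB// in h1.
have h2 := mean_ev_near (leq_trans size_X (_ : 300 <= 310)%N) (_ : 0 <= u / 4 <= u).
have {}h2 := h2 isT ltac:(lra).
move: h1 h2; norm_lra.
Qed.

Lemma mean_phi_chi_near :
  `|mean (fun x => x ^+ 2 * chi x) - u / 64 * zr (pmean (pphi X))| <= tol / 200.
Proof.
have [u0 ut t0] := bounds.
have bX : bmeas (fun x => x ^+ 2 * (u / 4 * ev X (1 - 2 * x))).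
  by apply: bmeasM => //; apply: bmeasM; [exact: bmeas_cst|exact: bmeas_ev].
have h x : I01 x -> `|x ^+ 2 * chi x - x ^+ 2 * (u / 4 * ev X (1 - 2 * x))| <= 1 * (tol / 1000).
  by move=> Ix; rewrite -mulrBr normrM ler_pM ?sqr_le1 ?chi_near.
have h1 := le_mean_norm (bmeasB (bmeasM bsq bchi) bX) h.
rewrite meanB// in h1; last exact: bmeasM.
have e : mean (fun x => x ^+ 2 * (u / 4 * ev X (1 - 2 * x))) =
    mean (fun x => u / 64 * ev (pphi X) (1 - 2 * x)).
  by apply: eq_mean => x _; rewrite ev_pphi; field.
rewrite e in h1.
have sz : (size (pphi X) <= 310)%N.
  by apply: leq_trans (size_pphi _) _; exact: leq_trans (leq_add size_X (leqnn 2)) _.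
have h2 := mean_ev_near sz (_ : 0 <= u / 64 <= u); have {}h2 := h2 ltac:(lra).
move: h1 h2; norm_lra.
Qed.

(** The second equation with the computed mean and density in place of the true ones; the certified
    [2^64 * u / 64] accounts for nearly 29 of the 30 units. *)
Lemma chi_res x : I01 x ->
  `|chi x - transfer chi x - (x ^+ 2 - mu0) * hpol x| <= 30 * tol.
Proof.
move=> Ix; have [u0 ut t0] := bounds.
have z1 := abs_1B2x Ix; have := hfun_res size_F Ix; rewrite odd_ext_F -/chi.
have := le_trans (ev_wnorm _ z1) (zr_le X_res); have := Hm_near z1.
rewrite (zrX 2 64).
rewrite evD evZ evD evZ evD evN evZ ev_pphi (_ : zr 16 = 16)// (_ : zr (-4) = - 4)//.
rewrite /hpol -/mu0; set z := 1 - 2 * x.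
move: (ev H z) (ev Hm z) (ev X z) (ev (transfer_poly gF) z) (chi x - _) => a b c d v h1 h2 h3.
have h4 : `|u * (b - mu0 * a)| <= u * 300 ^+ 2.
  by rewrite normrM (gtr0_norm u0) ler_wpM2l// ltW.
have {}h2 : `|u * (16 * (c + - 4 * d) + (- (16 * x ^+ 2 * a) + 16 * b))| <= u * 2 ^+ 64.
  by rewrite normrM (gtr0_norm u0) ler_wpM2l// ltW.
rewrite (_ : v - _ = (v - u / 4 * (c - 4 * d)) +
  u * (16 * (c + - 4 * d) + (- (16 * x ^+ 2 * a) + 16 * b)) / 64 -
  u * (b - mu0 * a) / 4); last by field.
move: h2 h3 h4; move: (u * (_ + (_ + _))) (v - _) (u * (b - _)) => v1 v2 v3.
norm_lra.
Qed.

Lemma hpol_le x : I01 x -> `|hpol x| <= 4.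
Proof.
move=> Ix; have := inv_near Ix; have i0 := inv_density_ge0 Ix; have i3 := inv_density_le3 Ix.
have := tol_le; have := tol_gt0.
by rewrite !ler_norml => ? ? /andP[? ?]; apply/andP; split; lra.
Qed.

(** Passing to the true density costs [2 * 6] units, passing to the true mean costs [7 * 4], and
    [chi_res] contributes 30. *)
Lemma poisson_res x : I01 x ->
  `|cphi sq x * inv x - (chi x - transfer chi x)| <= 71 * tol.
Proof.
move=> Ix; have t0 := tol_gt0.
have h1 : `|cphi sq x * (inv x - hpol x)| <= 2 * 1 * (6 * tol).
  by rewrite normrM ler_pM ?inv_near//; exact: cphi_le lip_sqr sqr_le1 _ Ix.
have h2 : `|(mu0 - mphi sq) * hpol x| <= 7 * tol * 4.
  by rewrite normrM ler_pM ?hpol_le// distrC mphi_near.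
have := chi_res Ix; move: h1 h2; rewrite /cphi.
move: (chi x - _) (mphi sq) (hpol x) (inv x) => v a b c h1 h2 h3.
rewrite (_ : _ - v = (x ^+ 2 - a) * (c - b) + (mu0 - a) * b - (v - (x ^+ 2 - mu0) * b)); last by ring.
move: h1 h2 h3; move: (_ * (c - b)) (_ * b) (v - _) => v1 v2 v3.
norm_lra.
Qed.

(** The main loss of accuracy: [2 * 2920 * 3 * 71 = 1243920] units. *)
Lemma csum_lim_near (t : R) : csum sq @ \oo --> t ->
  `|t - mean (fun x => cphi sq x * chi x)| <= 13 * 10 ^+ 5 * tol.
Proof.
move=> ct; have t0 := tol_gt0; have [l1 l2] := hfun_lip size_F F_le.
have lw := lip_w lip_sqr sqr_le1.
have [c hc] := csum_near lip_sqr sqr_le1 2920 l1 (lipB lw l2) poisson_res.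
set B := 2 * 1 * _ in hc.
have : `|t - mean (fun x => cphi sq x * chi x)| <= B + c * 0.
  have c1 : (fun n => `|csum sq n - mean (fun x => cphi sq x * chi x)|) @ \oo -->
      `|t - mean (fun x => cphi sq x * chi x)|.
    by apply: cvg_norm; apply: cvgB => //; exact: cvg_cst.
  have c2 : (fun n => B + c * theta ^+ n) @ \oo --> B + c * 0.
    apply: cvgD; first exact: cvg_cst.
    by apply: cvgMr; apply: cvg_expr; rewrite ger0_norm ?theta_lt1// ltW// theta_gt0.
  by apply: ler_cvg_to c1 c2 _; apply: nearW => n; exact: hc.
have := theta_tol; rewrite /B; move: (theta ^+ 2920) => th ?.
by rewrite mulr0 addr0 => h; apply: le_trans h _; lra.
Qed.

Lemma mul_near (a b c d e f : R) : `|a - c| <= e -> `|b - d| <= f -> `|b| <= 1 -> `|c| <= 2 ->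
  `|a * b - c * d| <= e + 2 * f.
Proof.
move=> h1 h2 b1 c2; rewrite (_ : _ - _ = (a - c) * b + c * (b - d)); last by ring.
apply: le_trans (ler_normD _ _) _; rewrite !normrM lerD//.
  by rewrite -[e]mulr1 ler_pM.
by rewrite ler_pM.
Qed.

Lemma diffusion_near : exists sg : R,
  (n%:R^-1 * second_moment sq n) @[n --> \oo] --> sg /\
  `|sg - (2 * (u / 64 * zr (pmean (pphi X)) - mu0 * (u / 4 * zr (pmean X))) -
     (u / 1024 * zr (pmean (pphi (pphi H))) - mu0 ^+ 2))| <= 27 * 10 ^+ 5 * tol.
Proof.
have t0 := tol_gt0; have t1 := tol_le; have u0 := u_gt0.
have [t ct] := csum_cvg lip_sqr sqr_le1.
exists (2 * t - corr sq 0); split; first exact: second_moment_cvg lip_sqr sqr_le1 _ ct.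
have bc : bmeas (cphi sq) by apply: bmeasB => //; exact: bmeas_cst.
have e1 : mean (fun x => cphi sq x * chi x) = mean (fun x => x ^+ 2 * chi x) - mphi sq * mean chi.
  rewrite -meanZ// -meanB; [|exact: bmeasM|by apply: bmeasM => //; exact: bmeas_cst].
  by apply: eq_mean => x _; rewrite mulrBl.
have e2 : corr sq 0 = mean (fun x => x ^+ 2 * x ^+ 2 * inv x) - mphi sq * mphi sq.
  have w0 := mean_cphi lip_sqr; have bw : bmeas (fun x => cphi sq x * inv x) by exact: bmeasM.
  (* Adds [mphi] times the vanishing mean of [cphi * inv], so that pointwise
     [(x^2 - m)^2 + m (x^2 - m) = x^4 - m x^2]. *)
  rewrite {1}/mphi -[LHS]addr0 -{1}(mulr0 (mphi sq)) -w0 -!meanZ//; last exact: bmeasM.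
  rewrite -meanB; [|exact: bmeasM (bmeasM bsq bsq) binv|by apply: bmeasM; [exact: bmeas_cst|exact: bmeasM]].
  rewrite -meanD; [|by apply: bmeasM|by apply: bmeasM; [exact: bmeas_cst|]].
  by rewrite -/(mphi sq); apply: eq_mean => x _ /=; rewrite /cphi; ring.
have hT := csum_lim_near ct; rewrite e1 in hT; rewrite e2.
have hm := mphi_near; have m1 := mphi_le lip_sqr sqr_le1.
have mu2 : `|mu0| <= 2.
  by move: hm m1; norm_lra.
have hmm := mul_near hm hm m1 mu2.
have b1 : `|u / 4 * zr (pmean X)| <= 1.
  rewrite normrM gtr0_norm; last by lra.
  have := ler_wpM2l (ltW u0) (zr_le (R := R) mass_X); rewrite zr_norm zrM.
  rewrite (_ : u * (zr 4 * zr s) = 4); first lra.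
  by rewrite mulrCA mulVf ?mulr1// gt_eqF.
have hc := mean_chi_near; have hpc := mean_phi_chi_near; have h4 := fourth_near.
have hc' : `|u / 4 * zr (pmean X) - mean chi| <= tol / 200 by rewrite distrC.
have hm' : `|mu0 - mphi sq| <= 7 * tol by rewrite distrC.
have hmc := mul_near hm' hc' b1 (le_trans m1 (ler1n _ 2)).
move: hT hpc h4 hmm hmc; rewrite expr2.
move: (mphi sq * mphi sq) (mphi sq * mean chi) (mu0 * mu0) (mu0 * (u / 4 * _)) => v1 v2 v3 v4.
move: (u / 64 * _) (u / 1024 * _) (mean _) (mean _) => v5 v6 v7 v8.
norm_lra.
Qed.

Variable dd : Z.
Hypothesis diffusion_c : Z.leb
  (Z.mul 10 (Z.abs (Z.sub
    (Z.mul
      (Z.sub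
        (Z.mul 2 (Z.sub (Z.mul (Z.mul 16 s) (pmean (pphi X))) (Z.mul (Z.mul 256 m) (pmean X))))
        (Z.sub (Z.mul s (pmean (pphi (pphi H)))) (Z.mul 1024 (Z.pow m 2))))
      (Z.pow 10 124))
    (Z.mul dd (Z.mul 1024 (Z.pow s 2))))))
  (Z.mul 2 (Z.mul 1024 (Z.pow s 2))).

Lemma diffusion_bound : exists sg : R,
  (n%:R^-1 * second_moment sq n) @[n --> \oo] --> sg /\
  `|sg - zr dd / 10 ^+ 124| <= 6 / 10 ^+ 124.
Proof.
have [sg [cv h1]] := diffusion_near; exists sg; split => //.
have p0 : 0 < 10 ^+ 124 :> R by rewrite exprn_gt0.
have q0 : 0 < 1024 * zr s ^+ 2 :> R by rewrite mulr_gt0 ?ltr0n ?exprn_gt0.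
move: h1; move: (zrX (R := R) m 2) (zrX (R := R) s 2) (zrX (R := R) 10 124) diffusion_c.
move: (Z.pow _ _) (Z.pow s _) (Z.pow m _) => P S2 M2 eM eS eP /(zr_le (R := R)).
rewrite !(zrM, zr_norm, zrB) eP eM eS => /(cert_near p0 q0).
rewrite /mu0.
set a := zr (pmean (pphi X)); set b := zr (pmean X); set c := zr (pmean _).
have -> : (2 * (16 * zr s * a - 256 * zr m * b) - (zr s * c - 1024 * zr m ^+ 2)) /
    (1024 * zr s ^+ 2) =
    2 * (u / 64 * a - u * zr m * (u / 4 * b)) - (u / 1024 * c - (u * zr m) ^+ 2).
  by rewrite /u; field; rewrite gt_eqF.
rewrite (tol_pow (erefl : 124 + 6 = 130)%N); have := tol_gt0.
move: (_ - (_ - (u * zr m) ^+ 2)) (zr dd * _) => v1 v2 t0.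
norm_lra.
Qed.

End Enclosures.

(** * Instantiation with the certified data *)

Section Conclusion.
Context {R : realType}.
Local Notation inv := (@inv_density R).

Lemma zr_scale : zr scale = 2 ^+ 486 :> R.
Proof. exact: (zrX 2 486). Qed.

Lemma scale_tol : 10 ^+ 16 <= tol * zr scale :> R.
Proof.
have h : zr (Z.pow 10 146) <= zr scale :> R by apply: zr_le.
have e : zr (Z.pow 10 146) = 10 ^+ 146 :> R by exact: (zrX 10 146).
rewrite e (exprD _ 16 130) in h.
by rewrite mulrC /tol ler_pdivlMr ?exprn_gt0.
Qed.

Lemma eqZsP p q : eqZs p q -> p = q.
Proof.
rewrite /eqZs; elim: p q => [|a p IH] [|b q] //=.
by move=> /andP[/Z.eqb_eq -> /IH ->].
Qed.

Lemma zr_shiftr (c a : Z) (k : nat) :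
  `|zr (Z.shiftr (Z.mul c a) (Z.of_nat k)) - (2 ^+ k)^-1 * zr c * zr a| <= 1 :> R.
Proof.
rewrite Z.shiftr_div_pow2; last by lia.
have sp : Z.lt 0 (Z.pow 2 (Z.of_nat k)) by lia.
have e := Z.div_mod (Z.mul c a) (Z.pow 2 (Z.of_nat k)) ltac:(lia).
have := Z.mod_pos_bound (Z.mul c a) _ sp.
move: e; set q := Z.div _ _; set r := Z.modulo _ _ => e [/Z.leb_le r0 /Z.lt_le_incl/Z.leb_le r1].
have {}r0 := zr_le (R := R) r0; have {}r1 := zr_le (R := R) r1.
have {}e := congr1 (@zr R) e; rewrite zrM zrD zrM in e; rewrite zrX (_ : zr 2 = 2)// in e r1.
have : 0 < 2 ^+ k :> R by rewrite exprn_gt0.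
move: r0 r1 e; move: (2 ^+ k) (zr r) => S r' r0 r1 e s0.
rewrite -mulrA e (_ : _ - _ = - (r' / S)); last by field; rewrite gt_eqF.
by rewrite normrN normrM normfV (gtr0_norm s0) (ger0_norm r0) ler_pdivrMr// mul1r.
Qed.

Lemma m_mul_near (z : R) : `|z| <= 1 ->
  `|ev (pmapz m_mul H_coefs) z - unit_s scale * zr m_coef * ev H_coefs z| <= 300 ^+ 2.
Proof.
have h a : `|zr (m_mul a) - unit_s scale * zr m_coef * zr a| <= 1 :> R.
  by rewrite /unit_s zr_scale; exact: (zr_shiftr m_coef a 486).
move=> z1; apply: le_trans (ev_round _ h ler01 z1) _.
rewrite mul1r; apply: lerXn2r; [exact: ler0n|exact: ler0n|].
by rewrite (ler_nat _ _ 300).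
Qed.

Lemma artanh_sum_near (a : Z) : 0 < zr a :> R -> 10 ^+ 16 <= tol * zr a :> R ->
  `|unit_s a * zr (artanh_sum 190 1 (Z.quot (Z.mul 6 a) 7)) - ln (5 / 2)| <= 4 * tol :> R.
Proof.
move=> a0 at0; have := @ln_five_halves_err R 190 a; rewrite (gtr0_norm a0).
have r : (9 / 49) ^+ 190 <= tol :> R.
  have r19 : (9 / 49) ^+ 19 <= (10 ^+ 13)^-1 :> R.
    have h19 : zr (Z.mul (Z.pow 9 19) (Z.pow 10 13)) <= zr (Z.pow 49 19) :> R by apply: zr_le.
    rewrite zrM (zrX 9 19) (zrX 10 13) (zrX 49 19) in h19.
    rewrite expr_div_n ler_pdivrMr ?exprn_gt0// mulrC ler_pdivlMr ?exprn_gt0//.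
  have -> : 190%N = (19 * 10)%N by [].
  have -> : tol = (10 ^+ 13)^-1 ^+ 10 :> R by rewrite /tol exprVn -exprM.
  rewrite exprM; apply: lerXn2r => //; rewrite nnegrE; first by apply: exprn_ge0; lra.
  by rewrite invr_ge0 exprn_ge0.
have ra := ler_wpM2l (ltW a0) r.
rewrite /unit_s; move: (zr (artanh_sum _ _ _)) (zr a) (ln _) a0 at0 ra => v S l S0 St ra h.
have e : `|v - S * l| <= S * (4 * tol).
  by apply: le_trans h _; move: ra; move: ((9 / 49) ^+ 190) => w ra; lra.
rewrite (_ : _ - l = (v - S * l) / S); last by field; rewrite gt_eqF.
by rewrite normrM normfV (gtr0_norm S0) ler_pdivrMr// [_ * S]mulrC.
Qed.

Lemma ln_coef_near : `|unit_s scale * zr ln_coef - ln (5 / 2)| <= 4 * tol :> R.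
Proof.
by rewrite /ln_coef; apply: artanh_sum_near scale_tol; rewrite zr_scale exprn_gt0.
Qed.

Let size_E : (size E_coefs <= 240)%N. Proof. by []. Qed.
Let size_F : (size F_coefs <= 240)%N. Proof. by []. Qed.
Let size_H : (size H_coefs <= 300)%N. Proof. by []. Qed.
Let size_X : (size X_coefs <= 300)%N. Proof. by []. Qed.
Let size_D : (size D_coefs <= 300)%N. Proof. by []. Qed.

Lemma lyapunov_value :
  `|mean (fun x => ln (5 / 2 - x) * inv x) - decfrac lyap_digits| <= 2 / 10 ^+ 128 :> R.
Proof.
rewrite decfracE (_ : size lyap_digits = 128)//.
exact: (lyapunov_bound scale_tol size_E size_H size_D E_coefs_le (eqZsP H_coefsE) H_res_le
  D_res_le mass_H ln_coef_near lyap_cert).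
Qed.

Lemma diffusion_value : exists sg : R,
  (n%:R^-1 * second_moment (fun x : R => x ^+ 2) n) @[n --> \oo] --> sg /\
  `|sg - decfrac diffusion_digits| <= 6 / 10 ^+ 124.
Proof.
rewrite decfracE (_ : size diffusion_digits = 124)//.
exact: (diffusion_bound scale_tol size_E size_H E_coefs_le (eqZsP H_coefsE) H_res_le mass_H
  size_F size_X F_coefs_le (eqZsP X_coefsE) m_mul_near X_res_le phi_H mass_X diffusion_cert).
Qed.

End Conclusion.

Theorem theorem5 (R : realType) (rho : R -> R) :
  acip_density lanford rho ->
  (exists L : R, lyap_integral lanford rho = L%:E /\
     `|L - decfrac [:: 6;5;7;6;6;1;7;8;0;0;0;6;5;9;7;6;7;7;5;4;1;5;8;2;4;1;3;8;2;3;8;3;2;0;6;5;7;4;3;2;4;1;0;6;9;5;8;0;0;1;2;2;0;1;9;5;3;9;5;2;8;0;2;6;9;1;6;3;2;6;6;6;1;1;1;5;5;4;0;2;3;7;5;9;5;5;6;4;5;9;7;5;2;9;1;5;1;7;4;8;2;9;6;4;2;1;5;6;3;3;1;7;9;8;0;2;6;3;0;1;4;8;8;5;9;4;8;9]%N|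
       <= 2 / 10 ^+ 128) /\
  (exists s : R, diffusion_seq lanford rho (fun x => x ^+ 2) @ \oo --> s /\
     `|s - decfrac [:: 3;6;0;1;0;9;4;8;6;1;9;9;1;6;0;6;7;2;8;9;8;8;2;4;1;8;6;8;2;8;5;7;6;7;4;9;2;4;1;6;6;9;9;9;7;7;9;7;2;2;8;8;6;4;3;5;8;9;7;7;8;6;5;8;3;8;1;7;4;4;0;3;1;0;3;6;1;7;4;7;7;9;8;1;4;0;2;7;8;3;2;1;1;0;8;3;6;4;6;7;6;9;0;3;9;4;1;0;8;4;8;0;3;1;9;9;9;9;6;0;6;6;4;7]%N|
       <= 6 / 10 ^+ 124).
Proof.
move=> rhoP; split.
  exists (mean (fun x => ln (5 / 2 - x) * inv_density x)).
  by split; [exact: lyap_integralE|exact: lyapunov_value].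
have [sg [cv h]] := @diffusion_value R; exists sg; split; last exact: h.
rewrite (_ : diffusion_seq _ _ _ = fun n => n%:R^-1 * second_moment (fun x : R => x ^+ 2) n)//.
by apply/funext => n; exact: diffusion_seqE (@lip_sqr R) _ rhoP n.
Qed.
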